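(* Let $d\ge1$, $m\ge0$ be integers and let $\mathbf{a}:\mathbb{R}\times\mathbb{R}\times\mathbb{R}^d\to\mathbb{R}^d$ and $\mathbf{b}:\mathbb{R}\times\mathbb{R}^d\to\mathbb{R}^d$ satisfy: $\mathbf{a}\in(C_b^{m+1}(\mathbb{R}\times\mathbb{R}\times\mathbb{R}^d))^d$; $\theta\mapsto\mathbf{a}(t,\theta,\mathbf{x})$ is $2\pi$-periodic for every $t\in\mathbb{R}$, $\mathbf{x}\in\mathbb{R}^d$; $\mathbf{b}\in(C_b^{m+2}(\mathbb{R}\times\mathbb{R}^d))^d$. Suppose that the solution $\mathbf{Z}(t,\theta;\mathbf{z})$ of $\frac{\partial\mathbf{Z}}{\partial\theta}=\mathbf{b}(t,\mathbf{Z})$, $\mathbf{Z}(t,0;\mathbf{z})=\mathbf{z}$, is $2\pi$-periodic in $\theta$ for every $t\in\mathbb{R}$, $\mathbf{z}\in\mathbb{R}^d$. Let $\tilde\alpha^k$, $\tilde{\mathbf{a}}^k$, $\tilde{\mathbf{A}}^k$ be the functions defined recursively in the context. For $\mathbf{x}\in\mathbb{R}^d$, $s\in\mathbb{R}$, $T>0$, $\varepsilon>0$, let $\mathbf{X}_\varepsilon=\mathbf{X}_\varepsilon(t;\mathbf{x},s)$ be the solution of $$\frac{d\mathbf{X}_\varepsilon}{dt}=\mathbf{a}\Big(t,\frac{t-s}{\varepsilon},\mathbf{X}_\varepsilon\Big)+\frac1\varepsilon\mathbf{b}(t,\mathbf{X}_\varepsilon),\qquad \mathbf{X}_\varepsilon(s;\mathbf{x},s)=\mathbf{x}.$$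 Let $\mathbf{Y}^0$ be the solution of $\frac{d\mathbf{Y}^0}{dt}=\tilde{\mathbf{a}}^0(t,\mathbf{Y}^0)$, $\mathbf{Y}^0(s;\mathbf{x},s)=\mathbf{x}$, and for $k=1,\dots,m$ let $\mathbf{Y}^k$ be the solution of $\frac{d\mathbf{Y}^k}{dt}=\tilde{\mathbf{a}}^k(t,\mathbf{Y}^0,\dots,\mathbf{Y}^k)$, $\mathbf{Y}^k(s;\mathbf{x},s)=0$. Set $\mathbf{X}^0(t,\theta;\mathbf{x},s)=\mathbf{Z}(t,\theta;\mathbf{Y}^0(t;\mathbf{x},s))$ and, for $k=1,\dots,m$, $$\mathbf{X}^k(t,\theta;\mathbf{x},s)=\sum_{p=1}^k\frac1{p!}\sum_{\substack{j_1,\dots,j_p\ge1\\ j_1+\dots+j_p=k}}\{\nabla_z^{\,p}\mathbf{Z}(t,\theta;\mathbf{Y}^0(t;\mathbf{x},s))\}\{\mathbf{H}^{j_1},\dots,\mathbf{H}^{j_p}\},$$ where $\mathbf{H}^j=\mathbf{H}^j(t,\theta)=\mathbf{Y}^j(t;\mathbf{x},s)+\theta\tilde{\mathbf{A}}^{j-1}(t,\theta,\mathbf{Y}^0(t;\mathbf{x},s),\dots,\mathbf{Y}^{j-1}(t;\mathbf{x},s))$. For $k=1,\dots,m$ define $$\mathbf{X}^k_\varepsilon(t;\mathbf{x},s)=\frac1{\varepsilon^k}\Big(\mathbf{X}_\varepsilon(t;\mathbf{x},s)-\sum_{i=0}^{k-1}\varepsilon^i\,\mathbf{X}^i\Big(t,\frac{t-s}\varepsilon;\mathbf{x},s\Big)\Big).$$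 Then, for any $\mathbf{x}\in\mathbb{R}^d$, $s\in\mathbb{R}$ and $T>0$, the families $(\mathbf{X}^k_\varepsilon(\cdot;\mathbf{x},s))_{\varepsilon>0}$, for $k=1,\dots,m$, are bounded in $L^\infty([s,s+T])$ and $$\lim_{\varepsilon\to0}\ \sup_{t\in[s,s+T]}\Big|\mathbf{X}^k_\varepsilon(t;\mathbf{x},s)-\mathbf{X}^k\Big(t,\frac{t-s}\varepsilon;\mathbf{x},s\Big)\Big|=0\qquad(k=1,\dots,m).$$
   Context: $C_b^{m}$: functions having continuous and bounded derivatives up to order $m$ (order $0$ included). $|\cdot|$: Euclidean norm. $\nabla_z\mathbf{Z}$: Jacobian matrix of $\mathbf{z}\mapsto\mathbf{Z}(t,\theta;\mathbf{z})$. For a vector field $F$ of a variable $\mathbf{y}\in\mathbb{R}^d$ and $p\ge1$, $\{\nabla_y^{\,p}F\}\{\mathbf{h}^1,\dots,\mathbf{h}^p\}$ is the vector with $i$-th component $\sum_{l_1,\dots,l_p=1}^d\frac{\partial^pF_i}{\partial y_{l_1}\cdots\partial y_{l_p}}h^1_{l_1}\cdots h^p_{l_p}$. Definition of $\tilde\alpha^k,\tilde{\mathbf{a}}^k,\tilde{\mathbf{A}}^k$ (with $t,\theta\in\mathbb{R}$, $\mathbf{y}^0,\dots,\mathbf{y}^k\in\mathbb{R}^d$). For $k=0$: $$\tilde\alpha^0(t,\theta,\mathbf{y}^0)=\{\nabla_z\mathbf{Z}(t,\theta;\mathbf{y}^0)\}^{-1}\Big\{\mathbf{a}(t,\theta,\mathbf{Z}(t,\theta;\mathbf{y}^0))-\frac{\partial\mathbf{Z}}{\partial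 t}(t,\theta;\mathbf{y}^0)\Big\}.$$ For all $k\ge0$: $$\tilde{\mathbf{a}}^k(t,\mathbf{y}^0,\dots,\mathbf{y}^k)=\frac1{2\pi}\int_0^{2\pi}\tilde\alpha^k(t,\theta,\mathbf{y}^0,\dots,\mathbf{y}^k)\,d\theta,\qquad \tilde{\mathbf{A}}^k(t,\theta,\mathbf{y}^0,\dots,\mathbf{y}^k)=\frac1\theta\int_0^\theta\tilde\alpha^k(t,\sigma,\mathbf{y}^0,\dots,\mathbf{y}^k)\,d\sigma-\tilde{\mathbf{a}}^k(t,\mathbf{y}^0,\dots,\mathbf{y}^k),$$ so that $\theta\tilde{\mathbf{A}}^k=\int_0^\theta\tilde\alpha^k\,d\sigma-\theta\tilde{\mathbf{a}}^k$ (also at $\theta=0$, where it is $0$). For $k\ge1$, writing $\mathbf{h}^j=\mathbf{y}^j+\theta\tilde{\mathbf{A}}^{j-1}(t,\theta,\mathbf{y}^0,\dots,\mathbf{y}^{j-1})$ for $j\ge1$, $$\tilde\alpha^k(t,\theta,\mathbf{y}^0,\dots,\mathbf{y}^k)=\sum_{p=1}^k\frac1{p!}\sum_{\substack{j_1,\dots,j_p\ge1\\ j_1+\dots+j_p=k}}\{\nabla_{y^0}^{\,p}\tilde\alpha^0(t,\theta,\mathbf{y}^0)\}\{\mathbf{h}^{j_1},\dots,\mathbf{h}^{j_p}\}$$ $$\qquad-\theta\Big(\sum_{j=0}^{k-1}\{\nabla_{y^j}\tilde{\mathbf{A}}^{k-1}(t,\theta,\mathbf{y}^0,\dots,\mathbf{y}^{k-1})\}\{\tilde{\mathbf{a}}^j(t,\mathbf{y}^0,\dots,\mathbf{y}^j)\}+\frac{\partial\tilde{\mathbf{A}}^{k-1}}{\partial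 t}(t,\theta,\mathbf{y}^0,\dots,\mathbf{y}^{k-1})\Big).$$ *)

(* Defs.v *)
From HB Require Import structures.
From mathcomp Require Import all_boot all_order all_algebra.
From mathcomp Require Import all_classical all_reals all_analysis.

Set Implicit Arguments.
Unset Strict Implicit.
Unset Printing Implicit Defensive.

Import Order.TTheory GRing.Theory Num.Theory.
Import numFieldNormedType.Exports.

Local Open Scope classical_set_scope.
Local Open Scope ring_scope.

(* [E] lists the coordinate directions of [V], so that the iterated ['D_e] are
   the partial derivatives. *)
Fixpoint Cb (R : realType) (V : normedModType R) (E : seq V) (n : nat)
    (f : V -> R) : Prop :=
  [/\ continuous f, bounded_fun f &
      if n is n'.+1 then
        forall e, e \in E -> (forall x, derivable f x e) /\ Cb E n' ('D_e f)
      else True].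

Definition axes_x (R : realType) (d : nat) : seq (R * 'cV[R]_d) :=
  (1, 0) :: [seq (0, delta_mx i 0) | i <- enum 'I_d].

Definition axes_tx (R : realType) (d : nat) : seq (R * R * 'cV[R]_d) :=
  (1, 0, 0) :: (0, 1, 0) :: [seq (0, 0, delta_mx i 0) | i <- enum 'I_d].

(* The norm that the library puts on matrices is the sup norm. *)
Definition enorm (R : realType) (d : nat) (v : 'cV[R]_d) : R :=
  Num.sqrt (\sum_i v i 0 ^+ 2).

Definition bounded_in_Linfty (R : realType) (d : nat) (u v : R)
    (F : R -> R -> 'cV[R]_d) : Prop :=
  (forall eps, 0 < eps -> forall i,
     measurable_fun `[u, v] (fun t => F eps t i 0)) /\
  exists M : R, forall eps, 0 < eps ->
    (Lnorm (mrestr lebesgue_measure (measurable_itv `[u, v])) +oo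
       (fun t => (enorm (F eps t))%:E) <= M%:E)%E.

Definition jac (R : realType) (d : nat) (F : 'cV[R]_d -> 'cV[R]_d)
    (z : 'cV[R]_d) : 'M[R]_d :=
  \matrix_(i, j) 'D_(delta_mx j 0) (fun z' => F z' i 0) z.

Definition partials (R : realType) (d : nat) (l : seq 'I_d)
    (f : 'cV[R]_d -> R) : 'cV[R]_d -> R :=
  foldr (fun i g => 'D_(delta_mx i 0) g) f l.

Definition nabla (R : realType) (d p : nat) (F : 'cV[R]_d -> 'cV[R]_d)
    (y : 'cV[R]_d) (h : 'I_p -> 'cV[R]_d) : 'cV[R]_d :=
  \col_i \sum_(l : p.-tuple 'I_d)
    partials l (fun y' => F y' i 0) y * \prod_(q < p) h q (tnth l q) 0.

(* sum_{p=1}^k 1/p! sum_{j_1+...+j_p = k, j_q >= 1}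
     {nabla^p F(y)} {h j_1, ..., h j_p} *)
Definition compsum (R : realType) (d k : nat) (F : 'cV[R]_d -> 'cV[R]_d)
    (y : 'cV[R]_d) (h : nat -> 'cV[R]_d) : 'cV[R]_d :=
  \sum_(1 <= p < k.+1) (p`!%:R)^-1 *:
    \sum_(j : p.-tuple 'I_k.+1 |
            [forall q, (0 < tnth j q)%N] && (\sum_(q < p) tnth j q == k)%N)
      nabla F y (fun q : 'I_p => h (tnth j q)).

Definition vint (R : realType) (d : nat) (f : R -> 'cV[R]_d) (u v : R) :
    'cV[R]_d :=
  \col_i (if u <= v then \int[lebesgue_measure]_(x in `[u, v]) f x i 0
          else - \int[lebesgue_measure]_(x in `[v, u]) f x i 0).

(* A tuple (y^0, ..., y^k) is given as a sequence [nat -> 'cV_d] of which only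
   the first k+1 terms matter; see [alpha_eq_upto] below. *)
Definition upd (T : Type) (y : nat -> T) (j : nat) (u : T) : nat -> T :=
  fun i => if i == j then u else y i.

Definition vfield (R : realType) (d : nat) :=
  R -> R -> (nat -> 'cV[R]_d) -> 'cV[R]_d.

Definition mean (R : realType) (d : nat) (f : vfield R d) (t : R)
    (y : nat -> 'cV[R]_d) : 'cV[R]_d :=
  (2 * pi)^-1 *: vint (fun th => f t th y) 0 (2 * pi).

(* At [th = 0] this is [- mean f t y]; it is only used multiplied by [th]. *)
Definition osc (R : realType) (d : nat) (f : vfield R d) : vfield R d :=
  fun t th y => th^-1 *: vint (fun sg => f t sg y) 0 th - mean f t y.

Definition alpha0 (R : realType) (d : nat)
    (a Z : R -> R -> 'cV[R]_d -> 'cV[R]_d) (t th : R) (z : 'cV[R]_d) :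
    'cV[R]_d :=
  invmx (jac (Z t th) z) *m (a t th (Z t th z)
                              - derive1 (fun t' => Z t' th z) t).

Definition alpha_step (R : realType) (d : nat)
    (a Z : R -> R -> 'cV[R]_d -> 'cV[R]_d) (al : nat -> vfield R d) (k : nat) :
    vfield R d :=
  fun t th y =>
    compsum k (alpha0 a Z t th) (y 0%N)
      (fun j => y j + th *: osc (al j.-1) t th y)
    - th *: (\sum_(j < k) nabla (fun u => osc (al k.-1) t th (upd y j u)) (y j)
                            (fun _ : 'I_1 => mean (al j) t y)
             + derive1 (fun t' => osc (al k.-1) t' th y) t).

(* The [k]-th field depends on all the previous ones, hence the course-of-values
   recursion: [alpha_upto a Z n] is correct at the indices up to [n].  The
   defining equations are [alpha_0] and [alpha_S]. *)
Fixpoint alpha_upto (R : realType) (d : nat)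
    (a Z : R -> R -> 'cV[R]_d -> 'cV[R]_d) (n : nat) : nat -> vfield R d :=
  if n is n'.+1 then
    fun k => if (k <= n')%N then alpha_upto a Z n' k
             else alpha_step a Z (alpha_upto a Z n') k
  else fun _ t th y => alpha0 a Z t th (y 0%N).

Definition alpha (R : realType) (d : nat)
    (a Z : R -> R -> 'cV[R]_d -> 'cV[R]_d) (k : nat) : vfield R d :=
  alpha_upto a Z k k.

Definition abar (R : realType) (d : nat)
    (a Z : R -> R -> 'cV[R]_d -> 'cV[R]_d) (k : nat) (t : R)
    (y : nat -> 'cV[R]_d) : 'cV[R]_d :=
  mean (alpha a Z k) t y.

Definition Abar (R : realType) (d : nat)
    (a Z : R -> R -> 'cV[R]_d -> 'cV[R]_d) (k : nat) : vfield R d :=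
  osc (alpha a Z k).

Lemma alpha_uptoS (R : realType) (d : nat)
    (a Z : R -> R -> 'cV[R]_d -> 'cV[R]_d) n k :
  alpha_upto a Z n.+1 k = if (k <= n)%N then alpha_upto a Z n k
                          else alpha_step a Z (alpha_upto a Z n) k.
Proof. by []. Qed.

Lemma alpha_uptoE (R : realType) (d : nat)
    (a Z : R -> R -> 'cV[R]_d -> 'cV[R]_d) n k :
  (k <= n)%N -> alpha_upto a Z n k = alpha a Z k.
Proof.
elim: n k => [|n IH] k; first by rewrite leqn0 => /eqP->.
rewrite leq_eqVlt => /predU1P[->//|]; rewrite ltnS => kn.
by rewrite alpha_uptoS kn IH.
Qed.

Lemma eq_compsum (R : realType) (d k : nat) (F : 'cV[R]_d -> 'cV[R]_d) y h h' :
  (forall j, (0 < j <= k)%N -> h j = h' j) ->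
  compsum k F y h = compsum k F y h'.
Proof.
move=> hh'; apply: eq_bigr => p _; congr (_ *: _).
apply: eq_bigr => j /andP[/forallP j0 _]; congr nabla; apply/funext => q.
by apply: hh'; rewrite j0 -ltnS ltn_ord.
Qed.

Lemma eq_subscale (R : pzRingType) (V : lmodType R) (c : R)
    (u u' v v' w w' : V) :
  u = u' -> v = v' -> w = w' -> u - c *: (v + w) = u' - c *: (v' + w').
Proof. by move=> -> -> ->. Qed.

Lemma eq_alpha_step (R : realType) (d : nat)
    (a Z : R -> R -> 'cV[R]_d -> 'cV[R]_d) (al al' : nat -> vfield R d) k t th y :
  (0 < k)%N -> (forall j, (j < k)%N -> al j = al' j) ->
  alpha_step a Z al k t th y = alpha_step a Z al' k t th y.
Proof.
move=> k0 alal'.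
have E : al k.-1 = al' k.-1 by apply: alal'; rewrite ltn_predL.
rewrite /alpha_step E; apply: eq_subscale.
- by apply: eq_compsum => j /andP[j0 jk]; rewrite alal'// prednK.
- by apply: eq_bigr => j _; rewrite alal'.
- by [].
Qed.

Lemma alpha_0 (R : realType) (d : nat)
    (a Z : R -> R -> 'cV[R]_d -> 'cV[R]_d) t th y :
  alpha a Z 0 t th y = alpha0 a Z t th (y 0%N).
Proof. by []. Qed.

Lemma alpha_S (R : realType) (d : nat)
    (a Z : R -> R -> 'cV[R]_d -> 'cV[R]_d) k t th y :
  alpha a Z k.+1 t th y =
    compsum k.+1 (alpha0 a Z t th) (y 0%N)
      (fun j => y j + th *: Abar a Z j.-1 t th y)
    - th *: (\sum_(j < k.+1)
               nabla (fun u => Abar a Z k t th (upd y j u)) (y j)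
                 (fun _ : 'I_1 => abar a Z j t y)
             + derive1 (fun t' => Abar a Z k t' th y) t).
Proof.
rewrite {1}/alpha alpha_uptoS ltnn (eq_alpha_step _ _ _ _ _ (al' := alpha a Z))//.
by move=> j jk; apply: alpha_uptoE; rewrite -ltnS.
Qed.

Lemma eq_mean (R : realType) (d : nat) (f : vfield R d) t y y' :
  (forall th, f t th y = f t th y') -> mean f t y = mean f t y'.
Proof. by rewrite /mean => /funext ->. Qed.

Lemma eq_osc (R : realType) (d : nat) (f : vfield R d) t th y y' :
  (forall th, f t th y = f t th y') -> osc f t th y = osc f t th y'.
Proof.
by move=> e; rewrite /osc (eq_mean e); move/funext: e => ->.
Qed.

Lemma alpha_eq_upto (R : realType) (d : nat)
    (a Z : R -> R -> 'cV[R]_d -> 'cV[R]_d) k t th y y' :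
  (forall i, (i <= k)%N -> y i = y' i) ->
  alpha a Z k t th y = alpha a Z k t th y'.
Proof.
elim/ltn_ind: k t th y y' => -[|k] IH t th y y' yy'.
  by rewrite !alpha_0 yy'.
have eosc j t1 th1 z z' : (j <= k)%N -> (forall i, (i <= j)%N -> z i = z' i) ->
    Abar a Z j t1 th1 z = Abar a Z j t1 th1 z'.
  by move=> jk zz'; apply: eq_osc => th2; apply: IH.
have yk j i : (j <= k)%N -> (i <= j)%N -> y i = y' i.
  by move=> jk ij; apply: yy'; exact: leq_trans (leq_trans ij jk) (leqnSn k).
have Ey : y 0%N = y' 0%N by apply: yy'.
rewrite !alpha_S Ey; apply: eq_subscale.
- apply: eq_compsum => j /andP[j0 jk]; rewrite (yy' j jk).
  have jk1 : (j.-1 <= k)%N by rewrite -ltnS prednK.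
  have -> : Abar a Z j.-1 t th y = Abar a Z j.-1 t th y'; last by [].
  by apply: (eosc _ _ _ _ _ jk1) => i; apply: yk.
- apply: eq_bigr => j _; have jk : (j <= k)%N by rewrite -ltnS.
  have -> : abar a Z j t y = abar a Z j t y'.
    by apply: eq_mean => th1; apply: IH => // i; apply: yk.
  have -> : y j = y' j by apply: (yk j).
  have -> // : (fun u => Abar a Z k t th (upd y j u))
             = (fun u => Abar a Z k t th (upd y' j u)).
  apply/funext => u; apply: eosc => // i ik; rewrite /upd.
  by case: ifP => // _; apply: (yk k).
- have -> // : (fun t' => Abar a Z k t' th y) = (fun t' => Abar a Z k t' th y').
  by apply/funext => t1; apply: eosc => // i; apply: yk.
Qed.

(* When [F] is continuous, the equation at the end points, with one-sided
   derivatives, follows from the continuity of [X]. *)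
Definition solves_on (R : realType) (d : nat) (s T : R)
    (F : R -> 'cV[R]_d -> 'cV[R]_d) (x : 'cV[R]_d) (X : R -> 'cV[R]_d) : Prop :=
  [/\ X s = x, {within `[s, s + T], continuous X} &
      forall t, t \in `]s, s + T[ -> is_derive t 1 X (F t (X t))].

Definition Xprofile (R : realType) (d : nat)
    (a Z : R -> R -> 'cV[R]_d -> 'cV[R]_d) (Y : nat -> R -> 'cV[R]_d)
    (k : nat) (t th : R) : 'cV[R]_d :=
  let y := Y ^~ t in
  if k is 0 then Z t th (y 0%N)
  else compsum k (Z t th) (y 0%N)
         (fun j => y j + th *: Abar a Z j.-1 t th y).

Definition Xrem (R : realType) (d : nat)
    (a Z : R -> R -> 'cV[R]_d -> 'cV[R]_d) (Y : nat -> R -> 'cV[R]_d) (s : R)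
    (X : R -> R -> 'cV[R]_d) (k : nat) (eps t : R) : 'cV[R]_d :=
  (eps ^+ k)^-1 *:
    (X eps t - \sum_(i < k) eps ^+ i *: Xprofile a Z Y i t ((t - s) / eps)).

(* Main.v *)
(* Write theta = (t - s) / eps.  Pulling X_eps back along the flow of b, i.e.
   setting Y_eps(t) = Z(t, - theta; X_eps(t)), removes the singular term: Y_eps
   solves Y_eps' = alpha^0(t, theta, Y_eps), with alpha^0 bounded, smooth and
   2pi-periodic in theta.  The fields alpha^k are built so that
   U = Y^0 + sum_{1 <= j <= m+1} eps^j (Y^j + theta A^{j-1}(t, theta, Y)), where
   Y^{m+1} is replaced by 0, solves the same equation up to O(eps^{m+1}): since
   theta A^k is a theta-primitive of alpha^k - a^k, its time derivative produces
   (alpha^k - a^k) / eps plus a transport term, and these cancel order by order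
   against the Taylor coefficients of alpha^0(t, theta, U).  Gronwall's inequality
   gives Y_eps - U = O(eps^{m+1}) uniformly in t; applying Z(t, theta; .) and its
   Taylor expansion gives X_eps = sum_{i <= m} eps^i X^i + O(eps^{m+1}).

   All bounds are uniform in theta because theta A^k is again 2pi-periodic, so
   that theta may be restricted to a compact interval. *)

(* Two obstacles shape the proof. First, [Z] is given only as a solution of its equation for each
   [t] and [z], so its joint regularity has to be established. The flow theorem does this by
   induction, the tangent map of a flow being again a flow, with the parameter [t] treated as a
   state at rest. The same theorem replaces differentiation under the integral sign for the averages
   and primitives. Second, regularity is consumed: alpha^0 contains a derivative of Z and is of
   class C^{m+1}, and each step of the recursion differentiates theta A^{k-1}, so that alpha^k is of
   class C^{m+1-k}. The last field in use, alpha^m, is therefore C^1, just what differentiating its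
   corrector requires; that corrector, the term of order eps^{m+1} in U, compensates the oscillation
   of alpha^m at order eps^m. Only the product theta A^k is handled, since A^k itself is in general
   not periodic and has no meaningful value at theta = 0. The expansion needs eps <= 1; boundedness
   for larger eps comes from that of X_eps and of the profiles. *)
Require Import Defs.
From HB Require Import structures.
From mathcomp Require Import all_boot all_order all_algebra.
From mathcomp Require Import all_classical all_reals all_analysis.
From mathcomp Require Import measurable_realfun ess_sup_inf.
From mathcomp Require Import ring lra zify.

Set Implicit Arguments.
Unset Strict Implicit.
Unset Printing Implicit Defensive.

Import Order.TTheory GRing.Theory Num.Theory.
Import numFieldNormedType.Exports.

Local Open Scope classical_set_scope.
Local Open Scope ring_scope.

(** * Linear identities in modules *)

Section module_expressions.
Context {R : comPzRingType} {V : lmodType R}.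

Inductive vexpr := VAtom of nat | VZero | VAdd of vexpr & vexpr | VOpp of vexpr
  | VScale of R & vexpr.

Fixpoint veval (env : seq V) (e : vexpr) : V :=
  match e with
  | VAtom i => env`_i
  | VZero => 0
  | VAdd a b => veval env a + veval env b
  | VOpp a => - veval env a
  | VScale r a => r *: veval env a
  end.

Fixpoint vcoef (i : nat) (e : vexpr) : R :=
  match e with
  | VAtom j => if eqn i j then 1 else 0
  | VZero => 0
  | VAdd a b => vcoef i a + vcoef i b
  | VOpp a => - vcoef i a
  | VScale r a => r * vcoef i a
  end.

Fixpoint vclosed (n : nat) (e : vexpr) : bool :=
  match e with
  | VAtom i => (i < n)%N
  | VZero => true
  | VAdd a b => vclosed n a && vclosed n b
  | VOpp a => vclosed n a
  | VScale r a => vclosed n a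
  end.

Lemma vevalE env e : vclosed (size env) e ->
  veval env e = \sum_(i < size env) vcoef i e *: env`_i.
Proof.
elim: e => [j /= jn||a IHa b IHb /andP[/IHa{}IHa /IHb{}IHb]|a IHa /IHa{}IHa|r a IHa /IHa{}IHa] /=.
- rewrite (bigD1 (Ordinal jn))//=; case: (@eqnP j j) => // _.
  rewrite scale1r big1 ?addr0// => i ij.
  by case: eqnP => [ji|]; [rewrite -val_eqE /= ji eqxx in ij|rewrite scale0r].
- by rewrite big1// => i _; rewrite scale0r.
- by rewrite IHa IHb -big_split/=; apply: eq_bigr => i _; rewrite scalerDl.
- by rewrite IHa -sumrN; apply: eq_bigr => i _; rewrite scaleNr.
- by rewrite IHa scaler_sumr; apply: eq_bigr => i _; rewrite scalerA.
Qed.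

(** A conjunction in [Prop] rather than a boolean test: after [/=] it unfolds into one scalar
    equation per atom, each left to [ring]. *)
Fixpoint vcheck (n : nat) (a b : vexpr) : Prop :=
  if n is n'.+1 then vcoef n' a = vcoef n' b /\ vcheck n' a b else True.

Lemma vcheckP env a b : vclosed (size env) a && vclosed (size env) b ->
  vcheck (size env) a b -> veval env a = veval env b.
Proof.
move=> /andP[ca cb] ab; rewrite !vevalE//.
suff H i : (i < size env)%N -> vcoef i a = vcoef i b.
  by apply: eq_bigr => i _; rewrite H.
elim: (size env) ab => // n IH /= [ab /IH{}IH]; rewrite ltnS leq_eqVlt.
by case/predU1P => [->//|/IH].
Qed.

End module_expressions.

Ltac vmem x s :=
  lazymatch s with
  | nil => constr:(false)
  | x :: _ => constr:(true)
  | _ :: ?s' => vmem x s'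
  end.
Ltac vindex x s :=
  lazymatch s with
  | x :: _ => constr:(0%N)
  | _ :: ?s' => let i := vindex x s' in constr:(S i)
  end.
Ltac vadd x s :=
  let b := vmem x s in
  lazymatch b with true => s | false => constr:(x :: s) end.
Ltac vatoms s t :=
  lazymatch t with
  | (?a + ?b)%R => let s' := vatoms s a in vatoms s' b
  | (- ?a)%R => vatoms s a
  | (_ *: ?a)%R => vatoms s a
  | 0%R => s
  | _ => vadd t s
  end.
Ltac vreify R s t :=
  lazymatch t with
  | (?a + ?b)%R => let x := vreify R s a in let y := vreify R s b in
                   constr:(@VAdd R x y)
  | (- ?a)%R => let x := vreify R s a in constr:(@VOpp R x)
  | (?r *: ?a)%R => let x := vreify R s a in constr:(@VScale R r x)
  | 0%R => constr:(@VZero R)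
  | _ => let i := vindex t s in constr:(@VAtom R i)
  end.
(* Decides linear identities in a module, the coefficients being compared by [ring]. *)
Ltac vring R V :=
  lazymatch goal with |- ?a = ?b =>
    let s := vatoms (@nil V) a in
    let s := vatoms s b in
    let x := vreify R s a in let y := vreify R s b in
    apply: (@vcheckP R V s x y isT); rewrite /vcheck /=; do ?split; try ring
  end.

(** * Differential calculus in normed modules *)

Section epsilon_delta.
Context {R : realType} {V W : normedModType R}.
Implicit Types (f : V -> W) (x v : V).

(** Multiplying the difference quotient by the increment removes the division and the punctured
    neighbourhood, the case [s = 0] being trivial. In this form a derivative passes through a
    translation or an affine change of variable by rewriting the argument of [f]. *)
Lemma is_derive_edP f x v l : is_derive x v f l <->
  forall e : R, 0 < e -> exists2 k : R, 0 < k &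
    forall s : R, `|s| < k -> `|f (x + s *: v) - f x - s *: l| <= e * `|s|.
Proof.
split.
  case=> fv <- e e0.
  have /cvgrPdist_le/(_ _ e0) := fv.
  rewrite near_withinE => /nbhs_ballP[k /= k0 H]; exists k => // s sk.
  have [->|s0] := eqVneq s 0.
    by rewrite !scale0r addr0 subrr subr0 !normr0 mulr0.
  have := H s; rewrite /ball /= sub0r normrN => /(_ sk s0).
  rewrite -/('D_v f x) => {}H.
  have -> : f (x + s *: v) - f x - s *: 'D_v f x =
     - (s *: ('D_v f x - s^-1 *: (f (s *: v + x) - f x))).
    by rewrite scalerBr scalerA mulfV// scale1r opprB (addrC x).
  by rewrite normrN normrZ mulrC ler_wpM2r.
move=> H.
have cv : (fun h => h^-1 *: ((f \o shift x) (h *: v) - f x)) @ 0^' --> l.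
  apply/cvgrPdist_le => e e0; have [k k0 Hk] := H _ e0.
  rewrite near_withinE; apply/nbhs_ballP; exists k => //= s.
  rewrite /ball /= sub0r normrN => /Hk {}Hk s0.
  have -> : l - s^-1 *: (f (s *: v + x) - f x) =
     - (s^-1 *: (f (x + s *: v) - f x - s *: l)).
    by rewrite [in RHS]scalerBr scalerA mulVf// scale1r opprB (addrC x).
  rewrite normrN normrZ normfV -ler_pdivlMl ?invr_gt0 ?normr_gt0//.
  by rewrite invrK mulrC.
split; first by apply: cvgP cv.
exact/cvg_lim.
Qed.

Lemma continuous_edP f : continuous f <->
  forall x (e : R), 0 < e -> exists2 k : R, 0 < k &
    forall y, `|y - x| < k -> `|f y - f x| <= e.
Proof.
split=> [fc x e e0|H x].
  have /cvgrPdist_le/(_ _ e0)/nbhs_ballP[k /= k0 Hk] := fc x.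
  exists k => // y yx; rewrite distrC; apply: Hk.
  by rewrite -ball_normE /ball_/= distrC.
apply/cvgrPdist_le => e e0; have [k k0 Hk] := H x _ e0.
apply/nbhs_ballP; exists k => //= y.
by rewrite -ball_normE /ball_/= distrC => /Hk; rewrite distrC.
Qed.

Lemma bounded_linear_continuous f (C : R) : linear f ->
  (forall v, `|f v| <= C * `|v|) -> continuous f.
Proof.
move=> lf fC; apply/continuous_edP => x e e0.
pose D := `|C| + 1; have D0 : 0 < D by rewrite ltr_pwDr.
exists (e / D); first exact: divr_gt0.
move=> y yx; have -> : f y - f x = f (y - x).
  have := lf (-1) x y; rewrite !scaleN1r [- x + _]addrC => ->.
  by rewrite addrC.
rewrite (le_trans (fC _))// (@le_trans _ _ (D * `|y - x|))//.
  by rewrite ler_wpM2r// (le_trans (ler_norm _))// lerDl.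
by rewrite -ler_pdivlMl// mulrC ltW.
Qed.

(** [L] is a bare function whose linearity is a hypothesis, so that explicit formulas can be
    proposed as differentials; the bound by [C] supplies the continuity that a differential must
    have. *)
Lemma differentiable_ed f x (L : V -> W) (C : R) : linear L ->
  (forall v, `|L v| <= C * `|v|) ->
  (forall e : R, 0 < e -> exists2 k : R, 0 < k &
    forall v, `|v| < k -> `|f (x + v) - f x - L v| <= e * `|v|) ->
  differentiable f x /\ 'd f x = L :> (V -> W).
Proof.
move=> linL LC H.
pose aL := GRing.isLinear.Build R V W *:%R L linL.
pose LL : {linear V -> W} := HB.pack L aL.
have cL : continuous LL by exact: bounded_linear_continuous LC.
have E : f \o shift x = cst (f x) + LL +o_ 0 id.
  apply/eqaddoP => e e0; have [k k0 Hk] := H _ e0.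
  apply/nbhs_ballP; exists k => //= v.
  rewrite -ball_normE /ball_/= sub0r normrN => /Hk.
  by rewrite !fctE /= opprD addrA (addrC x).
have dE : 'd f x = L :> (V -> W) by rewrite (diff_unique cL E).
split=> //; apply/diff_locallyP; split; last by rewrite dE.
by rewrite dE; exact: cL.
Qed.

Lemma diff_ed f x : differentiable f x ->
  forall e : R, 0 < e -> exists2 k : R, 0 < k &
    forall v, `|v| < k -> `|f (x + v) - f x - 'd f x v| <= e * `|v|.
Proof.
move=> /diff_locallyP[_ /eqaddoP H] e e0.
have /nbhs_ballP[k /= k0 Hk] := H _ e0.
exists k => // v vk; have := Hk v.
rewrite -ball_normE /ball_/= sub0r normrN => /(_ vk).
by rewrite !fctE /= opprD addrA (addrC x).
Qed.

Lemma diff_is_derive f x v : differentiable f x -> is_derive x v f ('d f x v).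
Proof.
by move=> df; split; [exact: diff_derivable|exact: deriveE].
Qed.

End epsilon_delta.

Lemma prod_norm_le {R : realType} {U V : normedModType R} (u : U) (v : V) (r : R) :
  (`|(u, v)| <= r) = (`|u| <= r) && (`|v| <= r).
Proof. by rewrite prod_normE /= ge_max. Qed.

Lemma prod_norm_lt {R : realType} {U V : normedModType R} (u : U) (v : V) (r : R) :
  (`|(u, v)| < r) = (`|u| < r) && (`|v| < r).
Proof. by rewrite prod_normE /= gt_max. Qed.

Lemma is_derive_comp_diff {R : realType} {V W : normedModType R} (F : V -> W)
    (g : R -> V) t l :
  differentiable F (g t) -> is_derive t 1 g l -> is_derive t 1 (F \o g) ('d F (g t) l).
Proof.
move=> dF dg.
have dg' : differentiable g t by apply/derivable1_diffP; case: dg.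
have /(_ 1) := @diff_is_derive _ _ _ _ _ _ (differentiable_comp dg' dF).
rewrite diff_comp//= -(deriveE _ dg').
by case: dg => _ ->.
Qed.

(** * Gronwall's inequality *)

Section gronwall.
Context {R : realType} {V : normedModType R}.

(** At the first time [c] where [|u|] meets the barrier [g], [|u c| = g c] while [|u| < g] just
    before, so the left increments force [dg c <= |du c|], against the strict hypothesis. Working
    with increments avoids differentiating the norm, which need not be differentiable. *)
Lemma norm_lt_of_derive_lt (u du : R -> V) (g dg : R -> R) (a b : R) :
  {within `[a, b], continuous u} ->
  (forall t, is_derive t (1 : R) g (dg t)) ->
  (forall t, a < t < b -> is_derive t (1 : R) u (du t)) ->
  `|u a| < g a ->
  (forall t, a < t < b -> `|u t| <= g t -> `|du t| < dg t) ->
  forall t, a <= t < b -> `|u t| < g t.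
Proof.
move=> cu dg' du' ua Hlt t0 /andP[at0 t0b]; apply/not_notP => /negP; rewrite -leNgt => bad.
have ab : a < b := le_lt_trans at0 t0b.
have cg t : {for t, continuous g}.
  by apply: differentiable_continuous; apply/derivable1_diffP; case: (dg' t).
pose A := [set t : R | a <= t < b /\ g t <= `|u t|].
have At0 : A t0 by split=> //; apply/andP.
have hiA : has_inf A by split; [exists t0|exists a => t [/andP[]]].
pose c := inf A.
have cA t : A t -> c <= t by move=> At; apply: ge_inf => //; case: hiA.
have ct0 : c <= t0 by exact: cA.
have ac : a < c.
  have [_ cua _] := (continuous_within_itvP u ab).1 cu.
  have : (`|u x| - g x) @[x --> a^'+] --> `|u a| - g a.
    apply: cvgB; first exact: cvg_norm.
    by apply: cvg_at_right_filter; exact: cg.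
  move=> /cvgr_lt/(_ 0) => H; have := H _; rewrite subr_lt0 => /(_ ua).
  rewrite near_withinE => /nbhs_ballP[k /= k0 Hk].
  apply: (@lt_le_trans _ _ (a + k)); first by rewrite ltrDl.
  apply: lb_le_inf; first by exists t0.
  move=> t [/andP[at' tb] gt]; rewrite leNgt; apply/negP => tk.
  have [ta|nta] := eqVneq t a; first by move: gt; rewrite ta leNgt ua.
  have ltat : a < t by rewrite lt_neqAle eq_sym nta.
  have := Hk t; rewrite /ball/= ltr0_norm ?subr_lt0// opprB ltrBlDr addrC.
  by move=> /(_ tk ltat); rewrite ltNge gt.
have cab : a < c < b by rewrite ac (le_lt_trans ct0).
have duc := du' c cab.
have cuc : {for c, continuous u}.
  by apply: differentiable_continuous; apply/derivable1_diffP; case: duc.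
have cw : {for c, continuous (fun x => `|u x| - g x)}.
  by apply: cvgB; [exact: cvg_norm|exact: cg].
have gle : g c <= `|u c|.
  rewrite leNgt; apply/negP => lt.
  have : `|u c| - g c < 0 by rewrite subr_lt0.
  move=> /(cvgr_lt _ cw)/nbhs_ballP[k /= k0 Hk].
  have [t At tc] := inf_adherent k0 hiA.
  have := Hk t; rewrite /ball/= ler0_norm ?subr_le0 ?cA// opprB ltrBlDr addrC.
  move=> /(_ tc) /=; rewrite subr_lt0 ltNge.
  by case: At => _ ->.
have ltc t : a < t < c -> `|u t| < g t.
  move=> /andP[at' tc]; rewrite ltNge; apply/negP => gt.
  have : A t by split=> //; rewrite ltW//= (lt_trans tc)//; case/andP: cab.
  by move=> /cA; rewrite leNgt tc.
have ule : `|u c| <= g c.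
  rewrite -subr_le0.
  have cwl : (`|u x| - g x) @[x --> c^'-] --> `|u c| - g c.
    by apply: cvg_at_left_filter; exact: cw.
  apply: (cvgr_to_le cwl); near=> x; rewrite subr_le0 ltW// ltc//.
  by apply/andP; split.
(* It remains to prove [dg c <= |du c|], up to [e], by comparing the increments of [g] and [u] from
   [c - s] to [c]. *)
have := Hlt c cab ule; apply/negP; rewrite -leNgt.
apply/ler_addgt0Pl => e e0.
have e20 : 0 < e / 2 by exact: divr_gt0.
have [k1 k10 H1] := (is_derive_edP _ _ _ _).1 (dg' c) _ e20.
have [k2 k20 H2] := (is_derive_edP _ _ _ _).1 duc _ e20.
pose s := Num.min (Num.min k1 k2) (c - a) / 2.
have m0 : 0 < Num.min (Num.min k1 k2) (c - a) by rewrite !lt_min k10 k20 subr_gt0.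
have s0 : 0 < s by apply: divr_gt0.
have sm : s < Num.min (Num.min k1 k2) (c - a) by rewrite /s ltr_pdivrMr// ltr_pMr// ltr1n.
move: sm; rewrite !lt_min => /andP[/andP[sk1 sk2] sca].
have := H1 (- s); rewrite normrN (gtr0_norm s0) => /(_ sk1).
have := H2 (- s); rewrite normrN (gtr0_norm s0) => /(_ sk2).
rewrite /GRing.scale /= !mulr1 -/(GRing.scale (- s) _) -/(GRing.scale (- s) (du c)).
rewrite !scaleNr opprK => h2 h1.
have := ltc (c - s); rewrite ltrBlDl ltrDr s0 andbT ltrBrDl -ltrBrDr sca => /(_ isT) h3.
have h4 : `|u c| - `|u (c - s)| <= s * `|du c| + e / 2 * s.
  rewrite lerBlDr.
  have -> : u c = (s *: du c - (u (c - s) - u c + s *: du c)) + u (c - s).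
    by rewrite opprD opprB [s *: _ + _]addrC !subrK.
  rewrite (le_trans (ler_normD _ _))// lerD2r (le_trans (ler_normB _ _))//.
  by rewrite lerD// normrZ gtr0_norm.
have h5 : g c - g (c - s) >= s * dg c - e / 2 * s.
  move: h1; rewrite ler_norml => /andP[_]; rewrite mulNr opprK => h1.
  lra.
have : s * dg c <= s * (e + `|du c|) by lra.
by rewrite ler_pM2l.
Unshelve. all: by end_near. Qed.

End gronwall.

Section gronwall.
Context {R : realType} {V : normedModType R}.

(** The barrier [g] has initial value and slope enlarged by [n > 0], which makes its derivative
    strictly larger than [L * g + d]; then [n] tends to 0. The bound is not the sharp one, but it
    stays valid for [L = 0], where it becomes a mean value inequality. *)
Lemma gronwall (u du : R -> V) (L d a b : R) : 0 <= L -> 0 <= d ->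
  {within `[a, b], continuous u} ->
  (forall t, a < t < b -> is_derive t (1 : R) u (du t)) ->
  (forall t, a < t < b -> `|du t| <= L * `|u t| + d) ->
  forall t, a <= t <= b -> `|u t| <= (`|u a| + d * (b - a)) * expR (L * (b - a)).
Proof.
move=> L0 d0 cu du' Hu.
have main t : a <= t < b -> `|u t| <= (`|u a| + d * (b - a)) * expR (L * (b - a)).
  move=> /andP[at' tb].
  have ab : a < b := le_lt_trans at' tb.
  have E0 : 0 < expR (L * (b - a)) by exact: expR_gt0.
  apply/ler_addgt0Pl => e e0.
  (* Chosen so that the bound at [b] grows by exactly [e]. *)
  pose n := e / ((1 + (b - a)) * expR (L * (b - a))).
  have n0 : 0 < n by rewrite divr_gt0// mulr_gt0// addr_gt0// subr_gt0.
  have n0' := ltW n0; have dn0 : 0 <= d + n by exact: addr_ge0.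
  have nt : 0 <= (d + n) * (t - a) by rewrite mulr_ge0// subr_ge0.
  pose g x := (`|u a| + n + (d + n) * (x - a)) * expR (L * (x - a)).
  pose dg x := (d + n) * expR (L * (x - a)) + L * g x.
  have gd x : is_derive x (1 : R) g (dg x).
    rewrite /g; apply: is_derive_eq.
    rewrite /dg /g -![_ *: _]/(_ * _); ring.
  have H := norm_lt_of_derive_lt cu gd du'.
  have : `|u t| < g t.
    apply: H.
    - by rewrite /g subrr !mulr0 expR0 mulr1 addr0 ltrDl.
    - move=> x xab ux; rewrite (le_lt_trans (Hu _ xab))// /dg addrC.
      apply: ltr_leD; last exact: ler_wpM2l.
      rewrite (@lt_le_trans _ _ (d + n))// ?ltrDl// ler_peMr//.
      rewrite -expR0 ler_expR mulr_ge0// subr_ge0.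
      by case/andP : xab => /ltW.
    - by rewrite at'.
  move=> /ltW /le_trans; apply.
  rewrite (@le_trans _ _ ((`|u a| + n + (d + n) * (b - a)) * expR (L * (b - a))))//.
    rewrite /g ler_pM ?expR_ge0//.
    - by rewrite addr_ge0// addr_ge0.
    - by rewrite lerD2l ler_wpM2l // lerD2r ltW.
    - by rewrite ler_expR ler_wpM2l// lerD2r ltW.
  have -> : `|u a| + n + (d + n) * (b - a) = (`|u a| + d * (b - a)) + n * (1 + (b - a)) by ring.
  rewrite mulrDl addrC lerD2r -mulrA /n divfK//.
  by rewrite gt_eqF// mulr_gt0// addr_gt0// subr_gt0.
move=> t /andP[at']; rewrite le_eqVlt => /predU1P[tb|tb]; last by apply: main; rewrite at'.
subst t.
have [ab|ab] := eqVneq a b.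
  by rewrite ab subrr !mulr0 expR0 mulr1 addr0.
have {}ab : a < b by rewrite lt_neqAle ab.
have [_ _ cub] := (continuous_within_itvP u ab).1 cu.
apply: (cvgr_to_le (cvg_norm cub)); near=> x; apply: main.
by apply/andP; split; near: x; [exact: nbhs_left_ge|exact: nbhs_left_lt].
Unshelve. all: by end_near. Qed.

Lemma gronwall_sym (u du : R -> V) (L d r : R) : 0 <= L -> 0 <= d ->
  (forall t, `|t| <= r -> is_derive t (1 : R) u (du t)) ->
  (forall t, `|t| <= r -> `|du t| <= L * `|u t| + d) ->
  forall t, `|t| <= r -> `|u t| <= (`|u 0| + d * r) * expR (L * r).
Proof.
have main (v dv : R -> V) : 0 <= L -> 0 <= d ->
  (forall t, `|t| <= r -> is_derive t (1 : R) v (dv t)) ->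
  (forall t, `|t| <= r -> `|dv t| <= L * `|v t| + d) ->
  forall t, 0 <= t <= r -> `|v t| <= (`|v 0| + d * r) * expR (L * r).
  move=> L0 d0 vd Hv t tr.
  rewrite -[X in d * X]subr0 -[X in L * X]subr0.
  apply: (@gronwall v dv) => //.
  - apply: derivable_within_continuous => x; rewrite in_itv /= => /andP[x0 xr].
    by have [] := vd x _; rewrite ?ger0_norm.
  - by move=> x /andP[x0 xr]; apply: vd; rewrite gtr0_norm// ltW.
  - by move=> x /andP[x0 xr]; apply: Hv; rewrite gtr0_norm// ltW.
move=> L0 d0 ud Hu t; have [t0|t0] := leP 0 t.
  rewrite ger0_norm// => tr; apply: (main u du) => //.
  by rewrite t0.
rewrite ltr0_norm// => tr.
have : `|(u \o -%R) (- t)| <= (`|(u \o -%R) 0| + d * r) * expR (L * r).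
  apply: (main (u \o -%R) (fun x => - du (- x))) => //.
  - move=> x xr; have ux : is_derive (- x) (1 : R) u (du (- x)) by apply: ud; rewrite normrN.
    have := @is_derive_comp_diff R R V u -%R x (-1) _ _.
    case: (ux) => /derivable1_diffP dux uxE.
    move=> /(_ dux (is_deriveNid x 1)).
    by rewrite linearN -(deriveE _ dux) uxE.
  - by move=> x xr; rewrite normrN; apply: Hu; rewrite normrN.
  - by rewrite oppr_ge0 ltW.
by rewrite /= opprK oppr0.
Qed.

(** Gronwall's inequality with [L = 0], applied to [f] minus its affine approximation of slope [l].
    The order of [a] and [b] is left free because derivative estimates involve increments of either
    sign. *)
Lemma mean_value_le (f df : R -> V) (l : V) (d a b : R) : 0 <= d ->
  (forall t, Num.min a b <= t <= Num.max a b -> is_derive t (1 : R) f (df t)) ->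
  (forall t, Num.min a b <= t <= Num.max a b -> `|df t - l| <= d) ->
  `|f b - f a - (b - a) *: l| <= d * `|b - a|.
Proof.
have main (p q : R) : p <= q -> 0 <= d ->
    (forall t, p <= t <= q -> is_derive t (1 : R) f (df t)) ->
    (forall t, p <= t <= q -> `|df t - l| <= d) ->
    `|f q - f p - (q - p) *: l| <= d * (q - p).
  move=> pq d0 fd Hf.
  pose u t := f t - f p - (t - p) *: l.
  have ud t : p <= t <= q -> is_derive t (1 : R) u (df t - l).
    move=> /fd /is_derive_edP ft; apply/is_derive_edP => e /ft[k k0 Hk].
    exists k => // s /Hk; congr (`|_| <= _).
    by rewrite /u -[s *: 1]/(s * 1) mulr1; vring R V.
  have up : u p = 0 by rewrite /u !subrr scale0r subrr.
  have := @gronwall u (fun t => df t - l) 0 d p q (lexx _) d0 _ _ _ q.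
  rewrite mul0r expR0 mulr1 up normr0 add0r; apply.
  - apply: derivable_within_continuous => x; rewrite in_itv /= => /ud.
    by case.
  - by move=> t /andP[pt tq]; apply: ud; rewrite !ltW.
  - by move=> t /andP[pt tq]; rewrite mul0r add0r; apply: Hf; rewrite !ltW.
  - by rewrite pq lexx.
move=> d0; have [ab|/ltW ba] := leP a b => fd Hf.
  by rewrite ger0_norm ?subr_ge0//; apply: main.
rewrite ler0_norm ?subr_le0// opprB.
have -> : f b - f a - (b - a) *: l = - (f a - f b - (a - b) *: l).
  by vring R V.
by rewrite normrN; apply: main.
Qed.
End gronwall.

(** * Smooth maps *)

Section proper.
Context {R : realType}.

(** Heine-Borel property. It takes the place of finite dimension in the flow theorem and, being
    stable under products, passes to the tangent spaces [V * V]. *)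
Definition proper (V : normedModType R) :=
  forall r : R, compact [set x : V | `|x| <= r].

Lemma proper_real : proper R.
Proof.
move=> r; have -> : [set x : R | `|x| <= r] = `[- r, r]%classic.
  by apply/seteqP; split => x /=; rewrite in_itv/= ler_norml.
exact: segment_compact.
Qed.

Lemma proper_prod (V W : normedModType R) : proper V -> proper W -> proper (V * W)%type.
Proof.
move=> pV pW r.
have -> : [set x : V * W | `|x| <= r] = [set x : V | `|x| <= r] `*` [set x : W | `|x| <= r].
  by apply/seteqP; split => -[x y] /=; rewrite prod_norm_le => /andP.
exact: compact_setX.
Qed.

Lemma mx_norm_le m n (M : 'M[R]_(m, n)) (r : R) : 0 <= r ->
  (`|M| <= r) <-> (forall i j, `|M i j| <= r).
Proof.
move=> r0; rewrite [`|M|]/Num.Def.normr/= mx_normrE; split=> [/bigmax_leP[_ H] i j|H].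
  exact: (H (i, j)).
by apply/bigmax_leP; split=> // -[i j] _ /=.
Qed.

Lemma mx_entry_le m n (M : 'M[R]_(m, n)) i j : `|M i j| <= `|M|.
Proof. by apply: (mx_norm_le M _).1. Qed.

Lemma vec_mx_norm_le m n (v : 'rV[R]_(m * n)) : `|vec_mx v| <= `|v|.
Proof. by apply/mx_norm_le => // i j; rewrite mxE; exact: mx_entry_le. Qed.

(** Tychonoff's theorem for row vectors, carried over by [vec_mx], which does not increase the sup
    norm. *)
Lemma proper_mx m n : proper 'M[R]_(m, n).
Proof.
move=> r.
have [r0|r0] := ltP r 0.
  have -> : [set x : 'M[R]_(m, n) | `|x| <= r] = set0; last exact: compact0.
  by apply/seteqP; split => x //=; rewrite leNgt (lt_le_trans r0).
have -> : [set x : 'M[R]_(m, n) | `|x| <= r] =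
    vec_mx @` [set v : 'rV[R]_(m * n) | forall i, `[- r, r]%classic (v ord0 i)].
  apply/seteqP; split => [M /= Mr|M /= [v vr <-]].
    exists (mxvec M); last exact: mxvecK.
    move=> k; case: (mxvec_indexP k) => i j; rewrite mxvecE /= in_itv/= -ler_norml.
    exact: le_trans (mx_entry_le _ _ _) Mr.
  apply/mx_norm_le => // i j; rewrite mxE.
  by have := vr (mxvec_index i j); rewrite /= in_itv /= -ler_norml.
apply: continuous_compact; last first.
  apply: (@rV_compact _ _ (fun=> `[- r, r]%classic)) => i; exact: segment_compact.
apply: continuous_subspaceT; apply: (@bounded_linear_continuous _ _ _ _ 1).
  exact: linearP.
by move=> v; rewrite mul1r vec_mx_norm_le.
Qed.

Section compactness.
Context {V W : normedModType R}.
Hypothesis pV : proper V.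

Lemma proper_bounded (f : V -> W) (r : R) : continuous f ->
  exists2 M : R, 0 <= M & forall x, `|x| <= r -> `|f x| <= M.
Proof.
move=> cf; have : compact (f @` [set x : V | `|x| <= r]).
  by apply: continuous_compact; [exact: continuous_subspaceT|exact: pV].
move=> /compact_bounded[M [Mr H]].
exists (`|M| + 1); first by rewrite addr_ge0.
move=> x xr; apply: (H (`|M| + 1)); last by exists x.
by rewrite (le_lt_trans (ler_norm _))// ltrDl.
Qed.

(** Heine's theorem. Only [x] is confined to the ball; [y] may leave it, so that no margin on the
    radius has to be kept. *)
Lemma proper_unif (f : V -> W) (r e : R) : continuous f -> 0 < e ->
  exists2 k : R, 0 < k & forall x y, `|x| <= r -> `|y - x| < k -> `|f y - f x| <= e.
Proof.
move=> /continuous_edP cf e0.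
pose P (k : R) (x : V) := forall y, `|y - x| < k -> `|f y - f x| <= e.
have : \forall k \near 0^'+, [set x : V | `|x| <= r] `<=` P k.
  have cK : compact [set x : V | `|x| <= r] := @pV r.
  refine ((compact_near_coveringP _).1 cK R (0^'+) P _ _) => x _.
  have [k k0 Hk] := cf x (e / 2) (divr_gt0 e0 (ltr0n _ 2)).
  have k20 : 0 < k / 2 by rewrite divr_gt0.
  exists ([set y | `|y - x| < k / 2], [set k' | 0 < k' < k / 2]) => /=.
    split.
      apply/nbhs_ballP; exists (k / 2) => //= y.
      by rewrite -ball_normE /ball_/= distrC.
    near=> k'; apply/andP; split => //.
  move=> [x' k'] /= [x'x /andP[k'0 k'k]] y yx'.
  rewrite -(subrKA (f x)) (le_trans (ler_normD _ _))// (splitr e) lerD//.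
    apply: Hk; rewrite -(subrKA x') (le_lt_trans (ler_normD _ _))//.
    by rewrite (splitr k) ltrD// (lt_trans yx').
  rewrite distrC; apply: Hk; rewrite (lt_trans x'x)//.
  by rewrite ltr_pdivrMr// ltr_pMr// ltr1n.
move=> H; near ((0 : R)^'+) => k; exists k => //.
move=> x y xr yx; have : [set x : V | `|x| <= r] `<=` P k by near: k.
exact.
Unshelve. all: by end_near. Qed.

End compactness.
End proper.

(** Smoothness through the tangent map [(x, v) |-> 'd f x v]: no topology on the space of linear
    maps is involved, and the chain rule becomes composition. The recursion changes [V] into
    [V * V], hence the quantification over the spaces inside the fixpoint. *)
Fixpoint Cn (R : realType) (n : nat) : forall V W : normedModType R, (V -> W) -> Prop :=
  if n is n'.+1 then fun V W f => (forall x, differentiable f x) /\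
     @Cn R n' (V * V)%type W (fun p => 'd f (p.1) p.2)
  else fun V W f => continuous f.

Section C1_estimates.
Context {R : realType} {V W : normedModType R}.
Implicit Types (f : V -> W) (x y v : V).

Lemma mean_value_diff_le f x y (l : W) (d : R) : 0 <= d ->
  (forall x, differentiable f x) ->
  (forall s : R, 0 <= s <= 1 -> `|'d f (x + s *: (y - x)) (y - x) - l| <= d) ->
  `|f y - f x - l| <= d.
Proof.
move=> d0 df H.
pose g s := f (x + s *: (y - x)).
have dg (s : R) : is_derive s (1 : R) g ('d f (x + s *: (y - x)) (y - x)).
  apply: (is_derive_comp_diff (g := fun s => x + s *: (y - x))); first exact: df.
  apply/is_derive_edP => e e0; exists 1 => // s' _.
  rewrite -[s' *: 1]/(s' * 1) mulr1 (_ : _ - _ = 0) ?normr0 ?mulr_ge0 ?(ltW e0)//.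
  by vring R V.
have := @mean_value_le _ _ g _ l d 0 1 d0 (fun t _ => dg t).
rewrite /g subr0 normr1 mulr1 !scale1r scale0r addr0 [x + _]addrC subrK; apply.
by move=> t; rewrite min_l// max_r//; exact: H.
Qed.

Hypothesis pV : proper V.

(** Joint continuity bounds the differential on pairs with a unit direction, and homogeneity does
    the rest; the radius [Num.max r 1] accommodates both the point and the unit vector. *)
Lemma C1_diff_bounded f (r : R) : Cn 1 f ->
  exists2 C : R, 0 <= C & forall x v, `|x| <= r -> `|'d f x v| <= C * `|v|.
Proof.
move=> [df cdf].
have [M M0 H] := proper_bounded (proper_prod pV pV) (Num.max r 1) cdf.
exists M => // x v xr.
have [->|v0] := eqVneq v 0; first by rewrite linear0 !normr0 mulr0.
have nv0 : 0 < `|v| by rewrite normr_gt0.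
have := H (x, `|v|^-1 *: v); rewrite prod_norm_le !le_max xr /=.
rewrite normrZ normfV normr_id mulVf ?gt_eqF// lexx orbT => /(_ isT).
by rewrite linearZ normrZ normfV normr_id -ler_pdivlMl ?invr_gt0// invrK mulrC.
Qed.

Lemma C1_diff_unif f (r e : R) : Cn 1 f -> 0 < e ->
  exists2 k : R, 0 < k & forall x y v, `|x| <= r -> `|y - x| < k ->
    `|'d f y v - 'd f x v| <= e * `|v|.
Proof.
move=> [df cdf] e0.
have [k k0 H] := proper_unif (proper_prod pV pV) (Num.max r 1) cdf e0.
exists k => // x y v xr yx.
have [->|v0] := eqVneq v 0; first by rewrite (linear0 ('d f y)) (linear0 ('d f x)) subrr !normr0 mulr0.
have nv0 : 0 < `|v| by rewrite normr_gt0.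
have := H (x, `|v|^-1 *: v) (y, `|v|^-1 *: v).
rewrite prod_norm_le !le_max xr /=.
rewrite normrZ normfV normr_id mulVf ?gt_eqF// lexx orbT => /(_ isT).
have -> : (y, `|v|^-1 *: v) - (x, `|v|^-1 *: v) = (y - x, 0) by congr pair; rewrite subrr.
rewrite prod_norm_lt yx normr0 k0 => /(_ isT).
rewrite (linearZZ ('d f y)) (linearZZ ('d f x)) -scalerBr normrZ normfV normr_id.
by rewrite -ler_pdivlMl ?invr_gt0// invrK mulrC.
Qed.

Lemma C1_lipschitz f (r : R) : Cn 1 f ->
  exists2 C : R, 0 <= C & forall x y, `|x| <= r -> `|y| <= r ->
    `|f y - f x| <= C * `|y - x|.
Proof.
move=> f1; have [C C0 H] := C1_diff_bounded r f1; exists C => // x y xr yr.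
rewrite -[f y - f x]subr0; apply: mean_value_diff_le => //.
- by rewrite mulr_ge0.
- by case: f1.
move=> s /andP[s0 s1]; rewrite subr0; apply: H.
have -> : x + s *: (y - x) = (1 - s) *: x + s *: y by vring R V.
rewrite (le_trans (ler_normD _ _))// !normrZ (ger0_norm s0) ger0_norm ?subr_ge0//.
have : (1 - s) * `|x| <= (1 - s) * r by rewrite ler_wpM2l// subr_ge0.
have : s * `|y| <= s * r by rewrite ler_wpM2l.
by lra.
Qed.

(** Strict differentiability, uniform over base points in a ball: both ends of the increment may
    move away from [z]. The difference quotients of a flow require this, since the two trajectories
    and the reference one may all be distinct. *)
Lemma C1_strict f (r e : R) : Cn 1 f -> 0 < e ->
  exists2 k : R, 0 < k & forall z x y, `|z| <= r -> `|x - z| < k -> `|y - z| < k ->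
    `|f y - f x - 'd f z (y - x)| <= e * `|y - x|.
Proof.
move=> f1 e0; have [k k0 H] := C1_diff_unif r f1 e0; exists k => // z x y zr xz yz.
apply: mean_value_diff_le.
- by rewrite mulr_ge0// ltW.
- by case: f1.
move=> s /andP[s0 s1]; apply: H => //.
have -> : x + s *: (y - x) - z = (1 - s) *: (x - z) + s *: (y - z) by vring R V.
rewrite (le_lt_trans (ler_normD _ _))// !normrZ (ger0_norm s0) ger0_norm ?subr_ge0//.
have [->|sn] := eqVneq s 0; first by rewrite subr0 mul1r mul0r addr0.
have : (1 - s) * `|x - z| <= (1 - s) * k by rewrite ler_wpM2l ?subr_ge0// ltW.
have : s * `|y - z| < s * k by rewrite ltr_pM2l// lt_neqAle eq_sym sn.
by lra.
Qed.

End C1_estimates.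

Section smooth_functions.
Context {R : realType}.

Lemma CnP n (V W : normedModType R) (f : V -> W) :
  Cn n.+1 f = ((forall x, differentiable f x) /\
               Cn n (fun p : V * V => 'd f (p.1) p.2)).
Proof. by []. Qed.

Lemma Cn_diff n (V W : normedModType R) (f : V -> W) x : Cn n.+1 f -> differentiable f x.
Proof. by case. Qed.

Lemma Cn_continuous n (V W : normedModType R) (f : V -> W) : Cn n f -> continuous f.
Proof. by case: n => //= n [df _] x; exact: differentiable_continuous. Qed.

Lemma CnS n (V W : normedModType R) (f : V -> W) : Cn n.+1 f -> Cn n f.
Proof.
elim: n V W f => [|n IH] V W f; first exact: Cn_continuous.
by rewrite [Cn n.+2 _]CnP CnP => -[df /IH].
Qed.

Lemma Cn_le m n (V W : normedModType R) (f : V -> W) : (m <= n)%N -> Cn n f -> Cn m f.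
Proof.
move=> /subnK <-; elim: (n - m)%N => [|k IH]; first by rewrite add0n.
by rewrite addSn => /CnS.
Qed.

Lemma Cn_cst n (V W : normedModType R) (c : W) : Cn n (fun _ : V => c).
Proof.
elim: n V c => [|n IH] V c; first exact: cst_continuous.
rewrite CnP; split=> [x|]; first exact: differentiable_cst.
have -> : (fun p : V * V => 'd (cst c) (p.1) p.2) = fun=> 0.
  by apply/funext => p; rewrite diff_cst.
exact: IH.
Qed.

Lemma linear_diff (V W : normedModType R) (f : V -> W) x : linear f -> continuous f ->
  differentiable f x /\ 'd f x = f :> (V -> W).
Proof.
move=> lf cf.
pose LL : {linear V -> W} := HB.pack f (GRing.isLinear.Build R V W *:%R f lf).
by split; [exact: (@linear_differentiable _ _ _ LL)|exact: (@diff_lin _ _ _ LL)].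
Qed.

Lemma Cn_linear n (V W : normedModType R) (f : V -> W) : linear f -> continuous f -> Cn n f.
Proof.
elim: n V W f => [//|n IH] V W f lf cf; rewrite CnP; split.
  by move=> x; have [] := linear_diff x lf cf.
have -> : (fun p : V * V => 'd f (p.1) p.2) = fun p => f p.2.
  by apply/funext => p; have [_ ->] := linear_diff p.1 lf cf.
apply: IH => [a p q|p]; first exact: lf.
by apply: continuous_comp; [exact: cvg_snd|exact: cf].
Qed.

Lemma Cn_fst n (V W : normedModType R) : Cn n (fun p : V * W => p.1).
Proof. by apply: Cn_linear => // p; exact: cvg_fst. Qed.

Lemma Cn_snd n (V W : normedModType R) : Cn n (fun p : V * W => p.2).
Proof. by apply: Cn_linear => // p; exact: cvg_snd. Qed.

Lemma Cn_id n (V : normedModType R) : Cn n (fun p : V => p).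
Proof. by apply: Cn_linear => // p; exact: cvg_id. Qed.

Lemma Cn_pair n (U V W : normedModType R) (f : U -> V) (g : U -> W) :
  Cn n f -> Cn n g -> Cn n (fun x => (f x, g x)).
Proof.
elim: n U V W f g => [|n IH] U V W f g.
  by move=> cf cg x; exact: cvg_pair (cf x) (cg x).
rewrite !CnP => -[df Tf] [dg Tg]; split=> [x|]; first exact: differentiable_pair.
have -> : (fun p : U * U => 'd (fun x => (f x, g x)) (p.1) p.2) =
          fun p => ('d f (p.1) p.2, 'd g (p.1) p.2).
  by apply/funext => p; rewrite diff_pair.
exact: IH.
Qed.

(** The tangent map of a composite is the composite of the tangent maps, so the induction never
    meets a higher-order chain rule. *)
Lemma Cn_comp n (U V W : normedModType R) (f : U -> V) (g : V -> W) :
  Cn n f -> Cn n g -> Cn n (fun x => g (f x)).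
Proof.
elim: n U V W f g => [|n IH] U V W f g.
  by move=> cf cg x; exact: continuous_comp (cf x) (cg (f x)).
move=> Cf Cg; rewrite CnP; split=> [x|].
  exact: differentiable_comp (Cn_diff x Cf) (Cn_diff (f x) Cg).
have -> : (fun p : U * U => 'd (fun x => g (f x)) (p.1) p.2) =
          fun p => (fun q : V * V => 'd g (q.1) q.2) (f p.1, 'd f (p.1) p.2).
  apply/funext => p /=.
  by rewrite (@diff_comp _ _ _ _ f g _ (Cn_diff _ Cf) (Cn_diff _ Cg)).
apply: (IH _ _ _ _ (fun q : V * V => 'd g (q.1) q.2)); last by case: Cg.
apply: Cn_pair; last by case: Cf.
by apply: (IH _ _ _ fst f); [exact: Cn_fst|exact: CnS].
Qed.

Lemma Cn_triple n (U V W X : normedModType R) (f : U -> V) (g : U -> W) (h : U -> X) :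
  Cn n f -> Cn n g -> Cn n h -> Cn n (fun x => (f x, g x, h x)).
Proof. by move=> Cf Cg Ch; exact: Cn_pair (Cn_pair Cf Cg) Ch. Qed.

Lemma CnD n (V W : normedModType R) (f g : V -> W) :
  Cn n f -> Cn n g -> Cn n (fun x => f x + g x).
Proof.
move=> Cf Cg; apply: (Cn_comp (g := fun p : W * W => p.1 + p.2) (Cn_pair Cf Cg)).
apply: Cn_linear => [a p q|p]; first by rewrite scalerDr addrACA.
exact: add_continuous.
Qed.

Lemma CnN n (V W : normedModType R) (f : V -> W) : Cn n f -> Cn n (fun x => - f x).
Proof.
move=> Cf; apply: (Cn_comp (g := fun p : W => - p) Cf).
apply: Cn_linear => [a p q|p]; first by rewrite opprD scalerN.
exact: opp_continuous.
Qed.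

Lemma CnB n (V W : normedModType R) (f g : V -> W) :
  Cn n f -> Cn n g -> Cn n (fun x => f x - g x).
Proof. by move=> Cf Cg; apply: CnD => //; exact: CnN. Qed.

Lemma Cn_sum n (V W : normedModType R) I (s : seq I) (P : pred I) (f : I -> V -> W) :
  (forall i, P i -> Cn n (f i)) -> Cn n (fun x => \sum_(i <- s | P i) f i x).
Proof.
move=> Cf; elim: s => [|i s IH].
  by under eq_fun do rewrite big_nil; exact: Cn_cst.
have [Pi|nPi] := boolP (P i).
  have -> : (fun x => \sum_(j <- i :: s | P j) f j x) =
            fun x => f i x + \sum_(j <- s | P j) f j x.
    by apply/funext => x; rewrite big_cons Pi.
  exact: CnD (Cf _ Pi) IH.
have -> // : (fun x => \sum_(j <- i :: s | P j) f j x) =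
          fun x => \sum_(j <- s | P j) f j x.
by apply/funext => x; rewrite big_cons (negbTE nPi).
Qed.

Lemma diff_scale (V : normedModType R) (p : R * V) :
  differentiable (fun p : R * V => p.1 *: p.2) p /\
  'd (fun p : R * V => p.1 *: p.2) p = (fun q => p.1 *: q.2 + q.1 *: p.2) :> (R * V -> V).
Proof.
apply: (@differentiable_ed _ _ _ _ _ _ (`|p.1| + `|p.2|)).
- by move=> a [q1 q2] [r1 r2] /=; rewrite -[a *: q1]/(a * q1); vring R V.
- move=> q; rewrite (le_trans (ler_normD _ _))// !normrZ mulrDl.
  have /andP[q1 q2] : (`|q.1| <= `|q|) && (`|q.2| <= `|q|).
    by rewrite -prod_norm_le; case: q.
  by rewrite lerD// ?ler_wpM2l// mulrC ler_wpM2l.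
- move=> e e0; exists e => // q qe.
  have -> : (p + q).1 *: (p + q).2 - p.1 *: p.2 - (p.1 *: q.2 + q.1 *: p.2) = q.1 *: q.2.
    by rewrite -[(p + q).1]/(p.1 + q.1) -[(p + q).2]/(p.2 + q.2); vring R V.
  have /andP[q1 q2] : (`|q.1| <= `|q|) && (`|q.2| <= `|q|).
    by rewrite -prod_norm_le; case: q {qe}.
  by rewrite normrZ ler_pM// (le_trans q1)// ltW.
Qed.

(** The tangent map of the scaling is a sum of two scalings, which closes the induction. *)
Lemma Cn_scale_pair n (V : normedModType R) : Cn n (fun p : R * V => p.1 *: p.2).
Proof.
elim: n => [|n IH]; first by move=> p; exact: scale_continuous.
rewrite CnP; split=> [p|]; first by have [] := diff_scale p.
have -> : (fun p : (R * V) * (R * V) => 'd (fun p : R * V => p.1 *: p.2) (p.1) p.2) =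
   (fun p => (p.1.1 *: p.2.2) + (p.2.1 *: p.1.2)).
  by apply/funext => p; have [_ ->] := diff_scale p.1.
have C1 := Cn_fst n (R * V)%type (R * V)%type.
have C2 := Cn_snd n (R * V)%type (R * V)%type.
apply: CnD.
  apply: (@Cn_comp n _ _ _ (fun q : (R * V) * (R * V) => (q.1.1, q.2.2)) _ _ IH).
  apply: (@Cn_pair n _ R V).
    exact: (Cn_comp C1 (Cn_fst _ _ _)).
  exact: (Cn_comp C2 (Cn_snd _ _ _)).
apply: (@Cn_comp n _ _ _ (fun q : (R * V) * (R * V) => (q.2.1, q.1.2)) _ _ IH).
apply: (@Cn_pair n _ R V).
  exact: (Cn_comp C2 (Cn_fst _ _ _)).
exact: (Cn_comp C1 (Cn_snd _ _ _)).
Qed.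

Lemma CnZ n (V W : normedModType R) (k : V -> R) (f : V -> W) :
  Cn n k -> Cn n f -> Cn n (fun x => k x *: f x).
Proof. by move=> Ck Cf; exact: Cn_comp (Cn_pair Ck Cf) (Cn_scale_pair n W). Qed.

Lemma CnM n (V : normedModType R) (f g : V -> R) :
  Cn n f -> Cn n g -> Cn n (fun x => f x * g x).
Proof. exact: CnZ. Qed.

Lemma Cn_prod n (V : normedModType R) I (s : seq I) (f : I -> V -> R) :
  (forall i, Cn n (f i)) -> Cn n (fun x => \prod_(i <- s) f i x).
Proof.
move=> Cf; elim: s => [|i s IH].
  by under eq_fun do rewrite big_nil; exact: Cn_cst.
by under eq_fun do rewrite big_cons; exact: CnM.
Qed.

Lemma Cn_entry n k l (V : normedModType R) (f : V -> 'M[R]_(k, l)) i j :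
  Cn n f -> Cn n (fun x => f x i j).
Proof.
move=> Cf; apply: (Cn_comp (g := fun M : 'M[R]_(k, l) => M i j) Cf).
apply: Cn_linear => [a p q|]; first by rewrite !mxE.
exact: coord_continuous.
Qed.

Lemma Cn_mx n k l (V : normedModType R) (f : V -> 'M[R]_(k, l)) :
  (forall i j, Cn n (fun x => f x i j)) -> Cn n f.
Proof.
move=> Cf; have -> : f = fun x => \sum_i \sum_j f x i j *: delta_mx i j.
  by apply/funext => x; exact: matrix_sum_delta.
apply: Cn_sum => i _; apply: Cn_sum => j _; apply: CnZ => //.
exact: Cn_cst.
Qed.

Lemma Cn_diff_along n (U V W : normedModType R) (f : V -> W) (g h : U -> V) :
  Cn n.+1 f -> Cn n g -> Cn n h -> Cn n (fun x => 'd f (g x) (h x)).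
Proof.
move=> [_ Tf] Cg Ch.
exact: (Cn_comp (g := fun p : V * V => 'd f (p.1) p.2) (Cn_pair Cg Ch)).
Qed.

End smooth_functions.

(** * Smooth dependence of a flow on its initial value *)

Lemma norm_le_eps {R : realType} {V : normedModType R} (x : V) (C : R) :
  (forall e : R, 0 < e -> `|x| <= C * e) -> x = 0.
Proof.
move=> H; apply/eqP; rewrite -normr_le0; apply/ler_addgt0Pl => e e0.
rewrite addr0; have C1 : 0 < `|C| + 1 by rewrite ltr_pwDr.
apply: (le_trans (H (e / (`|C| + 1)) _)); first exact: divr_gt0.
rewrite mulrA ler_pdivrMr// mulrC ler_wpM2l ?(ltW e0)//.
by rewrite (le_trans (ler_norm _))// lerDl.
Qed.

Lemma is_derive_pair {R : realType} {V W : normedModType R} (f : R -> V) (g : R -> W) t a b :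
  is_derive t (1 : R) f a -> is_derive t (1 : R) g b ->
  is_derive t (1 : R) (fun s => (f s, g s)) (a, b).
Proof.
move=> /is_derive_edP Hf /is_derive_edP Hg; apply/is_derive_edP => e e0.
have [k1 k10 H1] := Hf e e0; have [k2 k20 H2] := Hg e e0.
exists (Num.min k1 k2); first by rewrite lt_min k10.
move=> s; rewrite lt_min => /andP[/H1 s1 /H2 s2].
by rewrite [X in `|X|](_ : _ = (f (t + s *: 1) - f t - s *: a, g (t + s *: 1) - g t - s *: b))//
  prod_norm_le s1.
Qed.

Lemma dist_between {R : realType} (a b x : R) :
  Num.min a b <= x <= Num.max a b -> `|x - a| <= `|b - a|.
Proof.
by have [ab|ab] := leP a b => /andP[x1 x2]; [rewrite !ger0_norm|rewrite !ler0_norm]; lra.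
Qed.

Section flow.
Context {R : realType} {V : normedModType R} (pV : proper V).
Context (G : V -> V) (Phi : R -> V -> V).
Hypothesis G1 : Cn 1 G.
Hypothesis dPhi : forall t w, is_derive t (1 : R) (fun s => Phi s w) (G (Phi t w)).
Hypothesis Phi0 : forall w, Phi 0 w = w.
Hypothesis bPhi : forall r : R, exists M, forall t w, `|t| <= r -> `|w| <= r -> `|Phi t w| <= M.

Lemma flow_lipschitz (r : R) : exists2 C : R, 0 <= C & forall t w w',
  `|t| <= r -> `|w| <= r -> `|w'| <= r -> `|Phi t w' - Phi t w| <= C * `|w' - w|.
Proof.
have [M HM] := bPhi r; have [L L0 HL] := C1_lipschitz pV M G1.
exists (expR (L * r)); first exact: expR_ge0.
move=> t w w' tr wr w'r.
have := @gronwall_sym _ _ (fun s => Phi s w' - Phi s w)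
  (fun s => G (Phi s w') - G (Phi s w)) L 0 r L0 (lexx _) _ _ t tr.
rewrite !Phi0 mul0r addr0 mulrC; apply=> s sr.
by rewrite addr0; apply: HL; apply: HM.
Qed.

(** The difference quotient in the initial value. It solves the linearised equation up to a small
    error, and the properties of the derivative [D] are obtained from it in the limit. *)
Let Q (h : R) (w v : V) (t : R) := h^-1 *: (Phi t (w + h *: v) - Phi t w).
Let D (t : R) (w v : V) := 'D_v (Phi t) w.

Lemma quot_bound (r : R) : exists2 C : R, 0 <= C & forall (h : R) (w v : V) (t : R),
  h != 0 -> `|h| <= 1 -> `|w| <= r -> `|v| <= r -> `|t| <= r -> `|Q h w v t| <= C * `|v|.
Proof.
have [C C0 HC] := flow_lipschitz (2 * r); exists C => // h w v t h0 h1 wr vr tr.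
have r0 : 0 <= r by exact: le_trans wr.
rewrite normrZ normfV ler_pdivrMl ?normr_gt0// mulrCA -normrZ.
have hv : `|w + h *: v| <= 2 * r.
  rewrite (le_trans (ler_normD _ _))// normrZ.
  have : `|h| * `|v| <= 1 * r by rewrite ler_pM.
  by lra.
have := HC t w (w + h *: v) _ _ hv; rewrite addrAC subrr add0r; apply; lra.
Qed.

Lemma quot_derive h w v t : h != 0 ->
  is_derive t (1 : R) (Q h w v) (h^-1 *: (G (Phi t (w + h *: v)) - G (Phi t w))).
Proof. by move=> h0; apply: is_deriveZ. Qed.

(** By strict differentiability of [G], both quotients solve [u' = 'd G (Phi s w1) u] up to an error
    [e' * (B * r)]; Gronwall's inequality then compares them, the initial difference being
    [v1 - v2]. Varying [h], [w] and [v] together yields at once the Cauchy property and the uniform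
    continuity of the derivative. *)
Lemma quot_close (r e : R) : 0 < e -> exists2 k : R, 0 < k &
  forall (h1 h2 : R) (w1 w2 v1 v2 : V) (t : R), h1 != 0 -> h2 != 0 -> `|h1| < k -> `|h2| < k ->
  `|w1| <= r -> `|w2| <= r -> `|v1| <= r -> `|v2| <= r ->
  `|w1 - w2| < k -> `|v1 - v2| < k -> `|t| <= r ->
  `|Q h1 w1 v1 t - Q h2 w2 v2 t| <= e.
Proof.
move=> e0.
have [r0|r0] := ltP r 0.
  by exists 1 => // h1 h2 w1 w2 *; have := normr_ge0 w1; lra.
have [M HM] := bPhi (2 * r).
have [C C0 HC] := flow_lipschitz (2 * r).
have [B B0 HB] := quot_bound r.
have [L L0 HL] := C1_diff_bounded pV M G1.
pose E := expR (L * r); have E0 : 0 < E by exact: expR_gt0.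
have Br : 0 < 4 * (B * r * r + 1) * E.
  by rewrite !mulr_gt0// ltr_pwDr// !mulr_ge0.
pose e' := e / (4 * (B * r * r + 1) * E).
have e'0 : 0 < e' by exact: divr_gt0.
have [k1 k10 Hk1] := C1_strict pV M G1 e'0.
have C1r : 0 < (C + 1) * (1 + r) by rewrite mulr_gt0//; lra.
(* [1] keeps [w + h *: v] in the ball of radius [2 * r], the second bound gives
   [|v1 - v2| * E <= e / 2], and the third keeps the trajectories within [k1] of the one from [w1].
   The value of [e'] leaves at most [e / 2] for the accumulated error. *)
pose k := Num.min 1 (Num.min (e / (2 * E)) (k1 / ((C + 1) * (1 + r)))).
have k0 : 0 < k by rewrite !lt_min ltr01 !divr_gt0// mulr_gt0.
have kle : [/\ k <= 1, k <= e / (2 * E) & k <= k1 / ((C + 1) * (1 + r))].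
  by split; rewrite /k ?ge_min ?lexx ?orbT.
exists k => // h1 h2 w1 w2 v1 v2 t h10 h20 h1k h2k w1r w2r v1r v2r w12 v12 tr.
case: kle => kle1 kle2 kle3.
have small (w w' : V) : `|w| <= 2 * r -> `|w'| <= 2 * r -> `|w' - w| <= k + k * r ->
    forall s, `|s| <= r -> `|Phi s w' - Phi s w| < k1.
  move=> wr w'r ww s sr; apply: (le_lt_trans (HC _ _ _ _ wr w'r)); first lra.
  have : C * `|w' - w| <= C * (k + k * r) by rewrite ler_wpM2l.
  move/le_lt_trans; apply.
  have : k * ((C + 1) * (1 + r)) <= k1 by rewrite -ler_pdivlMr.
  apply: lt_le_trans; have : 0 < k * (1 + r) by rewrite mulr_gt0//; lra.
  by lra.
have hv (h : R) (w v : V) : `|h| < k -> `|w| <= r -> `|v| <= r -> `|w + h *: v| <= 2 * r /\ `|h *: v| <= k * r.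
  move=> hk wr vr; have H : `|h *: v| <= k * r by rewrite normrZ ler_pM// ltW.
  split=> //; rewrite (le_trans (ler_normD _ _))//.
  have : k * r <= 1 * r by rewrite ler_wpM2r.
  by lra.
pose u s := Q h1 w1 v1 s - Q h2 w2 v2 s.
pose dq h w v s := h^-1 *: (G (Phi s (w + h *: v)) - G (Phi s w)).
have du s : is_derive s (1 : R) u (dq h1 w1 v1 s - dq h2 w2 v2 s).
  by apply: is_deriveB; apply: quot_derive.
have dqE (h : R) (w v : V) (s : R) : h != 0 -> `|h| < k -> `|w| <= r -> `|v| <= r -> `|w1 - w| < k -> `|s| <= r ->
    `|dq h w v s - 'd G (Phi s w1) (Q h w v s)| <= e' * (B * r).
  move=> h0 hk wr vr w1w sr; rewrite /dq /Q.
  rewrite (linearZZ ('d G (Phi s w1))) -scalerBr normrZ.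
  have [hv1 hv2] := hv h w v hk wr vr.
  have r2 : r <= 2 * r by lra.
  have kr : 0 <= k * r by rewrite mulr_ge0// ltW.
  have : `|G (Phi s (w + h *: v)) - G (Phi s w) -
      'd G (Phi s w1) (Phi s (w + h *: v) - Phi s w)| <=
      e' * `|Phi s (w + h *: v) - Phi s w|.
    apply: Hk1.
    - by apply: HM; rewrite (le_trans _ r2).
    - apply: small => //; rewrite ?(le_trans _ r2)// distrC.
      by rewrite (le_trans (ltW w1w))// lerDl.
    - apply: small => //; rewrite ?(le_trans w1r r2)//.
      rewrite [_ - w1](_ : _ = (w - w1) + h *: v); last by vring R V.
      by rewrite (le_trans (ler_normD _ _))// lerD// distrC ltW.
  move=> H; apply: (@le_trans _ _ (e' * `|Q h w v s|)).
    by rewrite [`|Q _ _ _ _|]normrZ mulrCA ler_wpM2l.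
  rewrite ler_wpM2l ?(ltW e'0)// (le_trans (HB _ _ _ _ _ _ _ _ _))//.
    by rewrite (le_trans (ltW hk)).
  by rewrite ler_wpM2l.
have := @gronwall_sym _ _ u _ L (e' * (2 * (B * r))) r L0 _ (fun s _ => du s) _ t tr.
have d0 : 0 <= e' * (2 * (B * r)).
  have Br0 : 0 <= B * r by rewrite mulr_ge0.
  by rewrite mulr_ge0 ?(ltW e'0)// mulr_ge0.
move=> /(_ d0) H.
have {}H : `|u t| <= (`|u 0| + e' * (2 * (B * r)) * r) * E.
  apply: H => s sr.
  have -> : dq h1 w1 v1 s - dq h2 w2 v2 s =
    (dq h1 w1 v1 s - 'd G (Phi s w1) (Q h1 w1 v1 s)) -
    (dq h2 w2 v2 s - 'd G (Phi s w1) (Q h2 w2 v2 s)) + 'd G (Phi s w1) (u s).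
    have -> : 'd G (Phi s w1) (u s) = 'd G (Phi s w1) (Q h1 w1 v1 s) -
        'd G (Phi s w1) (Q h2 w2 v2 s) by exact: linearB.
    by vring R V.
  rewrite (le_trans (ler_normD _ _))// addrC lerD//.
    by apply: HL; apply: HM; lra.
  rewrite (le_trans (ler_normB _ _))//.
  have -> : e' * (2 * (B * r)) = e' * (B * r) + e' * (B * r) by ring.
  by rewrite lerD// dqE// subrr normr0.
have u0 : u 0 = v1 - v2.
  by rewrite /u /Q !Phi0 ![_ + _ *: _]addrC !addrK !scalerA !mulVf// !scale1r.
apply: (le_trans H); rewrite u0.
have H1 : `|v1 - v2| * E <= e / 2.
  have : k * (2 * E) <= e by rewrite -ler_pdivlMr// mulr_gt0.
  have : `|v1 - v2| * E <= k * E by rewrite ler_wpM2r ?(ltW E0)// ltW.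
  by lra.
have H2 : e' * (2 * (B * r)) * r * E <= e / 2.
  have e'E : e' * (4 * (B * r * r + 1) * E) = e by rewrite /e' divfK// gt_eqF.
  have : 0 <= e' * E by rewrite mulr_ge0// ltW.
  by lra.
by rewrite mulrDl; lra.
Qed.

(** The quotients form a Cauchy filter by [quot_close] taken at a fixed point and direction, and
    they stay in a closed ball; compactness of that ball provides the limit. *)
Lemma flow_derivable t w v : derivable (Phi t) w v.
Proof.
pose r := `|w| + `|v| + `|t|.
have [wr vr tr] : [/\ `|w| <= r, `|v| <= r & `|t| <= r].
  have := normr_ge0 w; have := normr_ge0 v; have := normr_ge0 t.
  by rewrite /r => *; split; lra.
have [C C0 HC] := quot_bound r.
have cvgQ : cvg ((fun h => Q h w v t) @ 0^').
  apply: (@compact_cauchy_cvg _ [set x : V | `|x| <= C * `|v|]).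
  - apply/cauchy_ballP => e e0.
    have [k k0 Hk] := quot_close r (divr_gt0 e0 (ltr0n _ 2)).
    pose A := [set q : V | exists h : R, [/\ h != 0, `|h| < k & q = Q h w v t]].
    have FA : ((fun h => Q h w v t) @ 0^') A.
      change (\forall h \near 0^', A (Q h w v t)).
      rewrite near_withinE; apply/nbhs_ballP; exists k => //= h.
      by rewrite /ball/= sub0r normrN => hk h0; exists h.
    exists (A, A) => //= -[_ _] /= [[h1 [h10 h1k ->]] [h2 [h20 h2k ->]]].
    rewrite -ball_normE /ball_/=; apply: (@le_lt_trans _ _ (e / 2)); last first.
      by rewrite ltr_pdivrMr// ltr_pMr// ltr1n.
    by apply: Hk; rewrite ?subrr ?normr0.
  - change (\forall h \near 0^', `|Q h w v t| <= C * `|v|).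
    rewrite near_withinE; apply/nbhs_ballP; exists 1 => //= h.
    by rewrite /ball/= sub0r normrN => h1 h0; apply: HC => //; exact: ltW.
  - exact: pV.
rewrite /derivable.
have <- // : (fun h => Q h w v t) = fun h => h^-1 *: ((Phi t \o shift w) (h *: v) - Phi t w).
by apply/funext => h; rewrite /Q /= [h *: v + w]addrC.
Qed.

Lemma quot_cvg t w v (e : R) : 0 < e -> exists2 k : R, 0 < k &
  forall h, h != 0 -> `|h| < k -> `|Q h w v t - D t w v| <= e.
Proof.
move=> e0; have /is_derive_edP/(_ e e0)[k k0 Hk] := derivableP (@flow_derivable t w v).
exists k => // h h0 /Hk; rewrite -/(D t w v) => {}Hk.
have -> : Q h w v t - D t w v = h^-1 *: (Phi t (w + h *: v) - Phi t w - h *: D t w v).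
  by rewrite [RHS]scalerBr scalerA mulVf// scale1r.
by rewrite normrZ normfV ler_pdivrMl ?normr_gt0// mulrC.
Qed.

Lemma quot_derive_close (r e : R) : 0 < e -> exists2 k : R, 0 < k &
  forall (h : R) (w1 w2 v1 v2 : V) (t : R), h != 0 -> `|h| < k ->
  `|w1| <= r -> `|w2| <= r -> `|v1| <= r -> `|v2| <= r ->
  `|w1 - w2| < k -> `|v1 - v2| < k -> `|t| <= r ->
  `|Q h w1 v1 t - D t w2 v2| <= e.
Proof.
move=> e0; have [k k0 Hk] := quot_close r e0; exists k => // h w1 w2 v1 v2 t h0 hk *.
apply/ler_addgt0Pr => e' e'0; have [k' k'0 Hk'] := quot_cvg t w2 v2 e'0.
pose h2 := Num.min k k' / 2.
have m0 : 0 < Num.min k k' by rewrite lt_min k0.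
have h20 : 0 < h2 by rewrite divr_gt0.
have : `|h2| < Num.min k k' by rewrite gtr0_norm// /h2; lra.
rewrite lt_min => /andP[h2k h2k'].
have h2n : h2 != 0 by rewrite gt_eqF.
rewrite -(subrKA (Q h2 w2 v2 t)) (le_trans (ler_normD _ _))// lerD//.
  by apply: Hk.
exact: Hk'.
Qed.

Lemma derive_close (r e : R) : 0 < e -> exists2 k : R, 0 < k &
  forall (w1 w2 v1 v2 : V) (t : R),
  `|w1| <= r -> `|w2| <= r -> `|v1| <= r -> `|v2| <= r ->
  `|w1 - w2| < k -> `|v1 - v2| < k -> `|t| <= r ->
  `|D t w1 v1 - D t w2 v2| <= e.
Proof.
move=> e0; have e20 : 0 < e / 2 by rewrite divr_gt0.
have [k k0 Hk] := quot_derive_close r e20; exists k => // w1 w2 v1 v2 t *.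
have h0 : 0 < k / 2 by rewrite divr_gt0.
have hk : `|k / 2| < k by rewrite gtr0_norm//; lra.
have hn : k / 2 != 0 by rewrite gt_eqF.
rewrite -(subrKA (Q (k / 2) w1 v1 t)) (le_trans (ler_normD _ _))// (splitr e) lerD//.
  by rewrite distrC; apply: Hk; rewrite ?subrr ?normr0.
exact: Hk.
Qed.

Lemma derive_norm_le (r : R) : exists2 C : R, 0 <= C & forall (w v : V) (t : R),
  `|w| <= r -> `|t| <= r -> `|D t w v| <= C * `|v|.
Proof.
have [C C0 HC] := flow_lipschitz (`|r| + 1); exists C => // w v t wr tr.
apply/ler_addgt0Pr => e e0; have [k k0 Hk] := quot_cvg t w v e0.
have v10 : 0 < `|v| + 1 by rewrite ltr_pwDr.
pose h := Num.min k (1 / (`|v| + 1)) / 2.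
have m0 : 0 < Num.min k (1 / (`|v| + 1)) by rewrite lt_min k0 divr_gt0.
have h0 : 0 < h by rewrite divr_gt0.
have : `|h| < Num.min k (1 / (`|v| + 1)) by rewrite gtr0_norm// /h; lra.
rewrite lt_min => /andP[hk]; rewrite ltr_pdivlMr// => hv.
have hn0 : h != 0 by rewrite gt_eqF.
have rr : r <= `|r| + 1 by rewrite (le_trans (ler_norm _))// lerDl.
have -> : D t w v = Q h w v t + - (Q h w v t - D t w v) by vring R V.
rewrite (le_trans (ler_normD _ _))// normrN lerD//; last exact: Hk.
rewrite normrZ normfV ler_pdivrMl ?normr_gt0// mulrCA -normrZ.
have := HC t w (w + h *: v); rewrite addrAC subrr add0r; apply; try exact: le_trans rr.
rewrite (le_trans (ler_normD _ _))// normrZ.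
have : `|h| * `|v| <= `|h| * (`|v| + 1) by rewrite ler_wpM2l// lerDl.
have := ler_norm r; lra.
Qed.

(** Homogeneity substitutes [h * a] for [h]. Additivity follows the broken path from [w] to
    [w + h *: v1] and then along [v2]; the moving base point is harmless because [quot_derive_close]
    is uniform in it. *)
Lemma derive_linear t w : linear (D t w).
Proof.
have DZ (a : R) v : D t w (a *: v) = a *: D t w v.
  have [->|a0] := eqVneq a 0; first by rewrite !scale0r /D derive0.
  apply/subr0_eq; apply: (@norm_le_eps _ _ _ (1 + `|a|)) => e e0.
  have [k1 k10 H1] := quot_cvg t w (a *: v) e0.
  have [k2 k20 H2] := quot_cvg t w v e0.
  have a1 : 0 < `|a| + 1 by rewrite ltr_pwDr.
  pose h := Num.min k1 (k2 / (`|a| + 1)) / 2.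
  have m0 : 0 < Num.min k1 (k2 / (`|a| + 1)) by rewrite lt_min k10 divr_gt0.
  have h0 : 0 < h by rewrite divr_gt0.
  have : `|h| < Num.min k1 (k2 / (`|a| + 1)) by rewrite gtr0_norm// /h; lra.
  rewrite lt_min => /andP[hk1]; rewrite ltr_pdivlMr// => hk2.
  have hn0 : h != 0 by rewrite gt_eqF.
  have QE : Q h w (a *: v) t = a *: Q (h * a) w v t.
    have aE : a * (h * a)^-1 = h^-1 by rewrite invfM mulrCA divff// mulr1.
    by rewrite /Q scalerA -aE [RHS]scalerA.
  have -> : D t w (a *: v) - a *: D t w v =
     - (Q h w (a *: v) t - D t w (a *: v)) + a *: (Q (h * a) w v t - D t w v).
    by rewrite QE; vring R V.
  rewrite (le_trans (ler_normD _ _))// normrN normrZ mulrDl mul1r lerD ?H1//.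
  have ha : `|h * a| < k2.
    rewrite normrM; apply: le_lt_trans hk2.
    by rewrite mulrDr mulr1 lerDl.
  by rewrite ler_wpM2l//; apply: H2; rewrite // mulf_neq0.
have DD v1 v2 : D t w (v1 + v2) = D t w v1 + D t w v2.
  apply/subr0_eq; apply: (@norm_le_eps _ _ _ 3) => e e0.
  pose r := `|w| + `|v1| + `|v2| + `|t|.
  have := normr_ge0 w; have := normr_ge0 v1; have := normr_ge0 v2; have := normr_ge0 t.
  move=> t0 v20 v10 w0.
  have [k k0 Hk] := quot_derive_close r e0.
  pose h := Num.min 1 (k / (`|v1| + 1)) / 2.
  have v11 : 0 < `|v1| + 1 by rewrite ltr_pwDr.
  have m0 : 0 < Num.min 1 (k / (`|v1| + 1)) by rewrite lt_min ltr01 divr_gt0.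
  have h0 : 0 < h by rewrite divr_gt0.
  have : `|h| < Num.min 1 (k / (`|v1| + 1)) by rewrite gtr0_norm// /h; lra.
  rewrite lt_min => /andP[hk1]; rewrite ltr_pdivlMr// => hk2.
  have hn0 : h != 0 by rewrite gt_eqF.
  have nh := normr_ge0 h.
  have nhv : `|h *: v1| < k by rewrite normrZ; nra.
  have QE : Q h w (v1 + v2) t = Q h (w + h *: v1) v2 t + Q h w v1 t.
    have E : w + h *: (v1 + v2) = w + h *: v1 + h *: v2 by vring R V.
    by rewrite /Q -scalerDr E subrKA.
  have -> : D t w (v1 + v2) - (D t w v1 + D t w v2) =
     - (Q h w (v1 + v2) t - D t w (v1 + v2)) + (Q h (w + h *: v1) v2 t - D t w v2)
     + (Q h w v1 t - D t w v1).
    by rewrite QE; vring R V.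
  rewrite (le_trans (ler_normD _ _))//.
  have -> : 3 * e = e + e + e by ring.
  have hv1 : `|h *: v1| <= `|v1| by rewrite normrZ ler_piMl// ltW.
  have hk : `|h| < k by nra.
  rewrite lerD//.
    rewrite (le_trans (ler_normD _ _))// lerD//.
      rewrite normrN; apply: Hk => //; rewrite ?subrr ?normr0 /r//; try lra.
        by rewrite (le_trans (ler_normD _ _))//; lra.
      by rewrite (le_trans (ler_normD _ _))//; lra.
    apply: Hk => //; rewrite ?subrr ?normr0 /r//; try lra.
      by rewrite (le_trans (ler_normD _ _))//; lra.
    by rewrite addrAC subrr add0r.
  by apply: Hk => //; rewrite ?subrr ?normr0 /r//; lra.
by move=> a u v; rewrite DD DZ.
Qed.

(** The quotients converge uniformly over unit directions; taking [h = |v|] upgrades directional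
    derivatives to a differential. *)
Lemma flow_diff_state t w : differentiable (Phi t) w /\ 'd (Phi t) w = D t w :> (V -> V).
Proof.
pose r := `|w| + 1 + `|t|.
have := normr_ge0 w; have := normr_ge0 t => t0 w0.
have [C C0 HC] := derive_norm_le r.
apply: (@differentiable_ed _ _ _ _ _ _ C); first exact: derive_linear.
  by move=> v; apply: HC; rewrite /r; lra.
move=> e e0; have [k k0 Hk] := quot_derive_close r e0.
exists k => // v vk.
have [->|v0] := eqVneq v 0.
  by rewrite addr0 subrr /D derive0 subr0 !normr0 mulr0.
have nv0 : 0 < `|v| by rewrite normr_gt0.
pose u := `|v|^-1 *: v.
have u1 : `|u| = 1 by rewrite normrZ normfV normr_id mulVf// gt_eqF.
have vE : v = `|v| *: u by rewrite scalerA mulfV ?gt_eqF// scale1r.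
have := Hk `|v| w w u u t; rewrite normr_id subrr normr0 u1 subrr normr0.
rewrite gt_eqF// => /(_ isT vk) H.
have {}H : `|Q `|v| w u t - D t w u| <= e by apply: H => //; rewrite /r; lra.
have DvE : D t w v = `|v| *: D t w u.
  by have := derive_linear t w `|v| u 0; rewrite addr0 -vE => ->; rewrite /D derive0 addr0.
have -> : Phi t (w + v) - Phi t w - D t w v = `|v| *: (Q `|v| w u t - D t w u).
  by rewrite scalerBr /Q scalerA mulfV ?gt_eqF// scale1r -vE DvE.
by rewrite normrZ normr_id mulrC ler_wpM2r.
Qed.

Lemma flow_continuous : continuous (fun p : R * V => Phi p.1 p.2).
Proof.
apply/continuous_edP => -[t w] e e0 /=.
have := normr_ge0 w; have := normr_ge0 t => t0 w0.
have [C C0 HC] := flow_lipschitz (`|t| + `|w| + 1).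
have e20 : 0 < e / 2 by rewrite divr_gt0.
have /continuous_edP/(_ t _ e20)[k k0 Hk] : continuous (fun s => Phi s w).
  by move=> s; apply: differentiable_continuous; apply/derivable1_diffP; case: (dPhi s w).
have C1 : 0 < C + 1 by lra.
exists (Num.min (Num.min 1 k) (e / (2 * (C + 1)))).
  by rewrite !lt_min ltr01 k0 divr_gt0// mulr_gt0.
move=> -[t' w'] /=.
rewrite [X in `|X|](_ : _ = (t' - t, w' - w))// prod_norm_lt !lt_min.
move=> /andP[/andP[/andP[t1 tk] _] /andP[/andP[w1 _]]].
rewrite ltr_pdivlMr ?mulr_gt0// => we.
rewrite -(subrKA (Phi t' w)) (le_trans (ler_normD _ _))// (splitr e) lerD//; last exact: Hk.
have := ler_normB t' (- t); rewrite opprK.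
have t'E : `|t'| <= `|t| + 1.
  by rewrite -(subrK t t') (le_trans (ler_normD _ _))// addrC lerD2l ltW.
have w'E : `|w'| <= `|w| + 1.
  by rewrite -(subrK w w') (le_trans (ler_normD _ _))// addrC lerD2l ltW.
move=> _; apply: (le_trans (HC _ _ _ _ _ _)); try lra.
have := normr_ge0 (w' - w); nra.
Qed.

(** The variational equation, the derivatives in [t] and [w] being exchanged at the level of
    quotients. For fixed [s] the mean value inequality is applied to [Q h w v] between [t] and
    [t + s], with slope [l] and a bound [e] independent of [h]. *)
Lemma derive_flow_ode t w v :
  is_derive t (1 : R) (fun s => D s w v) ('d G (Phi t w) (D t w v)).
Proof.
apply/is_derive_edP => e e0.
have [r [rt rw rv r1]] : exists r : R, [/\ `|t| + 1 <= r, `|w| <= r, `|v| <= r & 1 <= r].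
  exists (`|t| + `|w| + `|v| + 1).
  have := normr_ge0 w; have := normr_ge0 t; have := normr_ge0 v.
  by move=> *; split; lra.
have v0 := normr_ge0 v; have r0 : 0 <= r by exact: le_trans r1.
have [M HM] := bPhi (r + r).
have [L L0 HL] := C1_diff_bounded pV M G1.
have [B B0 HB] := quot_bound r.
have Bv1 : 0 < B * `|v| + 1 by rewrite ltr_pwDr// mulr_ge0.
pose e1 := e / (2 * (B * `|v| + 1)).
have e10 : 0 < e1 by rewrite divr_gt0// mulr_gt0.
have [k1 k10 Hk1] := C1_strict pV M G1 e10.
have cPhi := (continuous_edP _).1 flow_continuous (t, w).
have [k2 k20 Hk2] := cPhi (k1 / 2) (divr_gt0 k10 (ltr0n _ 2)).
have [K K0 HK] : exists2 K : R, 0 <= K & forall h s, h != 0 -> `|h| <= 1 -> `|s| <= r ->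
    `|h^-1 *: (G (Phi s (w + h *: v)) - G (Phi s w))| <= K.
  have [L2 L20 HL2] := C1_lipschitz pV M G1.
  exists (L2 * (B * `|v|)); first by rewrite !mulr_ge0.
  move=> h s h0 h1 sr; rewrite normrZ normfV ler_pdivrMl ?normr_gt0//.
  have hv : `|w + h *: v| <= r + r.
    rewrite (le_trans (ler_normD _ _))// normrZ.
    have : `|h| * `|v| <= 1 * `|v| by rewrite ler_wpM2r.
    by lra.
  apply: (le_trans (HL2 (Phi s w) (Phi s (w + h *: v)) _ _)).
  - by apply: HM; rewrite ler_wpDr.
  - by apply: HM; rewrite // ler_wpDr.
  rewrite mulrCA ler_wpM2l//.
  have := HB h w v s h0 h1; rewrite normrZ normfV ler_pdivrMl ?normr_gt0//.
  by apply; lra.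
have L10 : 0 < 4 * (L + 1) by lra.
have LK10 : 0 < 4 * (L * K + 1) by have : 0 <= L * K by [rewrite mulr_ge0|]; lra.
(* [1] keeps the times below [r], [k2 / 2] keeps the trajectories within [k1] of [Phi t w], and the
   last bound gives [L * (K * |s|) <= e / 4], where [K] bounds the time derivative of the
   quotients. *)
pose d := Num.min (Num.min 1 (k2 / 2)) (e / (4 * (L * K + 1))).
have d0 : 0 < d by rewrite !lt_min ltr01 !divr_gt0.
exists d => // s sd.
have [s1 sk2 se] : [/\ `|s| < 1, `|s| < k2 / 2 & `|s| * (4 * (L * K + 1)) < e].
  by move: sd; rewrite /d !lt_min => /andP[/andP[-> ->]]; rewrite ltr_pdivlMr.
have sk2' : `|s| < k2 by lra.
have sE : s *: (1 : R) = s by exact: mulr1.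
rewrite sE.
set l := 'd G (Phi t w) (D t w v).
(* Pass to the limit [h -> 0] in the mean value inequality for the quotients. *)
suff H : forall e' : R, 0 < e' -> exists h, [/\ `|Q h w v (t + s) - D (t + s) w v| <= e',
    `|Q h w v t - D t w v| <= e' & `|Q h w v (t + s) - Q h w v t - s *: l| <= e * `|s|].
  apply/ler_addgt0Pr => e' e'0; have [h [h1 h2 h3]] := H (e' / 2) (divr_gt0 e'0 (ltr0n _ 2)).
  have -> : D (t + s) w v - D t w v - s *: l = (Q h w v (t + s) - Q h w v t - s *: l) +
     ((Q h w v t - D t w v) - (Q h w v (t + s) - D (t + s) w v)) by vring R V.
  rewrite (le_trans (ler_normD _ _))// lerD//.
  by rewrite (le_trans (ler_normB _ _))//; lra.
move=> e' e'0.
have LKe : 0 < e / (4 * (L + 1)) by rewrite divr_gt0.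
have [h1 h10 H1] := quot_cvg (t + s) w v e'0.
have [h2 h20 H2] := quot_cvg t w v e'0.
have [h3 h30 H3] := quot_cvg t w v LKe.
have v10 : 0 < `|v| + 1 by lra.
pose m := Num.min (Num.min (Num.min 1 h1) (Num.min h2 h3)) (k2 / (`|v| + 1)).
have m0 : 0 < m by rewrite !lt_min ltr01 h10 h20 h30 divr_gt0.
pose h := m / 2; have h0 : 0 < h by rewrite divr_gt0.
have : `|h| < m by rewrite gtr0_norm// /h; lra.
rewrite !lt_min => /andP[/andP[/andP[hh hh1] /andP[hh2 hh3]]]; rewrite ltr_pdivlMr// => hv.
have hn : h != 0 by rewrite gt_eqF.
exists h; split; [exact: H1|exact: H2|].
have mv := @mean_value_le _ _ (Q h w v) (fun s => h^-1 *: (G (Phi s (w + h *: v)) - G (Phi s w))).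
have := mv l e t (t + s) (ltW e0) (fun x _ => quot_derive w v x hn).
rewrite [t + s - t](_ : _ = s); last by ring.
apply=> x xts.
have xt : `|x - t| <= `|s|.
  by have := dist_between xts; rewrite [t + s]addrC addrK.
have near_t y : `|y - t| <= `|s| -> `|y| <= r.
  move=> yt; apply: le_trans rt; rewrite -(subrK t y) (le_trans (ler_normD _ _))//.
  by rewrite addrC lerD2l (le_trans yt)// ltW.
have Qx : `|Q h w v x - Q h w v t| <= K * `|s|.
  have := mv 0 K t x K0 (fun x _ => quot_derive w v x hn).
  rewrite scaler0 subr0 => H; apply: (le_trans (H _)); last by rewrite ler_wpM2l.
  move=> y yx; rewrite subr0; apply: HK => //; first by rewrite ltW.
  by apply: near_t; apply: le_trans xt; exact: dist_between.
have xh : `|Phi x (w + h *: v) - Phi t w| < k1.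
  apply: (@le_lt_trans _ _ (k1 / 2)); last by rewrite gtr_pMr// invf_lt1// ltr1n.
  apply: (Hk2 (x, w + h *: v)).
  rewrite [X in `|X|](_ : _ = (x - t, w + h *: v - w))// prod_norm_lt.
  rewrite addrAC subrr add0r normrZ; apply/andP; split; first exact: le_lt_trans xt sk2'.
  by apply: le_lt_trans hv; rewrite ler_wpM2l// lerDl.
have x0 : `|Phi x w - Phi t w| < k1.
  apply: (@le_lt_trans _ _ (k1 / 2)); last by rewrite gtr_pMr// invf_lt1// ltr1n.
  apply: (Hk2 (x, w)).
  rewrite [X in `|X|](_ : _ = (x - t, w - w))// prod_norm_lt.
  by rewrite subrr normr0 k20 andbT; exact: le_lt_trans xt sk2'.
have Mt : `|Phi t w| <= M by apply: HM; rewrite ler_wpDr// (le_trans _ rt)// lerDl.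
have xr := near_t x xt.
have A1 := Hk1 _ _ _ Mt x0 xh.
have A2 : `|h^-1 *: (G (Phi x (w + h *: v)) - G (Phi x w)) - 'd G (Phi t w) (Q h w v x)| <= e / 2.
  rewrite (linearZZ ('d G (Phi t w))) -scalerBr normrZ normfV ler_pdivrMl ?normr_gt0//.
  apply: (le_trans A1).
  have := HB h w v x hn (ltW hh) rw rv xr.
  rewrite normrZ normfV ler_pdivrMl ?normr_gt0// => A3.
  apply: (@le_trans _ _ (e1 * (`|h| * (B * `|v|)))).
    by rewrite ler_wpM2l// ltW.
  rewrite mulrCA ler_wpM2l// /e1.
  have e1E : e / (2 * (B * `|v| + 1)) * (2 * (B * `|v| + 1)) = e.
    by rewrite divfK// gt_eqF// mulr_gt0.
  by move: e10; rewrite /e1; lra.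
rewrite -(subrKA ('d G (Phi t w) (Q h w v x))) (le_trans (ler_normD _ _))// (splitr e) lerD//.
have -> : 'd G (Phi t w) (Q h w v x) - l = 'd G (Phi t w) (Q h w v x - D t w v).
  by rewrite (linearB ('d G (Phi t w))).
rewrite (le_trans (HL _ _ Mt))//.
have A3 : `|Q h w v x - D t w v| <= K * `|s| + e / (4 * (L + 1)).
  rewrite -(subrKA (Q h w v t)) (le_trans (ler_normD _ _))// lerD//.
  exact: H3.
apply: (@le_trans _ _ (L * (K * `|s| + e / (4 * (L + 1))))); first by rewrite ler_wpM2l.
have e4 : e / (4 * (L + 1)) * (4 * (L + 1)) = e by rewrite divfK// gt_eqF.
by move: LKe; have := normr_ge0 s; lra.
Qed.

(** The increment is split into a time step starting from [w + v], handled by the mean value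
    inequality and the continuity of [G] along the flow, and a space step at time [t]. *)
Lemma flow_differentiable p : differentiable (fun p : R * V => Phi p.1 p.2) p /\
  'd (fun p : R * V => Phi p.1 p.2) p =
    (fun q => q.1 *: G (Phi p.1 p.2) + D p.1 p.2 q.2) :> (R * V -> V).
Proof.
case: p => t w /=.
have [C C0 HC] := derive_norm_le (`|t| + `|w|).
have := normr_ge0 w; have := normr_ge0 t => t0 w0.
apply: (@differentiable_ed _ _ _ _ _ _ (`|G (Phi t w)| + C)).
- move=> c [s1 v1] [s2 v2] /=; rewrite derive_linear -[c *: s1]/(c * s1).
  by vring R V.
- move=> [s v] /=; have /andP[sq vq] : (`|s| <= `|(s, v)|) && (`|v| <= `|(s, v)|).
    by rewrite -prod_norm_le.
  rewrite (le_trans (ler_normD _ _))// normrZ mulrDl lerD//.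
    by rewrite mulrC ler_wpM2l.
  by rewrite (le_trans (HC _ _ _ _ _))// ?ler_wpM2l//; lra.
move=> e e0; have e20 : 0 < e / 2 by rewrite divr_gt0.
have [dw dwE] := flow_diff_state t w.
have [k1 k10 H1] := diff_ed dw e20.
have cG : continuous (fun p : R * V => G (Phi p.1 p.2)).
  by move=> p; apply: (continuous_comp (flow_continuous (x := p))); exact: Cn_continuous G1 _.
have [k2 k20 H2] := (continuous_edP _).1 cG (t, w) _ e20.
exists (Num.min k1 k2); first by rewrite lt_min k10.
move=> [s v]; rewrite lt_min !prod_norm_lt /= => /andP[/andP[sk1 vk1] /andP[sk2 vk2]].
have /andP[sq vq] : (`|s| <= `|(s, v)|) && (`|v| <= `|(s, v)|) by rewrite -prod_norm_le.
have -> : Phi (t + s) (w + v) - Phi t w - (s *: G (Phi t w) + D t w v) =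
  (Phi (t + s) (w + v) - Phi t (w + v) - s *: G (Phi t w)) +
  (Phi t (w + v) - Phi t w - D t w v) by vring R V.
rewrite (le_trans (ler_normD _ _))// (splitr e) mulrDl lerD//; last first.
  by rewrite -dwE (le_trans (H1 _ vk1))// ler_wpM2l// ltW.
have := @mean_value_le _ _ (fun s => Phi s (w + v)) _ (G (Phi t w)) (e / 2) t (t + s)
  (ltW e20) (fun x _ => dPhi x (w + v)).
rewrite [t + s - t](_ : _ = s); last by ring.
move=> H; apply: (le_trans (H _)); last by rewrite ler_wpM2l// ltW.
move=> x xts; apply: (H2 (x, w + v)).
rewrite [X in `|X|](_ : _ = (x - t, w + v - w))// prod_norm_lt.
rewrite addrAC subrr add0r vk2 andbT; apply: le_lt_trans sk2.
by have := dist_between xts; rewrite [t + s]addrC addrK.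
Qed.

Lemma derive_flow_continuous : continuous (fun p : R * (V * V) => D p.1 p.2.1 p.2.2).
Proof.
apply/continuous_edP => -[t [w v]] e e0 /=; have e20 : 0 < e / 2 by rewrite divr_gt0.
have := normr_ge0 w; have := normr_ge0 t; have := normr_ge0 v => v0 t0 w0.
have [k1 k10 H1] := derive_close (`|t| + `|w| + `|v| + 1) e20.
have /continuous_edP/(_ t _ e20)[k2 k20 H2] : continuous (fun s => D s w v).
  move=> s; apply: differentiable_continuous; apply/derivable1_diffP.
  by case: (derive_flow_ode s w v).
exists (Num.min 1 (Num.min k1 k2)); first by rewrite !lt_min ltr01 k10.
move=> [t' [w' v']] /=.
rewrite [X in `|X|](_ : _ = (t' - t, (w' - w, v' - v)))// !prod_norm_lt !lt_min.
move=> /andP[/and3P[t1 tk1 tk2] /andP[/and3P[w1 wk1 _] /and3P[v1 vk1 _]]].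
rewrite -(subrKA (D t' w v)) (le_trans (ler_normD _ _))// (splitr e) lerD//; last exact: H2.
have E (U : normedModType R) (x x' : U) : `|x' - x| < 1 -> `|x'| <= `|x| + 1.
  by move=> xx; rewrite -(subrK x x') (le_trans (ler_normD _ _))// addrC lerD2l ltW.
have := E _ _ _ t1; have := E _ _ _ w1; have := E _ _ _ v1 => *.
by apply: H1; lra.
Qed.

End flow.

(** The pair [TPhi] of the flow and its derivative is the flow on [V * V] of [TG], which has one
    derivative fewer than [G]. The induction hypothesis for it, together with the formula for the
    differential of [Phi], gives one more derivative of [Phi]. The boundedness hypothesis is
    inherited by [TPhi] through [derive_norm_le]. *)
Theorem flow_smooth {R : realType} (n : nat) (V : normedModType R)
    (G : V -> V) (Phi : R -> V -> V) :
  proper V -> Cn n.+1 G ->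
  (forall t w, is_derive t (1 : R) (fun s => Phi s w) (G (Phi t w))) ->
  (forall w, Phi 0 w = w) ->
  (forall r : R, exists M, forall t w, `|t| <= r -> `|w| <= r -> `|Phi t w| <= M) ->
  Cn n.+1 (fun p : R * V => Phi p.1 p.2).
Proof.
elim: n V G Phi => [|n IH] V G Phi pV CG dPhi Phi0 bPhi.
  rewrite CnP; split=> [p|].
    by have [] := flow_differentiable pV CG dPhi Phi0 bPhi p.
  have -> : (fun p : (R * V) * (R * V) => 'd (fun p : R * V => Phi p.1 p.2) (p.1) p.2) =
    fun p => p.2.1 *: G (Phi p.1.1 p.1.2) + 'D_(p.2.2) (Phi p.1.1) p.1.2.
    by apply/funext => p; have [_ ->] := flow_differentiable pV CG dPhi Phi0 bPhi p.1.
  have C1 := Cn_fst 0 (R * V)%type (R * V)%type.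
  have C2 := Cn_snd 0 (R * V)%type (R * V)%type.
  apply: CnD; first apply: CnZ.
  - exact: (Cn_comp C2 (Cn_fst _ _ _)).
  - apply: (Cn_comp _ (CnS CG)).
    apply: (@Cn_comp _ 0 _ _ _ fst (fun p : R * V => Phi p.1 p.2)) => //.
    exact: flow_continuous dPhi Phi0 bPhi.
  apply: (@Cn_comp _ 0 _ _ _ (fun p : (R * V) * (R * V) => (p.1.1, (p.1.2, p.2.2)))
    (fun p => 'D_(p.2.2) (Phi p.1) p.2.1)); last exact: derive_flow_continuous dPhi Phi0 bPhi.
  apply: (@Cn_pair _ 0 _ R (V * V)%type); first exact: (Cn_comp C1 (Cn_fst _ _ _)).
  apply: (@Cn_pair _ 0 _ V V); first exact: (Cn_comp C1 (Cn_snd _ _ _)).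
  exact: (Cn_comp C2 (Cn_snd _ _ _)).
have CG1 : Cn 1 G by apply: Cn_le CG.
have dP := flow_differentiable pV CG1 dPhi Phi0 bPhi.
pose TG (p : V * V) := (G p.1, 'd G (p.1) p.2).
pose TPhi t (p : V * V) := (Phi t p.1, 'D_(p.2) (Phi t) p.1).
have CTG : Cn n.+1 TG.
  apply: Cn_pair; last by case: CG.
  by apply: (Cn_comp (Cn_fst _ _ _)); exact: CnS.
have CTPhi : Cn n.+1 (fun p : R * (V * V) => TPhi p.1 p.2).
  apply: (IH _ TG) => //.
  - exact: proper_prod.
  - move=> t [w v]; apply: (@is_derive_pair _ _ _ (fun s => Phi s w) (fun s => 'D_v (Phi s) w)).
    exact: (derive_flow_ode pV CG1 dPhi Phi0 bPhi).
  - move=> [w v]; rewrite /TPhi /= Phi0; congr pair.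
    have -> : Phi 0 = id by apply/funext => x; rewrite Phi0.
    exact: derive_id.
  - move=> r; have [M HM] := bPhi r.
    have [C C0 HC] := derive_norm_le pV CG1 dPhi Phi0 bPhi r.
    exists (Num.max M (C * r)) => t [w v] tr; rewrite prod_norm_le => /andP[wr vr].
    rewrite prod_norm_le !le_max HM//=; apply/orP; right.
    by rewrite (le_trans (HC _ _ _ _ _))// ler_wpM2l.
rewrite CnP; split=> [p|]; first by have [] := dP p.
have -> : (fun p : (R * V) * (R * V) => 'd (fun p : R * V => Phi p.1 p.2) (p.1) p.2) =
  fun p => p.2.1 *: G (TPhi p.1.1 (p.1.2, p.2.2)).1 + (TPhi p.1.1 (p.1.2, p.2.2)).2.
  by apply/funext => p; have [_ ->] := dP p.1.
have C1 := Cn_fst n.+1 (R * V)%type (R * V)%type.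
have C2 := Cn_snd n.+1 (R * V)%type (R * V)%type.
have CT : Cn n.+1 (fun p : (R * V) * (R * V) => TPhi p.1.1 (p.1.2, p.2.2)).
  apply: (@Cn_comp _ _ _ _ _ (fun p : (R * V) * (R * V) => (p.1.1, (p.1.2, p.2.2))) _ _ CTPhi).
  apply: (@Cn_pair _ _ _ R (V * V)%type); first exact: (Cn_comp C1 (Cn_fst _ _ _)).
  apply: (@Cn_pair _ _ _ V V); first exact: (Cn_comp C1 (Cn_snd _ _ _)).
  exact: (Cn_comp C2 (Cn_snd _ _ _)).
apply: CnD; last exact: (Cn_comp CT (Cn_snd _ _ _)).
apply: CnZ; first exact: (Cn_comp C2 (Cn_fst _ _ _)).
by apply: (Cn_comp _ (CnS CG)); exact: (Cn_comp CT (Cn_fst _ _ _)).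
Qed.

(** * Bounded continuous partial derivatives *)

Section continuous_partials.
Context {R : realType} {V : normedModType R} {I : Type}.
Context (s : seq I) (e : I -> V) (c : I -> V -> R) (E : seq V).
Hypothesis eE : forall i, e i \in E.
Hypothesis c_lin : forall i, linear (c i).
Hypothesis c_bnd : forall i v, `|c i v| <= `|v|.
Hypothesis c_basis : forall v, \sum_(i <- s) c i v *: e i = v.
Implicit Types f : V -> R.

Lemma is_derive_line f y w (t : R) : derivable f (y + t *: w) w ->
  is_derive t (1 : R) (fun t => f (y + t *: w)) ('D_w f (y + t *: w)).
Proof.
move=> /derivableP /is_derive_edP H; apply/is_derive_edP => k /H[k' k'0 Hk'].
exists k' => // u /Hk'; congr (`|f _ - _ - _| <= _).
by rewrite -[u *: 1]/(u * 1) mulr1 scalerDl addrA.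
Qed.

Lemma partial_close f x w (k : R) : (forall x, derivable f x w) -> continuous ('D_w f) ->
  0 < k -> exists2 d : R, 0 < d & forall y (a : R), `|y - x| < d -> `|a| < d ->
  `|f (y + a *: w) - f y - a * 'D_w f x| <= k * `|a|.
Proof.
move=> df /continuous_edP/(_ x k) H k0; have [d d0 Hd] := H k0.
have w1 : 0 < 1 + `|w| by rewrite ltr_pwDl.
exists (d / 2 / (1 + `|w|)); first by rewrite !divr_gt0.
move=> y a yx ax.
have := @mean_value_le R R (fun t => f (y + t *: w)) _ ('D_w f x) k 0 a (ltW k0)
  (fun t _ => is_derive_line (df _)).
rewrite scale0r addr0 subr0; apply=> t /dist_between; rewrite !subr0 => ta.
apply: Hd; rewrite [_ - x](_ : _ = (y - x) + t *: w); last by vring R V.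
rewrite (le_lt_trans (ler_normD _ _))// normrZ (splitr d) ltrD//.
  by rewrite (lt_le_trans yx)// ler_pdivrMr// ler_peMr ?lerDl// ltW// divr_gt0.
have : `|a| * (1 + `|w|) < d / 2 by rewrite -ltr_pdivlMr.
by apply: le_lt_trans; rewrite ler_pM// lerDr.
Qed.

(** The increment is made one coordinate at a time. The starting point [y] ranges over a
    neighbourhood of [x], because after each leg the induction resumes from a displaced point. *)
Lemma partials_close f (l : seq I) x (k : R) :
  (forall i x, derivable f x (e i)) -> (forall i, continuous ('D_(e i) f)) -> 0 < k ->
  exists2 d : R, 0 < d & forall y (a : I -> R), `|y - x| < d -> (forall i, `|a i| < d) ->
  `|f (y + \sum_(i <- l) a i *: e i) - f y - \sum_(i <- l) a i * 'D_(e i) f x|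
    <= k * \sum_(i <- l) `|a i|.
Proof.
move=> df cdf k0; elim: l => [|i l [d d0 IH]].
  by exists 1 => // y a _ _; rewrite !big_nil addr0 subrr subr0 normr0 mulr0.
have [d' d'0 Hd'] := partial_close x (df i) (cdf i) k0.
have w1 : 0 < 1 + `|e i| by rewrite ltr_pwDl.
exists (Num.min d' (d / 2 / (1 + `|e i|))); first by rewrite lt_min d'0 !divr_gt0.
move=> y a; rewrite lt_min => /andP[yd' yd] H.
have ad' j : `|a j| < d' by have := H j; rewrite lt_min => /andP[].
have ad j : `|a j| < d / 2 / (1 + `|e i|) by have := H j; rewrite lt_min => /andP[].
have dd : d / 2 / (1 + `|e i|) <= d / 2.
  by rewrite ler_pdivrMr// ler_peMr ?lerDl// ltW// divr_gt0.
have y' : `|y + a i *: e i - x| < d.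
  rewrite [_ - x](_ : _ = (y - x) + a i *: e i); last by vring R V.
  rewrite (le_lt_trans (ler_normD _ _))// normrZ (splitr d) ltrD//.
    exact: lt_le_trans dd.
  have : `|a i| * (1 + `|e i|) < d / 2 by rewrite -ltr_pdivlMr.
  by apply: le_lt_trans; rewrite ler_wpM2l// lerDr.
have {}IH := IH _ a y' _.
rewrite !big_cons addrA.
rewrite [X in `|X|](_ : _ =
  (f (y + a i *: e i + \sum_(j <- l) a j *: e j) - f (y + a i *: e i)
     - \sum_(j <- l) a j * 'D_(e j) f x) + (f (y + a i *: e i) - f y - a i * 'D_(e i) f x)).
  rewrite (le_trans (ler_normD _ _))// addrC mulrDr lerD//; first exact: Hd'.
  apply: IH => j; rewrite (lt_le_trans (ad j))// (le_trans dd)//.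
  by rewrite ler_pdivrMr// ler_peMr ?ler1n// ltW.
by ring.
Qed.

Lemma partials_diff f x :
  (forall i x, derivable f x (e i)) -> (forall i, continuous ('D_(e i) f)) ->
  differentiable f x /\
  'd f x = (fun v => \sum_(i <- s) c i v * 'D_(e i) f x) :> (V -> R).
Proof.
move=> df cdf.
apply: (@differentiable_ed _ _ _ _ _ _ (\sum_(i <- s) `|'D_(e i) f x|)).
- move=> a u v; rewrite [X in _ = X + _](_ : _ = a * (\sum_(i <- s) c i u * 'D_(e i) f x))//.
  rewrite mulr_sumr -big_split/=.
  by apply: eq_bigr => i _; rewrite c_lin -[a *: c i u]/(a * c i u) mulrDl mulrA.
- move=> v; rewrite (le_trans (ler_norm_sum _ _ _))// mulr_suml ler_sum// => i _.
  by rewrite normrM mulrC ler_wpM2l.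
move=> k k0.
have n0 : 0 < (size s)%:R + 1 :> R by rewrite ltr_wpDl.
have [d d0 Hd] := partials_close s x df cdf (divr_gt0 k0 n0).
exists d => // v vd; have := Hd x (fun i => c i v).
rewrite subrr normr0 c_basis => /(_ d0) H.
apply: (le_trans (H _)); first by move=> i; exact: le_lt_trans (c_bnd i v) vd.
rewrite -mulrA ler_wpM2l// ?(ltW k0)// ler_pdivrMl//.
rewrite (@le_trans _ _ (\sum_(i <- s) `|v|))//; first exact: ler_sum.
rewrite big_const_seq count_predT iter_addr_0.
by rewrite mulrDl mul1r -[_ *+ _]mulr_natl lerDl.
Qed.

(** The tangent map is a finite sum of a coordinate of the direction times a partial derivative, and
    the partial derivatives satisfy the same hypothesis one order lower. *)
Lemma Cb_Cn n f : Cb E n f -> Cn n f.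
Proof.
elim: n f => [|n IH] f; first by case.
move=> [cf _ H].
have df i y : derivable f y (e i) by have [] := H _ (eE i).
have CD i : Cn n ('D_(e i) f) by apply: IH; have [] := H _ (eE i).
have cD i : continuous ('D_(e i) f) by exact: Cn_continuous (CD i).
rewrite CnP; split=> [x|]; first by have [] := partials_diff x df cD.
have -> : (fun p : V * V => 'd f (p.1) p.2) =
    fun p => \sum_(i <- s) c i p.2 * 'D_(e i) f p.1.
  by apply/funext => p; have [_ ->] := partials_diff p.1 df cD.
apply: Cn_sum => i _; apply: CnM; last exact: (Cn_comp (Cn_fst _ _ _) (CD i)).
apply: (Cn_comp (Cn_snd _ _ _)); apply: Cn_linear; first exact: c_lin.
by apply: (bounded_linear_continuous (C := 1)) => // v; rewrite mul1r.
Qed.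

Lemma Cb_bounded (n : nat) f : Cb E n f -> exists2 M : R, 0 <= M & forall x, `|f x| <= M.
Proof.
move=> Cf; have bf : bounded_fun f by case: n Cf => [|n] [].
have [M [Mr HM]] := bf; exists (`|M| + 1); first by rewrite addr_ge0.
move=> x; apply: (HM (`|M| + 1)) => //.
by rewrite (le_lt_trans (ler_norm _))// ltrDl.
Qed.

(** The boundedness of the partial derivatives gives a bound on the whole space, hence the global
    Lipschitz constant of [b], where [Cn] gives bounds on balls only. *)
Lemma Cb_diff_bounded n f : Cb E n.+1 f ->
  exists2 M : R, 0 <= M & forall x v, `|'d f x v| <= M * `|v|.
Proof.
move=> [cf _ H].
have df i y : derivable f y (e i) by have [] := H _ (eE i).
have CD i : Cn n ('D_(e i) f) by apply: Cb_Cn; have [] := H _ (eE i).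
have cD i : continuous ('D_(e i) f) by exact: Cn_continuous (CD i).
have bD i : exists M : R, 0 <= M /\ forall x, `|'D_(e i) f x| <= M.
  by have [_ /Cb_bounded[M M0 HM]] := H _ (eE i); exists M.
have [M HM] := choice bD.
exists (\sum_(i <- s) M i); first by apply: sumr_ge0 => i _; case: (HM i).
move=> x v; have [_ ->] := partials_diff x df cD.
rewrite (le_trans (ler_norm_sum _ _ _))// mulr_suml ler_sum// => i _.
by rewrite normrM mulrC ler_pM//; case: (HM i).
Qed.

End continuous_partials.

(** * Coordinate directions of time, phase and space *)

Section axes.
Context {R : realType} {d : nat}.

Let s2 : seq (option 'I_d) := None :: map Some (enum 'I_d).
Let e2 (i : option 'I_d) : R * 'cV[R]_d :=
  if i is Some j then (0, delta_mx j 0) else (1, 0).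
Let c2 (i : option 'I_d) (v : R * 'cV[R]_d) : R := if i is Some j then v.2 j 0 else v.1.

Let s3 : seq (option (option 'I_d)) := None :: Some None :: map (Some \o Some) (enum 'I_d).
Let e3 (i : option (option 'I_d)) : R * R * 'cV[R]_d :=
  match i with None => (1, 0, 0) | Some None => (0, 1, 0)
             | Some (Some j) => (0, 0, delta_mx j 0) end.
Let c3 (i : option (option 'I_d)) (v : R * R * 'cV[R]_d) : R :=
  match i with None => v.1.1 | Some None => v.1.2 | Some (Some j) => v.2 j 0 end.

Let cV_basis (v : 'cV[R]_d) : \sum_(j <- enum 'I_d) v j 0 *: delta_mx j 0 = v.
Proof.
rewrite big_enum /= [RHS]matrix_sum_delta; apply: eq_bigr => i _.
by rewrite big_ord1.
Qed.

Let e2E i : e2 i \in axes_x R d.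
Proof.
case: i => [j|]; rewrite inE ?eqxx//; apply/orP; right.
by apply/mapP; exists j => //; rewrite mem_enum.
Qed.

Let e3E i : e3 i \in axes_tx R d.
Proof.
case: i => [[j|]|]; rewrite !inE ?eqxx ?orbT//; apply/orP; right; apply/orP; right.
by apply/mapP; exists j => //; rewrite mem_enum.
Qed.

Let c2_lin i : linear (c2 i).
Proof. by case: i => [j|] a u v //=; rewrite !mxE. Qed.

Let c3_lin i : linear (c3 i).
Proof. by case: i => [[j|]|] a u v //=; rewrite !mxE. Qed.

Let c2_bnd i v : `|c2 i v| <= `|v|.
Proof.
case: v => t x; have /andP[h1 h2] : (`|t| <= `|(t, x)|) && (`|x| <= `|(t, x)|).
  by rewrite -prod_norm_le.
by case: i => [j|] //=; exact: le_trans (mx_entry_le _ _ _) h2.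
Qed.

Let c3_bnd i v : `|c3 i v| <= `|v|.
Proof.
case: v => [[t th] x].
have /andP[/andP[h1 h3] h2] : (`|t| <= `|(t, th, x)|) && (`|th| <= `|(t, th, x)|)
     && (`|x| <= `|(t, th, x)|).
  by rewrite -!prod_norm_le.
by case: i => [[j|]|] //=; exact: le_trans (mx_entry_le _ _ _) h2.
Qed.

Let sum_pair0 (U : normedModType R) (x : 'cV[R]_d) (l : seq 'I_d) :
  \sum_(j <- l) x j 0 *: ((0, delta_mx j 0) : U * 'cV[R]_d) =
  (0, \sum_(j <- l) x j 0 *: delta_mx j 0).
Proof.
elim: l => [|j l IH]; first by rewrite !big_nil.
by rewrite !big_cons IH; congr pair; rewrite /= scaler0 addr0.
Qed.

Let c2_basis v : \sum_(i <- s2) c2 i v *: e2 i = v.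
Proof.
case: v => t x; rewrite big_cons big_map /= (sum_pair0 R) cV_basis.
by congr pair; rewrite /= ?scaler0 ?add0r ?addr0// -[t *: _]/(t * 1) mulr1.
Qed.

Let c3_basis v : \sum_(i <- s3) c3 i v *: e3 i = v.
Proof.
case: v => [[t th] x]; rewrite !big_cons big_map /= (sum_pair0 (R * R)%type) cV_basis.
by congr (_, _, _); rewrite /= ?scaler0 ?add0r ?addr0// -[_ *: _]/(_ * 1) mulr1.
Qed.

Lemma Cb_axes_x_Cn n (f : R * 'cV[R]_d -> R) : Cb (axes_x R d) n f -> Cn n f.
Proof. exact: Cb_Cn e2E c2_lin c2_bnd c2_basis n f. Qed.

Lemma Cb_axes_tx_Cn n (f : R * R * 'cV[R]_d -> R) : Cb (axes_tx R d) n f -> Cn n f.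
Proof. exact: Cb_Cn e3E c3_lin c3_bnd c3_basis n f. Qed.

Lemma Cb_axes_x_diff_bounded n (f : R * 'cV[R]_d -> R) : Cb (axes_x R d) n.+1 f ->
  exists2 M : R, 0 <= M & forall x v, `|'d f x v| <= M * `|v|.
Proof. exact: Cb_diff_bounded e2E c2_lin c2_bnd c2_basis n f. Qed.

End axes.

(** * Integrals depending on a parameter *)

Lemma is_derive_mx {R : realType} {V : normedModType R} m n (f : V -> 'M[R]_(m, n)) t v (l : 'M[R]_(m, n)) :
  (forall i j, is_derive t v (fun s => f s i j) (l i j)) -> is_derive t v f l.
Proof.
move=> H; have df : derivable f t v by apply/derivable_mxP => i j; case: (H i j).
split=> //; rewrite derive_mx//; apply/matrixP => i j; rewrite mxE.
by case: (H i j).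
Qed.

Lemma is_derive_entry {R : realType} {V : normedModType R} m n (f : V -> 'M[R]_(m, n)) t v (l : 'M[R]_(m, n)) i j :
  is_derive t v f l -> is_derive t v (fun s => f s i j) (l i j).
Proof.
move=> [df <-]; have dfij := (derivable_mxP f t v).1 df i j.
by split=> //; rewrite derive_mx// mxE.
Qed.

Section parametric_integral.
Context {R : realType}.

Definition iint (f : R -> R) (v : R) : R :=
  if 0 <= v then \int[lebesgue_measure]_(x in `[0, v]) f x
  else - \int[lebesgue_measure]_(x in `[v, 0]) f x.

Lemma iint0 f : iint f 0 = 0.
Proof. by rewrite /iint lexx set_itv1 Rintegral_set1. Qed.

(** The fundamental theorem of calculus concerns an integral with a fixed lower end point. With [c]
    below both [0] and [t], [iint f] is near [t] the primitive from [c] minus a constant, whatever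
    the sign of the argument. *)
Lemma iint_derive f t : continuous f -> is_derive t (1 : R) (iint f) (f t).
Proof.
move=> cf; pose c := Num.min 0 t - 1.
have [c0 ct] : c < 0 /\ c < t.
  have : Num.min 0 t <= 0 by rewrite ge_min lexx.
  have : Num.min 0 t <= t by rewrite ge_min lexx orbT.
  by rewrite /c; split; lra.
have int_f (a b : R) : lebesgue_measure.-integrable `[a, b] (EFin \o f).
  apply: continuous_compact_integrable; first exact: segment_compact.
  exact: continuous_subspaceT.
pose F x := \int[lebesgue_measure]_(y in `[c, x]) f y.
have FB x y : c <= x -> x <= y -> F y - F x = \int[lebesgue_measure]_(z in `[x, y]) f z.
  move=> cx xy; rewrite /F Rintegral_itvB//.
  rewrite Rintegral_itv_obnd_cbnd//.
  apply: integrableS (int_f x y) => //.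
  by apply: subset_itvr; rewrite bnd_simp.
have iintE x : c <= x -> iint f x = F x - F 0.
  move=> cx; rewrite /iint; have [x0|x0] := leP 0 x; first by rewrite FB// ltW.
  by rewrite -FB ?(ltW x0)// opprB.
have tt : t < t + 1 by rewrite ltrDl.
have [dF F'] := continuous_FTC1_closed tt (int_f c (t + 1)) ct (cf t).
have /is_derive_edP H : is_derive t (1 : R) F (f t).
  by split; [exact: dF|rewrite -derive1E; exact: F'].
apply/is_derive_edP => e /H[k k0 Hk]; exists (Num.min k (t - c)).
  by rewrite lt_min k0 subr_gt0.
move=> s; rewrite lt_min => /andP[sk stc].
have -> : s *: 1 = s by exact: mulr1.
have tsc : c <= t + s by move: stc; rewrite ltr_norml => /andP[]; lra.
rewrite !iintE// ?(ltW ct)//; have := Hk s sk.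
by have -> : s *: 1 = s by [exact: mulr1]; congr (`|_| <= _); ring.
Qed.

(** Instead of differentiating under the integral sign, the primitive is read off a flow. [Phi]
    keeps the parameter at rest, moves the second component at unit speed and the third at speed
    [f]; started from [((p.1, 0), 0)], its last component at time [p.2] is the integral. *)
Lemma iint_smooth n (V : normedModType R) (f : V * R -> R) : proper V -> Cn n.+1 f ->
  Cn n.+1 (fun p : V * R => iint (fun s => f (p.1, s)) p.2).
Proof.
move=> pV Cf; pose J p := iint (fun s => f (p, s)).
have cf p : continuous (fun s => f (p, s)).
  apply: (@Cn_continuous R n.+1); apply: (Cn_comp (Cn_pair (Cn_cst _ _ p) (Cn_id _ R)) Cf).
have dJ p t : is_derive t (1 : R) (J p) (f (p, t)) by exact: iint_derive.
pose S := ((V * R) * R)%type.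
pose G (w : S) : S := ((0, 1), f w.1).
pose Phi (t : R) (w : S) : S :=
  ((w.1.1, w.1.2 + t), w.2 + J w.1.1 (w.1.2 + t) - J w.1.1 w.1.2).
have pVR : proper (V * R)%type by apply: proper_prod => //; exact: proper_real.
have CPhi : Cn n.+1 (fun p : R * S => Phi p.1 p.2).
  apply: (flow_smooth (G := G)).
  - by apply: proper_prod => //; exact: proper_real.
  - apply: (@Cn_pair _ _ _ (V * R)%type R); first exact: Cn_cst.
    exact: (Cn_comp (Cn_fst _ _ _) Cf).
  - move=> t [[p x] u].
    have H1 : is_derive t (1 : R) (fun s => x + s) 1.
      apply/is_derive_edP => e e0; exists 1 => // s _.
      rewrite -[s *: 1]/(s * 1) mulr1 (_ : _ - s = 0); last by ring.
      by rewrite normr0 mulr_ge0// ltW.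
    have H2 : is_derive t (1 : R) (fun s => J p (x + s)) (f (p, x + t)).
      have /is_derive_edP H := dJ p (x + t).
      by apply/is_derive_edP => e /H[k k0 Hk]; exists k => // s /Hk; rewrite addrA.
    have H3 : is_derive t (1 : R) (fun s => u + J p (x + s) - J p x) (f (p, x + t)).
      have /is_derive_edP H := H2; apply/is_derive_edP => e /H[k k0 Hk].
      by exists k => // s /Hk; congr (`|_| <= _); vring R R.
    apply: (@is_derive_pair _ (V * R)%type R (fun s => (p, x + s))) => //.
    exact: (@is_derive_pair _ V R (fun=> p)).
  - by move=> [[p x] u]; rewrite /Phi /= addr0 addrK.
  - move=> r; have [M M0 HM] := proper_bounded pVR (2 * `|r|) (Cn_continuous Cf).
    have JM p t : `|p| <= `|r| -> `|t| <= 2 * `|r| -> `|J p t| <= M * (2 * `|r|).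
      move=> pr tr; have := @mean_value_le _ _ (J p) _ 0 M 0 t M0 (fun x _ => dJ p x).
      rewrite scaler0 !subr0 [J p 0]iint0 subr0 => H.
      apply: (@le_trans _ _ (M * `|t|)); last by rewrite ler_wpM2l.
      apply: H => y /dist_between; rewrite !subr0 => yt.
      by apply: HM; rewrite prod_norm_le; apply/andP; split; have := normr_ge0 r; lra.
    exists (2 * `|r| + M * (2 * `|r|) + M * (2 * `|r|)) => t [[p x] u] tr.
    rewrite !prod_norm_le => /andP[/andP[pr xr] ur] /=.
    have rr := ler_norm r; have r0 := normr_ge0 r.
    have MR : 0 <= M * (2 * `|r|) by rewrite !mulr_ge0.
    have xt : `|x + t| <= 2 * `|r| by rewrite (le_trans (ler_normD _ _))//; lra.
    have J1 : `|J p (x + t)| <= M * (2 * `|r|) by apply: JM => //; lra.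
    have J2 : `|J p x| <= M * (2 * `|r|) by apply: JM; lra.
    apply/andP; split; first by apply/andP; split; lra.
    rewrite (le_trans (ler_normB _ _))// lerD// (le_trans (ler_normD _ _))// lerD//.
    lra.
have -> : (fun p : V * R => iint (fun s => f (p.1, s)) p.2) =
    fun p => (Phi p.2 ((p.1, 0), 0)).2.
  by apply/funext => p; rewrite /Phi /= !add0r [J p.1 0]iint0 subr0.
apply: (Cn_comp _ (Cn_snd _ _ _)).
apply: (@Cn_comp _ _ _ _ _ (fun p : V * R => (p.2, ((p.1, 0), 0) : S)) _ _ CPhi).
apply: (@Cn_pair _ _ _ R S); first exact: Cn_snd.
apply: (@Cn_pair _ _ _ (V * R)%type R); last exact: Cn_cst.
by apply: (@Cn_pair _ _ _ V R); [exact: Cn_fst|exact: Cn_cst].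
Qed.

Lemma vint_entry d (f : R -> 'cV[R]_d) v i : vint f 0 v i 0 = iint (fun s => f s i 0) v.
Proof. by rewrite mxE. Qed.

Lemma vint_derive d (f : R -> 'cV[R]_d) t : continuous f ->
  is_derive t (1 : R) (vint f 0) (f t).
Proof.
move=> cf; apply: is_derive_mx => i j; rewrite (ord1 j).
under eq_fun do rewrite vint_entry.
apply: iint_derive => s.
apply: (@continuous_comp _ _ _ f (fun M : 'cV_d => M i 0)); first exact: cf.
exact: coord_continuous.
Qed.

Lemma vint0 d (f : R -> 'cV[R]_d) : vint f 0 0 = 0.
Proof. by apply/matrixP => i j; rewrite (ord1 j) vint_entry iint0 mxE. Qed.

Lemma vint_smooth n d (V : normedModType R) (f : V * R -> 'cV[R]_d) :
  proper V -> Cn n.+1 f ->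
  Cn n.+1 (fun p : V * R => vint (fun s => f (p.1, s)) 0 p.2).
Proof.
move=> pV Cf; apply: Cn_mx => i j; rewrite (ord1 j).
under eq_fun do rewrite vint_entry.
apply: (iint_smooth (f := fun q => f q i 0)) => //; exact: Cn_entry.
Qed.

End parametric_integral.

(** * Taylor expansion of a composition *)

Lemma is_derive_slice {R : realType} {U V W : normedModType R} (g : U * V -> W) u y v l :
  is_derive (u, y) (0, v) g l -> is_derive y v (fun z => g (u, z)) l.
Proof.
move=> /is_derive_edP H; apply/is_derive_edP => e /H[k k0 Hk].
exists k => // s /Hk.
have -> // : (u, y) + s *: (0, v) = (u, y + s *: v).
by congr pair; rewrite /= scaler0 addr0.
Qed.

Lemma is_derive_slicel {R : realType} {U V W : normedModType R} (g : U * V -> W) u y v l :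
  is_derive (u, y) (v, 0) g l -> is_derive u v (fun z => g (z, y)) l.
Proof.
move=> /is_derive_edP H; apply/is_derive_edP => e /H[k k0 Hk].
exists k => // s /Hk.
have -> // : (u, y) + s *: (v, 0) = (u + s *: v, y).
by congr pair; rewrite /= scaler0 addr0.
Qed.

Section tuple_sums.
Context {V : nmodType}.

Lemma sum_tuple_ffun (T : finType) p (G : p.-tuple T -> V) :
  \sum_l G l = \sum_(f : {ffun 'I_p -> T}) G (mktuple f).
Proof.
rewrite (reindex (fun f : {ffun 'I_p -> T} => mktuple f))//.
exists (fun l => [ffun q => tnth l q]) => [f _|l _].
  by apply/ffunP => q; rewrite ffunE tnth_mktuple.
by apply: eq_from_tnth => q; rewrite tnth_mktuple ffunE.
Qed.

Lemma sum_tuple_cons (T : finType) p (G : p.+1.-tuple T -> V) :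
  \sum_l G l = \sum_i \sum_(l : p.-tuple T) G [tuple of i :: l].
Proof.
rewrite pair_big /= (reindex (fun x : T * p.-tuple T => [tuple of x.1 :: x.2]))//=.
exists (fun l => (thead l, [tuple of behead l])) => [[i l] _|l _] /=.
  by rewrite theadE; congr pair; apply: val_inj.
by rewrite -tuple_eta.
Qed.

Lemma sum_tuple0 (T : finType) (G : 0.-tuple T -> V) : \sum_l G l = G [tuple].
Proof.
rewrite (bigD1 [tuple])//= big1 ?addr0// => l.
by case/negP; apply/eqP; exact: tuple0.
Qed.

(** A tuple of sum [k] has entries at most [k], so enlarging the index type adds no tuple. This puts
    the sums defining [compsum], for all [k], over a common type. *)
Lemma sum_tuple_widen p k N (G : ('I_p -> nat) -> V) : (k <= N)%N ->
  \sum_(t : p.-tuple 'I_k.+1 |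
      [forall q, (0 < tnth t q)%N] && (\sum_(q < p) tnth t q == k)%N) G (fun q => tnth t q) =
  \sum_(t : p.-tuple 'I_N.+1 |
      [forall q, (0 < tnth t q)%N] && (\sum_(q < p) tnth t q == k)%N) G (fun q => tnth t q).
Proof.
move=> kN; pose w (t : p.-tuple 'I_k.+1) : p.-tuple 'I_N.+1 :=
  mktuple (fun q => inord (tnth t q)).
pose w' (t : p.-tuple 'I_N.+1) : p.-tuple 'I_k.+1 := mktuple (fun q => inord (tnth t q)).
have wE t q : tnth (w t) q = tnth t q :> nat.
  by rewrite tnth_mktuple inordK// (leq_trans (ltn_ord _)).
rewrite [RHS](reindex_onto w w'); last first.
  move=> t /andP[_ /eqP tk]; apply: eq_from_tnth => q; apply: val_inj.
  change (nat_of_ord (tnth (w (w' t)) q) = tnth t q).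
  rewrite wE tnth_mktuple inordK// ltnS -tk (bigD1 q)//=.
  exact: leq_addr.
apply: eq_big => [t|t _]; last by congr G; apply/funext => q; rewrite wE.
have -> : w' (w t) = t.
  apply: eq_from_tnth => q; apply: val_inj.
  by rewrite tnth_mktuple wE inord_val.
rewrite eqxx andbT; congr andb.
  by apply: eq_forallb => q; rewrite wE.
by congr eq_op; apply: eq_bigr => q _; rewrite wE.
Qed.

End tuple_sums.

Section taylor.
Context {R : realType} {d : nat}.
Implicit Types (f : 'cV[R]_d -> R) (y : 'cV[R]_d).

Definition dsum p f y (h : 'I_p -> 'cV[R]_d) : R :=
  \sum_(l : p.-tuple 'I_d) partials l f y * \prod_(q < p) h q (tnth l q) 0.

Lemma nabla_entry p (F : 'cV[R]_d -> 'cV[R]_d) y (h : 'I_p -> 'cV[R]_d) i :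
  nabla F y h i 0 = dsum (fun z => F z i 0) y h.
Proof. by rewrite mxE. Qed.

Lemma diff_coords f y v : differentiable f y ->
  'd f y v = \sum_i v i 0 * 'D_(delta_mx i 0) f y.
Proof.
move=> df; rewrite {1}(matrix_sum_delta v) linear_sum; apply: eq_bigr => i _.
by rewrite big_ord1 linearZ /= deriveE.
Qed.

Lemma partials_smooth n (U : normedModType R) (F : U * 'cV[R]_d -> R) (l : seq 'I_d) :
  Cn (n + size l) F -> Cn n (fun p => partials l (fun z => F (p.1, z)) p.2).
Proof.
elim: l n F => [|i l IH] n F; first by rewrite addn0; congr Cn; apply/funext; case.
rewrite /= addnS -addSn => /IH Cg.
set g := fun p => _ in Cg.
have -> : (fun p => 'D_(delta_mx i 0) (partials l (fun z => F (p.1, z))) p.2) =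
    fun p => 'd g p (0, delta_mx i 0).
  apply/funext => -[u y] /=.
  have := diff_is_derive (0, delta_mx i 0) (Cn_diff (u, y) Cg).
  by move=> /is_derive_slice[].
exact: Cn_diff_along Cg (Cn_id _ _) (Cn_cst _ _ _).
Qed.

Lemma partials_smooth1 n f (l : seq 'I_d) : Cn (n + size l) f -> Cn n (partials l f).
Proof.
move=> Cf; have := @partials_smooth n R (fun p => f p.2) l (Cn_comp (Cn_snd _ _ _) Cf).
move=> /(Cn_comp (Cn_pair (Cn_cst _ _ (0 : R)) (Cn_id _ _))) /=.
by congr Cn; apply/funext.
Qed.

(** Differentiation in direction [v] puts a new index at the head of the tuple, the one that
    [partials] applies last. *)
Lemma dsum_derive p f y v (t : R) : Cn p.+1 f ->
  is_derive t (1 : R) (fun t => dsum f (y + t *: v) (fun _ : 'I_p => v))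
    (dsum f (y + t *: v) (fun _ : 'I_p.+1 => v)).
Proof.
move=> Cf; set x := y + t *: v.
have dl (l : p.-tuple 'I_d) : differentiable (partials l f) x.
  by apply: (@Cn_diff _ 0); apply: partials_smooth1; rewrite size_tuple.
have -> : dsum f x (fun _ : 'I_p.+1 => v) =
    \sum_(l : p.-tuple 'I_d) 'd (partials l f) x v * \prod_(q < p) v (tnth l q) 0.
  rewrite /dsum sum_tuple_cons exchange_big; apply: eq_bigr => l _.
  rewrite diff_coords// mulr_suml; apply: eq_bigr => i _.
  rewrite big_ord_recl tnth0 mulrA [v i 0 * _]mulrC; congr (_ * _).
  by apply: eq_bigr => q _; rewrite tnthS.
pose h (l : p.-tuple 'I_d) (t : R) := partials l f (y + t *: v) * \prod_(q < p) v (tnth l q) 0.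
suff H (r : seq (p.-tuple 'I_d)) : is_derive t (1 : R) (fun t => \sum_(l <- r) h l t)
   (\sum_(l <- r) 'd (partials l f) x v * \prod_(q < p) v (tnth l q) 0) by exact: H.
elim: r => [|l r IH].
  by under eq_fun do rewrite big_nil; rewrite big_nil; exact: is_derive_cst.
under eq_fun do rewrite big_cons; rewrite big_cons.
apply: is_deriveD; rewrite mulrC.
have -> : h l = fun t => \prod_(q < p) v (tnth l q) 0 * partials l f (y + t *: v).
  by apply/funext => u; rewrite /h mulrC.
apply: is_deriveZ; rewrite -deriveE//; apply: is_derive_line.
exact: diff_derivable.
Qed.

(** [g k] stands for the [k]-th derivative of [g 0]. The remainder is bounded by [M] without a
    factorial: on [[0, 1]] this crude form reproduces itself by one application of the mean value
    inequality. *)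
Lemma taylor_le (n : nat) (g : nat -> R -> R) (M : R) : 0 <= M ->
  (forall k t, (k <= n)%N -> is_derive t (1 : R) (g k) (g k.+1 t)) ->
  (forall t, 0 <= t <= 1 -> `|g n.+1 t| <= M) ->
  `|g 0%N 1 - \sum_(k < n.+1) g k 0 / k`!%:R| <= M.
Proof.
move=> M0 dg gM.
suff H (t : R) : 0 <= t <= 1 ->
    `|g 0%N t - \sum_(k < n.+1) g k 0 * (k`!%:R^-1 * t ^+ k)| <= M.
  have := H 1; rewrite ler01 lexx => /(_ isT); congr (`|_ - _| <= _).
  by apply: eq_bigr => k _; rewrite expr1n mulr1.
elim: n g dg gM t => [|n IH] g dg gM t t01.
  rewrite big_ord1 fact0 invr1 expr0 !mulr1.
  have := @mean_value_le _ _ (g 0%N) (g 1%N) 0 M 0 t M0 (fun x _ => dg 0%N x isT).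
  rewrite scaler0 !subr0; case/andP: t01 => t0 t1 H.
  apply: (le_trans (H _)); last by rewrite ger0_norm// ler_piMr.
  move=> x; rewrite min_l// max_r// => /andP[x0 xt]; rewrite subr0 gM//.
  by rewrite x0 (le_trans xt).
pose P (m : nat) (u : R) := \sum_(k < n.+2) g k 0 * (k`!%:R^-1 * u ^+ k).
pose Q (u : R) := \sum_(k < n.+1) g k.+1 0 * (k`!%:R^-1 * u ^+ k).
have dP u : is_derive u (1 : R) (P 0%N) (Q u).
  have H (r : seq nat) : is_derive u (1 : R)
      (fun u => \sum_(k <- r) g k 0 * (k`!%:R^-1 * u ^+ k))
      (\sum_(k <- r) g k 0 * (k`!%:R^-1 * (u ^+ k.-1 *+ k))).
    elim: r => [|k r IHr].
      by under eq_fun do rewrite big_nil; rewrite big_nil; exact: is_derive_cst.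
    under eq_fun do rewrite big_cons; rewrite big_cons.
    apply: is_deriveD; apply: is_deriveZ; apply: is_deriveZ.
    split; first exact: exprn_derivable.
    by rewrite exp_derive -![_ *: _]/(_ * _) mulr1 mulr_natl.
  have := H (index_iota 0 n.+2); rewrite /P /Q.
  under eq_fun do rewrite big_mkord; rewrite big_mkord big_ord_recl /= mulr0n !mulr0 add0r.
  congr is_derive; apply: eq_bigr => k _ /=; congr (_ * _).
  rewrite /bump leq0n add1n add0n factS natrM -[_ *+ _]mulr_natr; field.
  by rewrite addrC natr1 !pnatr_eq0 -lt0n fact_gt0.
have := @mean_value_le _ _ (fun u => g 0%N u - P 0%N u) (fun u => g 1%N u - Q u) 0 M 0 t M0 _ _.
rewrite scaler0 !subr0; have -> : g 0%N 0 - P 0%N 0 = 0.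
  rewrite /P big_ord_recl fact0 invr1 expr0 !mulr1 big1 ?addr0 ?subrr// => k _.
  by rewrite expr0n /= !mulr0.
rewrite subr0; case/andP: t01 => t0 t1 H; apply: (le_trans (H _ _)).
- by move=> x _; have dgx := dg 0%N x isT; have dPx := dP x; apply: is_deriveB.
- move=> x; rewrite min_l// max_r// => /andP[x0 xt]; rewrite subr0.
  apply: (IH (fun k => g k.+1)) => //; last by rewrite x0 (le_trans xt).
  by move=> k u kn; apply: dg.
- by rewrite ger0_norm// ler_piMr.
Qed.

End taylor.

Section compsum_taylor.
Context {R : realType} {d : nat}.
Implicit Types (f : 'cV[R]_d -> R) (y : 'cV[R]_d).

Definition csum k f y (h : nat -> 'cV[R]_d) : R :=
  \sum_(1 <= p < k.+1) (p`!%:R)^-1 *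
    \sum_(t : p.-tuple 'I_k.+1 |
            [forall q, (0 < tnth t q)%N] && (\sum_(q < p) tnth t q == k)%N)
      dsum f y (fun q : 'I_p => h (tnth t q)).

Lemma compsum_entry k (F : 'cV[R]_d -> 'cV[R]_d) y h i :
  compsum k F y h i 0 = csum k (fun z => F z i 0) y h.
Proof.
rewrite summxE; apply: eq_bigr => p _; rewrite mxE summxE; congr (_ * _).
by apply: eq_bigr => t _; rewrite nabla_entry.
Qed.

Lemma dsum_smooth n p (U W : normedModType R) (F : U * 'cV[R]_d -> R)
    (u : W -> U) (y : W -> 'cV[R]_d) (h : 'I_p -> W -> 'cV[R]_d) :
  Cn (n + p) F -> Cn n u -> Cn n y -> (forall q, Cn n (h q)) ->
  Cn n (fun w => dsum (fun z => F (u w, z)) (y w) (fun q => h q w)).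
Proof.
move=> CF Cu Cy Ch; apply: Cn_sum => l _; apply: CnM.
  apply: (Cn_comp (g := fun p => partials l (fun z => F (p.1, z)) p.2) (Cn_pair Cu Cy)).
  by apply: partials_smooth; rewrite size_tuple.
by apply: Cn_prod => q; apply: Cn_entry.
Qed.

Lemma compsum_smooth n k (U W : normedModType R) (F : U * 'cV[R]_d -> 'cV[R]_d)
    (u : W -> U) (y : W -> 'cV[R]_d) (h : nat -> W -> 'cV[R]_d) :
  Cn (n + k) F -> Cn n u -> Cn n y -> (forall j, (0 < j <= k)%N -> Cn n (h j)) ->
  Cn n (fun w => compsum k (fun z => F (u w, z)) (y w) (fun j => h j w)).
Proof.
move=> CF Cu Cy Ch; apply: Cn_mx => i j; rewrite (ord1 j).
under eq_fun do rewrite compsum_entry.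
rewrite /csum; under eq_fun do rewrite big_nat.
apply: Cn_sum => p /andP[p0 pk]; apply: CnM; first exact: Cn_cst.
apply: Cn_sum => t /andP[/forallP t0 _].
apply: (dsum_smooth (F := fun p => F p i 0) (h := fun q => h (tnth t q))) => //.
  by apply: Cn_entry; apply: Cn_le CF; rewrite leq_add2l.
by move=> q; apply: Ch; rewrite t0 -ltnS ltn_ord.
Qed.

Lemma dsum_le p f y (h : 'I_p -> 'cV[R]_d) (M H : R) :
  (forall l : p.-tuple 'I_d, `|partials l f y| <= M) -> (forall q, `|h q| <= H) ->
  `|dsum f y h| <= \sum_(l : p.-tuple 'I_d) M * H ^+ p.
Proof.
move=> fM hH; rewrite (le_trans (ler_norm_sum _ _ _))// ler_sum// => l _.
rewrite normrM ler_pM// normr_prod.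
rewrite (@le_trans _ _ (\prod_(q < p) H))//; last by rewrite prodr_const card_ord.
apply: ler_prod => q _; rewrite normr_ge0 /=.
exact: le_trans (mx_entry_le _ _ _) (hH q).
Qed.

Lemma dsum0 f y h : dsum f y (h : 'I_0 -> _) = f y.
Proof. by rewrite /dsum sum_tuple0 big_ord0 mulr1. Qed.

(** Multilinearity: choosing an index in each of the [p] slots is choosing a tuple, and the
    exponents of [e] add up to its sum. *)
Lemma dsum_expand p f y N (e : R) (h : nat -> 'cV[R]_d) :
  dsum f y (fun _ : 'I_p => \sum_(j < N.+1 | (0 < j)%N) e ^+ j *: h j) =
  \sum_(t : p.-tuple 'I_N.+1 | [forall q, (0 < tnth t q)%N])
     e ^+ (\sum_(q < p) tnth t q) * dsum f y (fun q => h (tnth t q)).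
Proof.
rewrite /dsum; under [RHS]eq_bigr do rewrite mulr_sumr.
rewrite [RHS]exchange_big; apply: eq_bigr => l _ /=.
under eq_bigr do rewrite summxE.
rewrite bigA_distr_big /= mulr_sumr.
rewrite [RHS]big_mkcond sum_tuple_ffun [LHS]big_mkcond; apply: eq_bigr => g _.
have -> : (g \in ffun_on (fun j : 'I_N.+1 => (0 < j)%N)) =
    [forall q, (0 < tnth (mktuple g) q)%N].
  by apply/ffun_onP/forallP => H q; have := H q; rewrite tnth_mktuple.
case: ifP => // _; rewrite mulrCA; congr (_ * _).
rewrite expr_sum -big_split; apply: eq_bigr => q _ /=.
by rewrite mxE tnth_mktuple.
Qed.

(** Positive entries of sum [k] force [p <= k], so larger [p] contribute nothing and all orders
    [k < N] share the same ranges. *)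
Lemma csum_widen k N f y h : (k < N)%N -> csum k f y h =
  \sum_(1 <= p < N) (p`!%:R)^-1 *
    \sum_(t : p.-tuple 'I_N.+1 |
            [forall q, (0 < tnth t q)%N] && (\sum_(q < p) tnth t q == k)%N)
      dsum f y (fun q : 'I_p => h (tnth t q)).
Proof.
move=> kN; rewrite [RHS](big_cat_nat (n := k.+1))//=.
rewrite [X in _ + X]big_nat [X in _ + X]big1 ?addr0.
  apply: eq_bigr => p _; congr (_ * _).
  exact: (sum_tuple_widen (fun t => dsum f y (fun q => h (t q))) (ltnW kN)).
move=> p /andP[kp _]; rewrite big_pred0 ?mulr0// => t.
apply/negP => /andP[/forallP t0 /eqP tk].
have : (\sum_(q < p) 1 <= \sum_(q < p) tnth t q)%N by apply: leq_sum => q _; exact: t0.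
by rewrite sum1_card card_ord tk leqNgt kp.
Qed.

(** Taylor's formula along the segment from [h 0] to the full sum, each differential being expanded
    by multilinearity; collecting the tuples of sum [k] gives the coefficient [csum k] of [e ^+ k].
    The constant depends on [f] and [h] only through [M] and [H], which makes the expansion uniform
    in time and phase. *)
Lemma csum_taylor (n : nat) (M H : R) : 0 <= M -> 0 <= H ->
  exists2 C : R, 0 <= C & forall f (h : nat -> 'cV[R]_d) (e : R), 0 <= e <= 1 ->
  Cn n.+1 f -> (forall j, (j <= n.+1)%N -> `|h j| <= H) ->
  (forall l z, (size l <= n.+1)%N -> `|z| <= n.+2%:R * H -> `|partials l f z| <= M) ->
  `|f (\sum_(j < n.+2) e ^+ j *: h j) -
    \sum_(k < n.+1) e ^+ k * (if k == 0 :> nat then f (h 0%N) else csum k f (h 0%N) h)|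
    <= C * e ^+ n.+1.
Proof.
move=> M0 H0.
(* [C1] bounds the Taylor remainder, and [C2] the terms of degree above [n] that the multilinear
   expansion produces. *)
pose C1 : R := \sum_(l : n.+1.-tuple 'I_d) M * (n.+1%:R * H) ^+ n.+1.
pose C2 : R := \sum_(1 <= p < n.+1) \sum_(t : p.-tuple 'I_n.+2)
  \sum_(l : p.-tuple 'I_d) M * H ^+ p.
exists (C1 + C2).
  apply: addr_ge0; first by apply: sumr_ge0 => l _; rewrite mulr_ge0// exprn_ge0// mulr_ge0.
  apply: sumr_ge0 => p _; apply: sumr_ge0 => t _; apply: sumr_ge0 => l _.
  by rewrite mulr_ge0// exprn_ge0.
move=> f h e /andP[e0 e1] Cf hH fM.
set y := h 0%N; pose v := \sum_(j < n.+2 | (0 < j)%N) e ^+ j *: h j.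
have vle : `|v| <= e * (n.+1%:R * H).
  have -> : v = \sum_(j < n.+1) e ^+ j.+1 *: h j.+1.
    by rewrite /v big_mkcond big_ord_recl /= add0r; apply: eq_bigr.
  rewrite (le_trans (ler_norm_sum _ _ _))//.
  rewrite (@le_trans _ _ (\sum_(j < n.+1) e * H))//; last first.
    by rewrite sumr_const card_ord -[_ * _ *+ _]mulr_natl mulrCA.
  apply: ler_sum => j _; rewrite normrZ normrX ger0_norm// ler_pM ?exprn_ge0//.
    by rewrite exprS ler_piMr// exprn_ile1.
  exact: hH.
have vle' : `|v| <= n.+1%:R * H by rewrite (le_trans vle)// ler_piMl// mulr_ge0.
have yle : `|y| <= H by exact: hH.
have seg (t : R) : 0 <= t <= 1 -> `|y + t *: v| <= n.+2%:R * H.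
  move=> /andP[t0 t1]; rewrite (le_trans (ler_normD _ _))// normrZ ger0_norm//.
  have : t * `|v| <= 1 * (n.+1%:R * H) by rewrite ler_pM.
  by rewrite -(natr1 n.+1); lra.
pose g p (t : R) := dsum f (y + t *: v) (fun _ : 'I_p => v).
pose A p (t : p.-tuple 'I_n.+2) := dsum f y (fun q => h (tnth t q)).
have gM t : 0 <= t <= 1 -> `|g n.+1 t| <= C1 * e ^+ n.+1.
  move=> t01; rewrite /C1 mulr_suml.
  apply: (le_trans (dsum_le (M := M) (H := e * (n.+1%:R * H)) _ _)) => //.
    by move=> l; apply: fM; rewrite ?size_tuple//; exact: seg.
  by apply: ler_sum => l _; rewrite -mulrA -exprMn [_ * e]mulrC.
have dg k t : (k <= n)%N -> is_derive t (1 : R) (g k) (g k.+1 t).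
  by move=> kn; apply: dsum_derive; apply: Cn_le Cf.
have Ce0 : 0 <= C1 * e ^+ n.+1 by apply: le_trans (gM 0 _); rewrite // lexx ler01.
have := taylor_le Ce0 dg gM.
have -> : g 0%N 1 = f (\sum_(j < n.+2) e ^+ j *: h j).
  rewrite /g dsum0 scale1r; congr f; rewrite [RHS](bigD1 ord0)//= expr0 scale1r.
  by congr (_ + _); apply: eq_bigl => j; rewrite lt0n.
move=> T; rewrite -(subrKA (\sum_(k < n.+1) g k 0 / k`!%:R)).
rewrite (le_trans (ler_normD _ _))// mulrDl lerD//.
have gE p : g p 0 = \sum_(t : p.-tuple 'I_n.+2 | [forall q, (0 < tnth t q)%N])
    e ^+ (\sum_(q < p) tnth t q) * A p t.
  by rewrite /g scale0r addr0 /v dsum_expand.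
(* Tuples of sum above [n] are kept with the value 0, so that the difference with the Taylor
   polynomial is taken tuple by tuple. *)
have csE : \sum_(k < n.+1) e ^+ k * (if k == 0 :> nat then f y else csum k f y h) =
    f y + \sum_(1 <= p < n.+1) p`!%:R^-1 *
      \sum_(t : p.-tuple 'I_n.+2 | [forall q, (0 < tnth t q)%N])
        (if (\sum_(q < p) tnth t q < n.+1)%N then e ^+ (\sum_(q < p) tnth t q) * A p t else 0).
  rewrite big_ord_recl /= expr0 mul1r; congr (_ + _).
  transitivity (\sum_(k < n.+1) \sum_(1 <= p < n.+1) e ^+ k * ((p`!%:R)^-1 *
    \sum_(t : p.-tuple 'I_n.+2 |
            [forall q, (0 < tnth t q)%N] && (\sum_(q < p) tnth t q == k)%N) A p t)).
    rewrite [RHS]big_ord_recl /=.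
    rewrite [X in _ = X + _]big_nat [X in _ = X + _]big1 ?add0r => [|p /andP[p0 _]].
      apply: eq_bigr => k _; rewrite -mulr_sumr; congr (_ * _).
      by rewrite (csum_widen (N := n.+1))// /bump leq0n add1n ltnS.
    rewrite big_pred0 ?mulr0// => t; apply/negP => /andP[/forallP t0 /eqP tk].
    by have := t0 (Ordinal p0); move: tk; rewrite (bigD1 (Ordinal p0))//= ; case: (tnth t _) => -[].
  rewrite exchange_big; apply: eq_bigr => p _ /=.
  under eq_bigr do rewrite mulrCA mulr_sumr; rewrite -mulr_sumr; congr (_ * _).
  rewrite (eq_bigr (fun k : 'I_n.+1 => \sum_(t : p.-tuple 'I_n.+2 | [forall q, (0 < tnth t q)%N])
      (if (\sum_(q < p) tnth t q == k)%N then e ^+ k * A p t else 0))) => [|k _]; last first.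
    by rewrite -big_mkcondr.
  rewrite exchange_big; apply: eq_bigr => t _ /=.
  set S := (\sum_(q < p) tnth t q)%N; rewrite -big_mkcond /=.
  case: ifP => [Sn|/negbT Sn]; first by rewrite (big_pred1 (Ordinal Sn)).
  by rewrite big_pred0// => k; apply/negP => /eqP Sk; rewrite Sk ltn_ord in Sn.
rewrite csE big_ord_recl /= {1}/g dsum0 scale0r addr0 fact0 divr1.
rewrite opprD addrACA subrr add0r.
have -> : \sum_(k < n) g (bump 0 k) 0 / (bump 0 k)`!%:R =
    \sum_(1 <= p < n.+1) p`!%:R^-1 * g p 0.
  by rewrite big_add1 big_mkord; apply: eq_bigr => k _; rewrite mulrC.
rewrite -sumrB (le_trans (ler_norm_sum _ _ _))// /C2 mulr_suml.
rewrite !big_nat; apply: ler_sum => p /andP[p0 pn].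
rewrite -mulrBr normrM (@ger0_norm _ _^-1) ?invr_ge0//.
apply: (@le_trans _ _ (1 * `|g p 0 - \sum_(t : p.-tuple 'I_n.+2 | [forall q, (0 < tnth t q)%N])
        (if (\sum_(q < p) tnth t q < n.+1)%N then e ^+ (\sum_(q < p) tnth t q) * A p t else 0)|)).
  rewrite ler_wpM2r// invf_le1 ?ltr0n ?fact_gt0//.
  by rewrite ler1n fact_gt0.
rewrite mul1r gE -sumrB (le_trans (ler_norm_sum _ _ _))// mulr_suml big_mkcond /=.
apply: ler_sum => t _.
have Ap : `|A p t| <= \sum_(l : p.-tuple 'I_d) M * H ^+ p.
  apply: dsum_le => [l|q]; last by apply: hH; rewrite -ltnS.
  apply: fM; first by rewrite size_tuple (leq_trans (ltnW pn)).
  by rewrite (le_trans yle)// ler_peMl// ler1n.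
have R0 : 0 <= (\sum_(l : p.-tuple 'I_d) M * H ^+ p) * e ^+ n.+1.
  by rewrite mulr_ge0 ?exprn_ge0// (le_trans _ Ap).
case: ifP => // _; case: ifP => [_|/negbT]; first by rewrite subrr normr0.
rewrite -leqNgt => Sn; rewrite subr0 normrM mulrC ler_pM//.
by rewrite normrX ger0_norm// ler_wiXn2l.
Qed.

Lemma compsum_taylor (n : nat) (M H : R) : 0 <= M -> 0 <= H ->
  exists2 C : R, 0 <= C & forall (F : 'cV[R]_d -> 'cV[R]_d) (h : nat -> 'cV[R]_d) (e : R),
  0 <= e <= 1 -> Cn n.+1 F -> (forall j, (j <= n.+1)%N -> `|h j| <= H) ->
  (forall i l z, (size l <= n.+1)%N -> `|z| <= n.+2%:R * H ->
     `|partials l (fun y => F y i 0) z| <= M) ->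
  `|F (\sum_(j < n.+2) e ^+ j *: h j) -
    \sum_(k < n.+1) e ^+ k *: (if k == 0 :> nat then F (h 0%N) else compsum k F (h 0%N) h)|
    <= C * e ^+ n.+1.
Proof.
move=> M0 H0; have [C C0 HC] := csum_taylor n M0 H0; exists C => // F h e e01 CF hH FM.
have e0 : 0 <= e by case/andP: e01.
apply/mx_norm_le; first by rewrite mulr_ge0// exprn_ge0.
move=> i j; rewrite (ord1 j) !mxE summxE.
have := HC (fun y => F y i 0) h e e01 (Cn_entry i 0 CF) hH (FM i).
congr (`|_ - _| <= _); apply: eq_bigr => k _; rewrite mxE; congr (_ * _).
by case: ifP => // _; rewrite compsum_entry.
Qed.

End compsum_taylor.

(** * The flow of b *)

Section periodic_functions.
Context {R : realType}.

(** The codomain is an arbitrary type, so that the lemma applies to whatever expression of the phase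
    has to be bounded. *)
Lemma periodic_reduce (A : Type) (g : R -> A) : (forall th, g (th + 2 * pi) = g th) ->
  forall th, exists2 th0, 0 <= th0 <= 2 * pi & g th = g th0.
Proof.
move=> gP th; have p0 : 0 < 2 * pi :> R by rewrite mulr_gt0// pi_gt0.
have gn (n : nat) x : g (x + 2 * pi *+ n) = g x.
  by elim: n x => [|n IH] x; rewrite ?mulr0n ?addr0// mulrS addrCA addrC gP IH.
pose k := Num.floor (th / (2 * pi)); pose th0 := th - k%:~R * (2 * pi).
exists th0.
  have := floor_le (th / (2 * pi)); rewrite ler_pdivlMr// -/k => k1.
  have := floorD1_gt (th / (2 * pi)); rewrite ltr_pdivrMr// -/k intrD => k2.
  by rewrite /th0; apply/andP; split; lra.
have [n [kn|kn]] : exists n : nat, k = n%:Z \/ k = - n%:Z.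
  by case: (k) => n; [exists n; left|exists n.+1; right; rewrite NegzE].
  by rewrite -(gn n th0) /th0 kn -[_ *+ n]mulr_natl subrK.
by rewrite -(gn n th) /th0 kn mulrNz mulNr opprK -[_ *+ n]mulr_natl.
Qed.

Lemma derive_periodic {V W : normedModType R} (f : V -> W) c x v :
  (forall y, f (y + c) = f y) -> 'D_v f (x + c) = 'D_v f x.
Proof.
move=> fc; rewrite /derive.
have -> // : (fun h : R => h^-1 *: ((f \o shift (x + c)) (h *: v) - f (x + c))) =
             (fun h : R => h^-1 *: ((f \o shift x) (h *: v) - f x)).
by apply/funext => h; rewrite /= addrA !fc.
Qed.

End periodic_functions.

Section diff_matrix.
Context {R : realType}.

Lemma diff_entry {V : normedModType R} k l (F : V -> 'M[R]_(k, l)) x v i j :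
  differentiable F x -> 'd F x v i j = 'D_v (fun y => F y i j) x.
Proof. by move=> dF; have [_ ->] := is_derive_entry i j (diff_is_derive v dF). Qed.

Lemma entry_differentiable {V : normedModType R} k l (F : V -> 'M[R]_(k, l)) x i j :
  differentiable F x -> differentiable (fun y => F y i j) x.
Proof.
move=> dF; apply: (@differentiable_comp _ _ _ _ F (fun M => M i j)) => //.
exact: differentiable_coord.
Qed.

Lemma jac_mulmx d (F : 'cV[R]_d -> 'cV[R]_d) z v :
  differentiable F z -> jac F z *m v = 'd F z v.
Proof.
move=> dF; apply/matrixP => i j; rewrite (ord1 j) diff_entry// mxE deriveE; last first.
  exact: entry_differentiable.
rewrite diff_coords; last exact: entry_differentiable.
by apply: eq_bigr => q _; rewrite mxE mulrC.
Qed.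

Lemma nabla1 d (F : 'cV[R]_d -> 'cV[R]_d) z v :
  differentiable F z -> nabla F z (fun _ : 'I_1 => v) = 'd F z v.
Proof.
move=> dF; apply/matrixP => i j; rewrite (ord1 j) diff_entry// deriveE; last first.
  exact: entry_differentiable.
rewrite diff_coords; last exact: entry_differentiable.
rewrite nabla_entry /dsum sum_tuple_cons; apply: eq_bigr => q _.
by rewrite sum_tuple0 big_ord1 mulrC.
Qed.

Lemma eq_mulmx_cV d (A B : 'M[R]_d) : (forall v : 'cV[R]_d, A *m v = B *m v) -> A = B.
Proof.
move=> AB; apply/matrixP => i j; have := AB (delta_mx j 0).
by rewrite -!colE => /matrixP/(_ i 0); rewrite !mxE.
Qed.

End diff_matrix.

(** * Regularity and group property of the flow of [b] *)

Section characteristics.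
Context {R : realType} {d n : nat} (b : R -> 'cV[R]_d -> 'cV[R]_d).
Context (Z : R -> R -> 'cV[R]_d -> 'cV[R]_d).
Hypothesis b_Cb : forall i, Cb (axes_x R d) n.+1 (fun p : R * 'cV[R]_d => b p.1 p.2 i 0).
Hypothesis Z_ode : forall (t th : R) (z : 'cV[R]_d),
  is_derive th (1 : R) (fun th' => Z t th' z) (b t (Z t th z)).
Hypothesis Z_init : forall t z, Z t 0 z = z.
Hypothesis Z_per : forall t z, periodic (fun th => Z t th z) (2 * pi).

Lemma b_smooth : Cn n.+1 (fun p : R * 'cV[R]_d => b p.1 p.2).
Proof. by apply: Cn_mx => i j; rewrite (ord1 j); exact: Cb_axes_x_Cn. Qed.

Lemma b_lipschitz : exists2 L : R, 0 <= L &
  forall p q : R * 'cV[R]_d, `|b q.1 q.2 - b p.1 p.2| <= L * `|q - p|.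
Proof.
have H i : exists M : R, 0 <= M /\ forall p q : R * 'cV[R]_d,
    `|b q.1 q.2 i 0 - b p.1 p.2 i 0| <= M * `|q - p|.
  have [M M0 HM] := Cb_axes_x_diff_bounded (b_Cb i); exists M; split=> // p q.
  rewrite -[X in `|X|]subr0.
  apply: (@mean_value_diff_le _ _ _ (fun p : R * 'cV[R]_d => b p.1 p.2 i 0)).
  - by rewrite mulr_ge0.
  - by have [] := Cb_axes_x_Cn (b_Cb i).
  - by move=> s _; rewrite subr0.
have [M HM] := choice H; exists (\sum_i M i); first by apply: sumr_ge0 => i _; case: (HM i).
move=> p q; have M0 : 0 <= \sum_i M i by apply: sumr_ge0 => i _; case: (HM i).
apply/mx_norm_le; first by rewrite mulr_ge0.
move=> i j; rewrite (ord1 j) !mxE; have [_ /(_ p q) H1] := HM i.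
apply: (le_trans H1); rewrite ler_wpM2r// (bigD1 i)//= lerDl.
by apply: sumr_ge0 => k _; case: (HM k).
Qed.

Lemma b_bounded : exists2 B : R, 0 <= B & forall t z, `|b t z| <= B.
Proof.
have H i : exists M : R, 0 <= M /\ forall p : R * 'cV[R]_d, `|b p.1 p.2 i 0| <= M.
  by have [M M0 HM] := Cb_bounded (b_Cb i); exists M.
have [M HM] := choice H.
have M0 : 0 <= \sum_i M i by apply: sumr_ge0 => i _; case: (HM i).
exists (\sum_i M i) => // t z; apply/mx_norm_le => // i j; rewrite (ord1 j).
have [_ /(_ (t, z)) H1] := HM i; apply: (le_trans H1); rewrite (bigD1 i)//= lerDl.
by apply: sumr_ge0 => k _; case: (HM k).
Qed.

(** The parameter [t] becomes a state component at rest, so that regularity in [t] is regularity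
    with respect to the initial value of an autonomous flow. *)
Let G (w : R * 'cV[R]_d) : R * 'cV[R]_d := (0, b w.1 w.2).
Let Phi (th : R) (w : R * 'cV[R]_d) : R * 'cV[R]_d := (w.1, Z w.1 th w.2).

Let Phi_ode th w : is_derive th (1 : R) (fun s => Phi s w) (G (Phi th w)).
Proof.
apply: (@is_derive_pair _ R 'cV[R]_d (fun=> w.1) (fun s => Z w.1 s w.2)).
Qed.

Lemma Z_dist_le : exists2 B : R, 0 <= B & forall t th z, `|Z t th z - z| <= B * `|th|.
Proof.
have [B B0 HB] := b_bounded; exists B => // t' th' z'.
have := @mean_value_le _ _ (fun s => Z t' s z') _ 0 B 0 th' B0 (fun x _ => Z_ode t' x z').
by rewrite scaler0 !subr0 Z_init; apply=> s _; rewrite subr0.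
Qed.

Definition zeta (p : R * R * 'cV[R]_d) : 'cV[R]_d := Z p.1.1 p.1.2 p.2.

Lemma zeta_smooth : Cn n.+1 zeta.
Proof.
have CPhi : Cn n.+1 (fun p : R * (R * 'cV[R]_d) => Phi p.1 p.2).
  apply: (flow_smooth (G := G)) => //.
  - by apply: proper_prod; [exact: proper_real|exact: proper_mx].
  - by apply: (@Cn_pair _ _ _ R); [exact: Cn_cst|exact: b_smooth].
  - by move=> [t z]; rewrite /Phi /= Z_init.
  - move=> r; have [B B0 HB] := Z_dist_le; exists (`|r| + B * `|r|) => th [t z] thr.
    rewrite !prod_norm_le => /andP[tr zr] /=; have rr := ler_norm r.
    have Br : 0 <= B * `|r| by rewrite mulr_ge0.
    apply/andP; split; first lra.
    rewrite -(subrK z (Z t th z)) (le_trans (ler_normD _ _))// addrC lerD//; first lra.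
    by rewrite (le_trans (HB _ _ _))// ler_wpM2l//; lra.
have -> : zeta = fun p => (Phi p.1.2 (p.1.1, p.2)).2 by apply/funext => -[[t th] z].
apply: (Cn_comp _ (Cn_snd _ _ _)).
apply: (@Cn_comp _ _ _ _ _ (fun p : R * R * 'cV[R]_d => (p.1.2, (p.1.1, p.2))) _ _ CPhi).
have C1 := Cn_fst n.+1 (R * R)%type 'cV[R]_d.
apply: (@Cn_pair _ _ _ R (R * 'cV[R]_d)%type); first exact: (Cn_comp C1 (Cn_snd _ _ _)).
apply: (@Cn_pair _ _ _ R 'cV[R]_d); first exact: (Cn_comp C1 (Cn_fst _ _ _)).
exact: Cn_snd.
Qed.

Lemma zeta_diff p : differentiable zeta p.
Proof. exact: Cn_diff zeta_smooth. Qed.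

(** Uniqueness by Gronwall's inequality: for frozen [t] the equation is autonomous in the phase, so
    both sides solve it with the same value at [th1 = 0]. *)
Lemma Z_group t th1 th2 z : Z t th1 (Z t th2 z) = Z t (th1 + th2) z.
Proof.
have [L L0 HL] := b_lipschitz.
pose u s := Z t s (Z t th2 z) - Z t (s + th2) z.
have du s : is_derive s (1 : R) u (b t (Z t s (Z t th2 z)) - b t (Z t (s + th2) z)).
  have H : is_derive s (1 : R) (fun s => Z t (s + th2) z) (b t (Z t (s + th2) z)).
    have /is_derive_edP H := Z_ode t (s + th2) z.
    by apply/is_derive_edP => e /H[k k0 Hk]; exists k => // x /Hk; rewrite (addrAC s).
  exact: is_deriveB.
have := @gronwall_sym _ _ u _ L 0 `|th1| L0 (lexx _) (fun s _ => du s) _ th1 (lexx _).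
have -> : u 0 = 0 by rewrite /u add0r Z_init subrr.
rewrite normr0 mul0r add0r mul0r => H.
apply/subr0_eq/eqP; rewrite -normr_le0; apply: H => s _; rewrite addr0.
have := HL (t, Z t (s + th2) z) (t, Z t s (Z t th2 z)).
have -> : (t, Z t s (Z t th2 z)) - (t, Z t (s + th2) z) = (0, u s).
  by rewrite -[LHS]/(t - t, _) subrr.
by move=> /le_trans; apply; rewrite ler_wpM2l// prod_norm_le normr0 normr_ge0 /=.
Qed.

Lemma ZK t th z : Z t (- th) (Z t th z) = z.
Proof. by rewrite Z_group addNr Z_init. Qed.

Lemma ZVK t th z : Z t th (Z t (- th) z) = z.
Proof. by rewrite Z_group addrN Z_init. Qed.

Lemma zeta_diff_periodic t th z w :
  'd zeta (t, th + 2 * pi, z) w = 'd zeta (t, th, z) w.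
Proof.
have zP q : zeta (q + (0, 2 * pi, 0)) = zeta q.
  by case: q => [[t' th'] z']; rewrite /zeta /= !addr0 Z_per.
have := derive_periodic (t, th, z) w zP; rewrite !deriveE; [|exact: zeta_diff..].
by rewrite (_ : (t, th, z) + (0, 2 * pi, 0) = (t, th + 2 * pi, z))//; congr (_, _, _);
  rewrite /= addr0.
Qed.

Lemma zeta_diff_theta t th z : 'd zeta (t, th, z) (0, 1, 0) = b t (Z t th z).
Proof.
have := diff_is_derive ((0, 1, 0) : R * R * 'cV[R]_d) (zeta_diff (t, th, z)).
by move=> /is_derive_slicel /(@is_derive_slice _ _ _ _ (fun q => zeta (q, z)))[_ <-];
  have [_ ->] := Z_ode t th z.
Qed.

Lemma zeta_diff_state t th z v : differentiable (Z t th) z /\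
  'd zeta (t, th, z) (0, 0, v) = 'd (Z t th) z v.
Proof.
have dZ : differentiable (Z t th) z.
  have C : Cn n.+1 (Z t th).
    apply: (Cn_comp (g := zeta) (f := fun z => (t, th, z)) _ zeta_smooth).
    apply: (@Cn_pair _ _ _ (R * R)%type); [exact: Cn_cst|exact: Cn_id].
  exact: Cn_diff C.
split=> //.
have /is_derive_slice[_ <-] := diff_is_derive ((0, 0, v) : R * R * 'cV[R]_d) (zeta_diff (t, th, z)).
exact: deriveE.
Qed.

(* Differentiating [Z t th (Z t s x) = Z t (th + s) x] in [s] at [s = 0]. *)
Lemma zeta_diff_b t th x : 'd zeta (t, th, x) (0, 0, b t x) = b t (Z t th x).
Proof.
have [dZ ->] := zeta_diff_state t th x (b t x).
have H0 : is_derive (0 : R) (1 : R) (fun s => Z t s x) (b t x).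
  by have := Z_ode t 0 x; rewrite Z_init.
have H1 : is_derive (0 : R) (1 : R) (Z t th \o (fun s => Z t s x)) ('d (Z t th) x (b t x)).
  by have := @is_derive_comp_diff _ _ _ (Z t th) _ _ _ _ H0; rewrite Z_init; exact.
have H2 : is_derive (0 : R) (1 : R) (Z t th \o (fun s => Z t s x)) (b t (Z t th x)).
  have -> : Z t th \o (fun s => Z t s x) = fun s => Z t (th + s) x.
    by apply/funext => s /=; rewrite Z_group.
  have /is_derive_edP H := Z_ode t th x.
  by apply/is_derive_edP => e /H[k k0 Hk]; exists k => // s /Hk; rewrite add0r addr0.
by have [_ <-] := H1; have [_ <-] := H2.
Qed.

(** Over one period Gronwall's inequality makes [Z] Lipschitz in [(t, z)] with constant
    [expR (L * (2 * pi))], and periodicity extends the resulting bound on the differential to all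
    phases. The uniform bound on [alpha0] rests on it. *)
Lemma zeta_diff_bounded : exists2 C : R, 0 <= C & forall t th z s v,
  `|'d zeta (t, th, z) (s, 0, v)| <= C * `|(s, v)|.
Proof.
have [L L0 HL] := b_lipschitz.
pose C := expR (L * (2 * pi)); exists C; first exact: expR_ge0.
have lipZ th : 0 <= th <= 2 * pi -> forall t z t' z',
    `|Z t' th z' - Z t th z| <= C * `|(t' - t, z' - z)|.
  move=> /andP[th0 th1] t z t' z'.
  pose u s := Phi s (t', z') - Phi s (t, z).
  have du s : is_derive s (1 : R) u (G (Phi s (t', z')) - G (Phi s (t, z))).
    by apply: is_deriveB.
  have := @gronwall_sym _ _ u _ L 0 (2 * pi) L0 (lexx _) (fun s _ => du s) _ th _.
  have -> : u 0 = (t' - t, z' - z) by rewrite /u /Phi /= !Z_init.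
  rewrite mul0r addr0 [_ * expR _]mulrC ger0_norm// => /(_ _ th1) H.
  have : `|u th| <= C * `|(t' - t, z' - z)|.
    apply: H => s _; rewrite addr0.
    have := HL (Phi s (t, z)) (Phi s (t', z')); apply: le_trans.
    rewrite [X in `|X|](_ : _ = (0, b t' (Z t' s z') - b t (Z t s z))).
      by rewrite prod_norm_le normr0 normr_ge0 lexx.
    by rewrite -[LHS]/(0 - 0, _) subrr.
  by rewrite [u th](_ : _ = (t' - t, Z t' th z' - Z t th z))// prod_norm_le => /andP[].
have main th : 0 <= th <= 2 * pi -> forall t z s v,
    `|'d zeta (t, th, z) (s, 0, v)| <= C * `|(s, v)|.
  move=> th01 t z s v; apply/ler_addgt0Pr => e e0.
  have := diff_is_derive ((s, 0, v) : R * R * 'cV[R]_d) (zeta_diff (t, th, z)).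
  move=> /is_derive_edP/(_ e e0)[k k0 Hk].
  have k20 : 0 < k / 2 by rewrite divr_gt0.
  have := Hk (k / 2); rewrite gtr0_norm// => /(_ ltac:(lra)).
  set D := 'd _ _ _.
  have -> : (t, th, z) + (k / 2) *: (s, 0, v) = (t + (k / 2) * s, th, z + (k / 2) *: v).
    by congr (_, _, _); rewrite /= -[_ *: 0]/(_ * 0) mulr0 addr0.
  have := lipZ th th01 t z (t + (k / 2) * s) (z + (k / 2) *: v).
  rewrite -/(zeta (t + (k / 2) * s, th, z + (k / 2) *: v)) -/(zeta (t, th, z)).
  have -> : (t + (k / 2) * s - t, z + (k / 2) *: v - z) = (k / 2) *: (s, v).
    by congr pair; rewrite /= addrAC subrr add0r.
  rewrite normrZ (gtr0_norm k20) => h1 h2.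
  have : `|(k / 2) *: D| <= C * (k / 2 * `|(s, v)|) + e * (k / 2).
    rewrite -[_ *: D](subKr (zeta (t + k / 2 * s, th, z + (k / 2) *: v) - zeta (t, th, z))).
    by rewrite (le_trans (ler_normB _ _))// lerD.
  by rewrite normrZ (gtr0_norm k20) => h3; rewrite -(ler_pM2l k20); lra.
move=> t th z s v.
have [|th0 th01 ->] := @periodic_reduce _ _ (fun th => 'd zeta (t, th, z) (s, 0, v)) _ th.
  by move=> x; exact: zeta_diff_periodic.
exact: main.
Qed.

End characteristics.

(** * The field [alpha0] as a pullback by the flow of [b] *)

Section alpha0_field.
Context {R : realType} {d m : nat}.
Context (a : R -> R -> 'cV[R]_d -> 'cV[R]_d) (b : R -> 'cV[R]_d -> 'cV[R]_d).
Context (Z : R -> R -> 'cV[R]_d -> 'cV[R]_d).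
Hypothesis a_Cb : forall i, Cb (axes_tx R d) m.+1
  (fun p : R * R * 'cV[R]_d => a p.1.1 p.1.2 p.2 i 0).
Hypothesis a_per : forall t x, periodic (fun th => a t th x) (2 * pi).
Hypothesis b_Cb : forall i, Cb (axes_x R d) m.+2 (fun p : R * 'cV[R]_d => b p.1 p.2 i 0).
Hypothesis Z_ode : forall (t th : R) (z : 'cV[R]_d),
  is_derive th (1 : R) (fun th' => Z t th' z) (b t (Z t th z)).
Hypothesis Z_init : forall t z, Z t 0 z = z.
Hypothesis Z_per : forall t z, periodic (fun th => Z t th z) (2 * pi).

Local Notation T3 := (R * R * 'cV[R]_d)%type.
Let zetaC : Cn m.+2 (zeta Z) := zeta_smooth b_Cb Z_ode Z_init.
Let zetaD p : differentiable (zeta Z) p := zeta_diff b_Cb Z_ode Z_init p.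

Lemma a_smooth : Cn m.+1 (fun p : T3 => a p.1.1 p.1.2 p.2).
Proof. by apply: Cn_mx => i j; rewrite (ord1 j); exact: Cb_axes_tx_Cn. Qed.

Lemma a_bounded : exists2 C : R, 0 <= C & forall t th z, `|a t th z| <= C.
Proof.
have H i : exists M : R, 0 <= M /\ forall p : T3, `|a p.1.1 p.1.2 p.2 i 0| <= M.
  by have [M M0 HM] := Cb_bounded (a_Cb i); exists M.
have [M HM] := choice H.
have M0 : 0 <= \sum_i M i by apply: sumr_ge0 => i _; case: (HM i).
exists (\sum_i M i) => // t th z; apply/mx_norm_le => // i j; rewrite (ord1 j).
have [_ /(_ (t, th, z)) H1] := HM i; apply: (le_trans H1); rewrite (bigD1 i)//= lerDl.
by apply: sumr_ge0 => k _; case: (HM k).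
Qed.

Let zetaD3 p s u v : 'd (zeta Z) p ((s, u, v) : T3) =
  s *: 'd (zeta Z) p ((1, 0, 0) : T3) + u *: 'd (zeta Z) p ((0, 1, 0) : T3) +
  'd (zeta Z) p ((0, 0, v) : T3).
Proof.
rewrite -(linearZZ ('d (zeta Z) p)) -(linearZZ ('d (zeta Z) p)) -!linearD; congr ('d _ _ _).
by congr (_, _, _); rewrite /= ?scaler0 ?addr0 ?add0r// -[_ *: 1]/(_ * 1) mulr1.
Qed.

(* Differentiating [Z t (- th) (Z t th z) = z] in [t]. *)
Let zeta_time_inverse t th z :
  'd (zeta Z) (t, - th, Z t th z) ((1, 0, derive1 (fun t' => Z t' th z) t) : T3) = 0.
Proof.
have H1 : is_derive t (1 : R) (fun t' => Z t' th z) (derive1 (fun t' => Z t' th z) t).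
  rewrite derive1E.
  have /is_derive_slicel := diff_is_derive ((1, 0, 0) : T3) (zetaD (t, th, z)).
  move=> /(@is_derive_slicel _ _ _ _ (fun q => zeta Z (q, z)))[H _].
  exact: derivableP.
have H2 : is_derive t (1 : R) (fun t' => ((t', - th), Z t' th z) : T3)
    ((1, 0), derive1 (fun t' => Z t' th z) t).
  apply: (@is_derive_pair _ (R * R)%type 'cV[R]_d (fun t' => (t', - th))).
  exact: (@is_derive_pair _ R R id (fun=> - th)).
have := is_derive_comp_diff (zetaD (t, - th, Z t th z)) H2.
have -> : zeta Z \o (fun t' => ((t', - th), Z t' th z)) = fun=> z.
  by apply/funext => t'; rewrite /zeta /= (ZK b_Cb Z_ode Z_init).
by case=> _ <-; rewrite derive_cst.
Qed.

(** Differentiation of [Z t (- th) (Z t th z) = z] in [z]. It makes [invmx] in [alpha0] a true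
    inverse, namely the Jacobian of the backward flow. *)
Lemma jac_inverse t th z :
  jac (Z t (- th)) (Z t th z) *m jac (Z t th) z = 1%:M.
Proof.
apply: eq_mulmx_cV => v; rewrite -mulmxA mul1mx.
have [d1 _] := zeta_diff_state b_Cb Z_ode Z_init t th z v.
have [d2 _] := zeta_diff_state b_Cb Z_ode Z_init t (- th) (Z t th z) v.
rewrite jac_mulmx// jac_mulmx//.
have := diff_comp d1 d2; have -> : Z t (- th) \o Z t th = id.
  by apply/funext => x /=; rewrite (ZK b_Cb Z_ode Z_init).
move=> /(congr1 (fun f => f v)) /= <-.
by rewrite (@diff_val _ _ _ _ _ _ _ (is_diff_id z)).
Qed.

(** The inverse Jacobian is the state differential of the backward flow, and by [zeta_time_inverse]
    it sends the time derivative of [Z] to the opposite of the time differential. With the matrix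
    inverse gone, regularity, boundedness and [backward_flow_ode] become direct. *)
Lemma alpha0_zeta t th z : alpha0 a Z t th z =
  'd (zeta Z) (t, - th, Z t th z) ((1, 0, a t th (Z t th z)) : T3).
Proof.
have J := jac_inverse t th z.
have -> : alpha0 a Z t th z = jac (Z t (- th)) (Z t th z) *m
    (a t th (Z t th z) - derive1 (fun t' => Z t' th z) t).
  rewrite /alpha0; congr (_ *m _).
  have [_ uJ] := mulmx1_unit J.
  by rewrite -[LHS]mul1mx -J mulmxK.
have [dZ H] := zeta_diff_state b_Cb Z_ode Z_init t (- th) (Z t th z)
  (a t th (Z t th z) - derive1 (fun t' => Z t' th z) t).
rewrite jac_mulmx// -H -[RHS]subr0 -(zeta_time_inverse t th z).
rewrite -(linearB ('d (zeta Z) _)); congr ('d _ _ _).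
by congr (_, _, _); rewrite /= subrr.
Qed.

Lemma alpha0_smooth : Cn m.+1 (fun p : T3 => alpha0 a Z p.1.1 p.1.2 p.2).
Proof.
under eq_fun do rewrite alpha0_zeta.
have C1 := Cn_fst m.+1 (R * R)%type 'cV[R]_d.
have Ct : Cn m.+1 (fun p : T3 => p.1.1) by exact: (Cn_comp C1 (Cn_fst _ _ _)).
have Cth : Cn m.+1 (fun p : T3 => p.1.2) by exact: (Cn_comp C1 (Cn_snd _ _ _)).
have Cz : Cn m.+1 (fun p : T3 => Z p.1.1 p.1.2 p.2) by exact: CnS zetaC.
apply: (Cn_diff_along zetaC); first exact: (Cn_triple Ct (CnN Cth) Cz).
have Ca := Cn_comp (Cn_triple Ct Cth Cz) a_smooth.
exact: (Cn_triple (Cn_cst _ _ (1 : R)) (Cn_cst _ _ (0 : R)) Ca).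
Qed.

Lemma alpha0_bounded : exists2 C : R, 0 <= C & forall t th z, `|alpha0 a Z t th z| <= C.
Proof.
have [A A0 HA] := a_bounded.
have [C C0 HC] := zeta_diff_bounded b_Cb Z_ode Z_init Z_per.
exists (C * Num.max 1 A); first by rewrite mulr_ge0// le_max ler01.
move=> t th z; rewrite alpha0_zeta (le_trans (HC _ _ _ _ _))// ler_wpM2l//.
by rewrite prod_norm_le normr1 !le_max lexx HA orbT.
Qed.

Lemma alpha0_periodic t th : alpha0 a Z t (th + 2 * pi) = alpha0 a Z t th.
Proof.
apply/funext => z.
have ZP t' : Z t' (th + 2 * pi) = Z t' th by apply/funext => z'; exact: Z_per.
rewrite /alpha0 !ZP a_per.
have -> // : (fun t' => Z t' (th + 2 * pi) z) = (fun t' => Z t' th z).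
by apply/funext => t'; rewrite ZP.
Qed.

(** The phase argument moves at speed [- eps^-1] and contributes [- eps^-1 *: b], while the state
    differential maps the forcing [eps^-1 *: b] to the same vector with the opposite sign; the
    singular terms cancel. *)
Lemma backward_flow_ode (s eps t : R) (X : R -> 'cV[R]_d) : eps != 0 ->
  is_derive t (1 : R) X (a t ((t - s) / eps) (X t) + eps^-1 *: b t (X t)) ->
  is_derive t (1 : R) (fun t => Z t (- ((t - s) / eps)) (X t))
    (alpha0 a Z t ((t - s) / eps) (Z t (- ((t - s) / eps)) (X t))).
Proof.
move=> e0 dX; set th := (t - s) / eps; set x := X t.
have H : is_derive t (1 : R) (fun t => ((t, - ((t - s) / eps)), X t) : T3)
   ((1, - eps^-1), a t th x + eps^-1 *: b t x).
  apply: (@is_derive_pair _ (R * R)%type 'cV[R]_d (fun t => (t, - ((t - s) / eps)))) => //.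
  apply: (@is_derive_pair _ R R id) => //.
  apply/is_derive_edP => e e1; exists 1 => // u _.
  rewrite -[u *: 1]/(u * 1) -[u *: _]/(u * _) (_ : _ - _ - _ = 0); last by ring.
  by rewrite normr0 mulr_ge0// ltW.
have := is_derive_comp_diff (zetaD (t, - th, x)) H.
rewrite alpha0_zeta (ZVK b_Cb Z_ode Z_init) -/th.
congr is_derive; rewrite zetaD3 [RHS]zetaD3 scale0r addr0 -addrA; congr (_ + _).
have -> : ((0, 0, a t th x + eps^-1 *: b t x) : T3) =
   ((0, 0, a t th x) : T3) + eps^-1 *: ((0, 0, b t x) : T3).
  by congr (_, _, _); rewrite /= ?scaler0 ?addr0 -?[_ *: 0]/(_ * 0) ?mulr0 ?addr0.
rewrite linearD (linearZZ ('d (zeta Z) _)).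
rewrite (zeta_diff_b b_Cb Z_ode Z_init) (zeta_diff_theta b_Cb Z_ode Z_init).
by rewrite scaleNr addrCA addNr addr0.
Qed.

End alpha0_field.

(** * Averages and oscillating primitives *)

Section vector_fields.
Context {R : realType} {d : nat}.
Implicit Types (f : vfield R d) (y : nat -> 'cV[R]_d).

(** Sequences of vectors carry no norm here, so the regularity of a field is tested by substituting
    maps of the same class defined on a proper space. *)
Definition smooth_field n f := forall V : normedModType R, proper V ->
  forall (t th : V -> R) (y : nat -> V -> 'cV[R]_d),
  Cn n t -> Cn n th -> (forall i, Cn n (y i)) ->
  Cn n (fun p => f (t p) (th p) (fun i => y i p)).

Definition periodic_field f := forall t th y, f t (th + 2 * pi) y = f t th y.

(** The corrector [th *: osc f], written without division. For a regular [f] it is regular at phase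
    0 as well, and it inherits the periodicity of [f]. *)
Definition prim f : vfield R d :=
  fun t th y => vint (fun s => f t s y) 0 th - th *: mean f t y.

Lemma scale_osc f t th y : th *: osc f t th y = prim f t th y.
Proof.
rewrite /osc /prim; have [->|th0] := eqVneq th 0.
  by rewrite vint0 !scale0r subr0.
by rewrite scalerBr scalerA mulfV// scale1r.
Qed.

Lemma osc_scale f t th y : th != 0 -> osc f t th y = th^-1 *: prim f t th y.
Proof. by move=> th0; rewrite -scale_osc scalerA mulVf// scale1r. Qed.

Lemma prim0 f t y : prim f t 0 y = 0.
Proof. by rewrite -scale_osc scale0r. Qed.

Lemma smooth_vint n f : smooth_field n.+1 f ->
  smooth_field n.+1 (fun t th y => vint (fun s => f t s y) 0 th).
Proof.
move=> Cf V pV t th y Ct Cth Cy.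
have C1 := Cn_fst n.+1 V R.
have CF : Cn n.+1 (fun p : V * R => f (t p.1) p.2 (fun i => y i p.1)).
  apply: (Cf _ (proper_prod pV proper_real) (fun p => t p.1) snd (fun i p => y i p.1)).
  - exact: (Cn_comp C1 Ct).
  - exact: Cn_snd.
  - by move=> i; exact: (Cn_comp C1 (Cy i)).
exact: (Cn_comp (Cn_pair (Cn_id _ V) Cth) (vint_smooth pV CF)).
Qed.

Lemma smooth_mean n f : smooth_field n.+1 f -> smooth_field n.+1 (fun t _ y => mean f t y).
Proof.
move=> /smooth_vint Cf V pV t th y Ct Cth Cy; apply: CnZ; first exact: Cn_cst.
exact: (Cf V pV t (fun=> 2 * pi) y Ct (Cn_cst _ _ _) Cy).
Qed.

Lemma smooth_prim n f : smooth_field n.+1 f -> smooth_field n.+1 (prim f).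
Proof.
move=> Cf V pV t th y Ct Cth Cy; apply: CnB; first exact: smooth_vint.
by apply: CnZ => //; exact: (smooth_mean Cf pV Ct Cth Cy).
Qed.

Lemma smooth_field_theta n f t y : smooth_field n f -> continuous (fun s => f t s y).
Proof.
move=> Cf; apply: (@Cn_continuous _ n).
apply: (Cf _ (@proper_real R) (fun=> t) id (fun i _ => y i)).
- exact: Cn_cst.
- exact: Cn_id.
- by move=> i; exact: Cn_cst.
Qed.

Lemma prim_derive n f t th y : smooth_field n f ->
  is_derive th (1 : R) (fun s => prim f t s y) (f t th y - mean f t y).
Proof.
move=> Cf; have H := vint_derive th (@smooth_field_theta n f t y Cf).
apply: is_deriveB; apply/is_derive_edP => e e0; exists 1 => // s _.
rewrite -[s *: 1]/(s * 1) mulr1 (_ : _ - _ - _ = 0).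
  by rewrite normr0 mulr_ge0// ltW.
by vring R 'cV[R]_d.
Qed.

(** The increment over a period has derivative zero, because [f] minus its mean is periodic, and it
    vanishes at phase 0, because the integral over a period is [2 * pi] times the mean. *)
Lemma prim_periodic n f : smooth_field n f -> periodic_field f -> periodic_field (prim f).
Proof.
move=> Cf fP t th y.
pose g s := prim f t (s + 2 * pi) y - prim f t s y.
have dg s : is_derive s (1 : R) g 0.
  have H : is_derive s (1 : R) (fun s => prim f t (s + 2 * pi) y) (f t s y - mean f t y).
    have /is_derive_edP := prim_derive t (s + 2 * pi) y Cf; rewrite fP => H.
    by apply/is_derive_edP => e /H[k k0 Hk]; exists k => // x /Hk; rewrite (addrAC s).
  have H' := prim_derive t s y Cf.
  by have := is_deriveB H H'; rewrite subrr.
have g0 : g 0 = 0.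
  rewrite /g add0r prim0 subr0 /prim /mean scalerA mulfV ?scale1r ?subrr//.
  by rewrite mulf_neq0// gt_eqF// pi_gt0.
have := @mean_value_le _ _ g _ 0 0 0 th (lexx _) (fun x _ => dg x).
rewrite scaler0 g0 !subr0 normr0 mul0r => H.
by apply/subr0_eq/eqP; rewrite -normr_le0; apply: H.
Qed.

(** The first [k + 1] terms of the sequence become the columns of a matrix, so that a field
    depending on them alone is a map on a proper space and has a differential. *)
Definition chart k (t th : R) y : R * R * 'M[R]_(d, k.+1) :=
  (t, th, \matrix_(r, j) y j r 0).

(** For [i > k], [inord i] is a default index; a field that satisfies [depends_upto k] does not see
    the column it selects. *)
Definition unchart k f (u : R * R * 'M[R]_(d, k.+1)) : 'cV[R]_d :=
  f u.1.1 u.1.2 (fun i => col (inord i) u.2).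

Definition depends_upto k f := forall t th y y',
  (forall i, (i <= k)%N -> y i = y' i) -> f t th y = f t th y'.

Lemma unchartK k f t th y : depends_upto k f -> unchart f (chart k t th y) = f t th y.
Proof.
move=> fk; apply: fk => i ik /=; apply/matrixP => r j.
by rewrite !mxE (ord1 j) inordK.
Qed.

Lemma unchart_smooth k n f : smooth_field n f -> Cn n (@unchart k f).
Proof.
move=> Cf; have C1 := Cn_fst n (R * R)%type 'M[R]_(d, k.+1).
apply: (Cf _ _ (fun u => u.1.1) (fun u => u.1.2) (fun i u => col (inord i) u.2)).
- apply: proper_prod; last exact: proper_mx.
  by apply: proper_prod; exact: proper_real.
- exact: (Cn_comp C1 (Cn_fst _ _ _)).
- exact: (Cn_comp C1 (Cn_snd _ _ _)).
- move=> i; apply: Cn_mx => r j.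
  have -> : (fun u : R * R * 'M[R]_(d, k.+1) => col (inord i) u.2 r j) =
            fun u => u.2 r (inord i) by apply/funext => u; rewrite mxE.
  by apply: Cn_entry; exact: Cn_snd.
Qed.

Lemma chart_smooth k n (V : normedModType R) (t th : V -> R) (y : nat -> V -> 'cV[R]_d) :
  Cn n t -> Cn n th -> (forall i, (i <= k)%N -> Cn n (y i)) ->
  Cn n (fun p => chart k (t p) (th p) (fun i => y i p)).
Proof.
move=> Ct Cth Cy; apply: (Cn_triple Ct Cth); apply: Cn_mx => r j.
under eq_fun do rewrite mxE.
by apply: Cn_entry; apply: Cy; rewrite -ltnS.
Qed.

(** The definition does not yield this directly, since it accepts only substitutions of class [n'];
    factoring through the chart turns the claim into a composition of maps. *)
Lemma smooth_field_le k n n' f : depends_upto k f -> (n <= n')%N ->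
  smooth_field n' f -> smooth_field n f.
Proof.
move=> fk nn' Cf V pV t th y Ct Cth Cy.
have := Cn_comp (chart_smooth (k := k) Ct Cth (fun i _ => Cy i)) (Cn_le nn' (unchart_smooth k Cf)).
by under eq_fun do rewrite (unchartK _ _ _ fk).
Qed.

Lemma depends_upto_prim k f : depends_upto k f -> depends_upto k (prim f).
Proof.
move=> fk t th y y' yy'; rewrite /prim (eq_mean (y' := y')); last first.
  by move=> s; exact: fk.
by congr (vint _ _ _ - _); apply/funext => s; exact: fk.
Qed.

Section transport.
Context (al : nat -> vfield R d) (k : nat).
Hypothesis Cal : smooth_field 1 (al k).
Hypothesis al_upto : depends_upto k (al k).

Let P := @unchart k (prim (al k)).
Let PC : Cn 1 P := unchart_smooth k (smooth_prim Cal).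
Let PD u : differentiable P u := Cn_diff u PC.

(* The derivative of [th *: osc (al k)] along the slow vector field. *)
Definition transport : vfield R d := fun t th y =>
  'd P (chart k t th y) ((1, 0, \matrix_(r, j) mean (al j) t y r 0) : R * R * 'M[R]_(d, k.+1)).

Let colmx (j : nat) (h : 'cV[R]_d) : 'M[R]_(d, k.+1) :=
  \matrix_(r, i) (if i == j :> nat then h r 0 else 0).

Lemma prim_upd_derive t th y j h : is_derive (y j) h (fun u => prim (al k) t th (upd y j u))
  ('d P (chart k t th y) ((0, 0, colmx j h) : R * R * 'M[R]_(d, k.+1))).
Proof.
have /is_derive_slice/is_derive_edP H :=
  diff_is_derive ((0, 0, colmx j h) : R * R * 'M[R]_(d, k.+1)) (PD (chart k t th y)).
have E u : prim (al k) t th (upd y j u) = P (chart k t th (upd y j u)).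
  by rewrite /P (unchartK _ _ _ (depends_upto_prim al_upto)).
apply/is_derive_edP => e e0; have [c c0 Hc] := H e e0.
exists c; first exact: c0.
move=> s sc; rewrite !E /chart.
have -> : \matrix_(r < d, i < k.+1) upd y j (y j + s *: h) i r 0 =
    \matrix_(r < d, i < k.+1) y i r 0 + s *: colmx j h :> 'M[R]_(d, k.+1).
  apply/matrixP => r i; rewrite /colmx !mxE /upd.
  by case: eqP => [->|_]; rewrite ?mxE ?mulr0 ?addr0.
have -> : \matrix_(r < d, i < k.+1) upd y j (y j) i r 0 =
    \matrix_(r < d, i < k.+1) y i r 0 :> 'M[R]_(d, k.+1).
  by apply/matrixP => r i; rewrite [LHS]mxE [RHS]mxE /upd; case: eqP => // ->.
exact: Hc.
Qed.

Lemma prim_time_derive t th y : is_derive t (1 : R) (fun t => prim (al k) t th y)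
  ('d P (chart k t th y) ((1, 0, 0) : R * R * 'M[R]_(d, k.+1))).
Proof.
have E t' : prim (al k) t' th y = P (chart k t' th y).
  by rewrite /P (unchartK _ _ _ (depends_upto_prim al_upto)).
under eq_fun do rewrite E.
have /is_derive_slicel := diff_is_derive ((1, 0, 0) : R * R * 'M[R]_(d, k.+1)) (PD (chart k t th y)).
exact: (@is_derive_slicel _ _ _ _ (fun q => P (q, \matrix_(r, j) y j r 0))).
Qed.

(** Groups the subtracted terms of the recursion into one directional derivative of [prim]. For
    [th != 0] the factor [th] cancels the [th^-1] of [osc]; for [th = 0] the direction has no phase
    component and [prim] vanishes on the whole slice of phase 0. *)
Lemma transportE t th y : th *: (\sum_(j < k.+1)
     nabla (fun u => osc (al k) t th (upd y j u)) (y j) (fun _ : 'I_1 => mean (al j) t y)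
   + derive1 (fun t' => osc (al k) t' th y) t) = transport t th y.
Proof.
pose N : 'M[R]_(d, k.+1) := \matrix_(r, j) mean (al j) t y r 0.
have NE : N = \sum_(j < k.+1) colmx j (mean (al j) t y).
  apply/matrixP => r i; rewrite /N mxE summxE (bigD1 i)//= /colmx [X in X + _]mxE eqxx.
  by rewrite big1 ?addr0// => j ji; rewrite mxE ifN// eq_sym.
have [->|th0] := eqVneq th 0.
  rewrite scale0r /transport.
  have := diff_is_derive ((1, 0, N) : R * R * 'M[R]_(d, k.+1)) (PD (chart k t 0 y)).
  case=> _ <-; apply/esym/lim_near_cst => //; apply: nearW => s /=.
  rewrite /P /unchart /= /chart /= -[_ *: 0]/(_ * 0) mulr0 add0r.
  by rewrite !prim0 subrr scaler0.
have dprim j : differentiable (fun u => prim (al k) t th (upd y j u)) (y j).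
  have C : Cn 1 (fun u : 'cV[R]_d => prim (al k) t th (fun i => upd y j u i)).
    apply: (smooth_prim Cal (@proper_mx R d 1) (t := fun=> t) (th := fun=> th)
      (y := fun i u => upd y j u i)); [exact: Cn_cst|exact: Cn_cst|].
    by move=> i; rewrite /upd; case: eqP => _; [exact: Cn_id|exact: Cn_cst].
  exact: Cn_diff C.
have oscE : osc (al k) t th = fun y => th^-1 *: prim (al k) t th y.
  by apply/funext => y'; rewrite osc_scale.
have -> : derive1 (fun t' => osc (al k) t' th y) t =
    th^-1 *: 'd P (chart k t th y) ((1, 0, 0) : R * R * 'M[R]_(d, k.+1)).
  have -> : (fun t' => osc (al k) t' th y) = th^-1 \*: (fun t' => prim (al k) t' th y).
    by apply/funext => t'; rewrite osc_scale.
  by have [H1 H2] := prim_time_derive t th y; rewrite derive1E deriveZ// H2.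
under eq_bigr => j _.
  rewrite oscE nabla1; last exact: (@differentiableZ _ _ _ _ th^-1 _ (dprim j)).
  rewrite -deriveE; last exact: (@differentiableZ _ _ _ _ th^-1 _ (dprim j)).
  have [H1 H2] := prim_upd_derive t th y j (mean (al j) t y).
  rewrite (@deriveZ _ _ _ (fun u => prim (al k) t th (upd y j u)))// H2.
  over.
rewrite -scaler_sumr -scalerDr scalerA mulfV// scale1r /transport -/N NE.
have -> : ((1, 0, \sum_(j < k.+1) colmx j (mean (al j) t y)) : R * R * 'M[R]_(d, k.+1)) =
  \sum_(j < k.+1) ((0, 0, colmx j (mean (al j) t y)) : R * R * 'M[R]_(d, k.+1)) + (1, 0, 0).
  have S (s : seq 'I_k.+1) (F : 'I_k.+1 -> 'M[R]_(d, k.+1)) :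
      \sum_(j <- s) ((0, 0, F j) : R * R * 'M[R]_(d, k.+1)) = (0, 0, \sum_(j <- s) F j).
    elim: s => [|j s IH]; first by rewrite !big_nil.
    by rewrite !big_cons IH; congr (_, _, _); rewrite /= addr0.
  by rewrite S; congr (_, _, _); rewrite /= ?add0r ?addr0.
by rewrite linearD linear_sum.
Qed.

Lemma transport_periodic : periodic_field (al k) -> periodic_field transport.
Proof.
move=> alP t th y; have pP := prim_periodic Cal alP.
have PP u : P (u + (0, 2 * pi, 0)) = P u.
  by case: u => [[t' th'] N]; rewrite /P /unchart /= !addr0 pP.
rewrite /transport; set v := (1, 0, _).
have -> : chart k t (th + 2 * pi) y = chart k t th y + (0, 2 * pi, 0).
  by rewrite /chart; congr (_, _, _); rewrite /= addr0.
have H1 := deriveE v (PD (chart k t th y)).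
have H2 := deriveE v (PD (chart k t th y + (0, 2 * pi, 0))).
exact: (etrans (esym H2) (etrans (derive_periodic _ _ PP) H1)).
Qed.

End transport.

Lemma transport_depends_upto al k :
  (forall j, (j <= k)%N -> depends_upto j (fun t (_ : R) y => mean (al j) t y)) ->
  depends_upto k (transport al k).
Proof.
move=> alU t th y y' yy'; rewrite /transport /chart.
have -> : \matrix_(r < d, j < k.+1) y j r 0 = \matrix_(r < d, j < k.+1) y' j r 0 :> 'M[R]_(d, k.+1).
  by apply/matrixP => r j; rewrite !mxE yy'// -ltnS.
have -> // : \matrix_(r < d, j < k.+1) mean (al j) t y r 0 =
  \matrix_(r < d, j < k.+1) mean (al j) t y' r 0 :> 'M[R]_(d, k.+1).
apply/matrixP => r j; rewrite [LHS]mxE [RHS]mxE.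
have jk : (j <= k)%N by rewrite -ltnS.
have -> // : mean (al j) t y = mean (al j) t y'.
by apply: (alU j jk t th y y') => i ij; apply: yy'; exact: leq_trans jk.
Qed.

Lemma transport_smooth al k n : smooth_field n.+1 (al k) ->
  (forall j, (j <= k)%N -> smooth_field n (fun t _ y => mean (al j) t y)) ->
  smooth_field n (transport al k).
Proof.
move=> Cal Cm V pV t th y Ct Cth Cy.
apply: (Cn_diff_along (unchart_smooth k (smooth_prim Cal))).
  by apply: chart_smooth.
apply: (Cn_triple (Cn_cst _ _ (1 : R)) (Cn_cst _ _ (0 : R))); apply: Cn_mx => r j.
under eq_fun do rewrite mxE.
by apply: Cn_entry; apply: (Cm j _ V pV t th y) => //; rewrite -ltnS.
Qed.

End vector_fields.

(** * Regularity and periodicity of the fields of the recursion *)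

Section alpha_fields.
Context {R : realType} {d m : nat}.
Context (a : R -> R -> 'cV[R]_d -> 'cV[R]_d) (b : R -> 'cV[R]_d -> 'cV[R]_d).
Context (Z : R -> R -> 'cV[R]_d -> 'cV[R]_d).
Hypothesis a_Cb : forall i, Cb (axes_tx R d) m.+1
  (fun p : R * R * 'cV[R]_d => a p.1.1 p.1.2 p.2 i 0).
Hypothesis a_per : forall t x, periodic (fun th => a t th x) (2 * pi).
Hypothesis b_Cb : forall i, Cb (axes_x R d) m.+2 (fun p : R * 'cV[R]_d => b p.1 p.2 i 0).
Hypothesis Z_ode : forall (t th : R) (z : 'cV[R]_d),
  is_derive th (1 : R) (fun th' => Z t th' z) (b t (Z t th z)).
Hypothesis Z_init : forall t z, Z t 0 z = z.
Hypothesis Z_per : forall t z, periodic (fun th => Z t th z) (2 * pi).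

Local Notation alpha := (alpha a Z).
Local Notation A0C := (alpha0_smooth a_Cb b_Cb Z_ode Z_init).

Lemma alpha_depends_upto k : depends_upto k (alpha k).
Proof. by move=> t th y y'; exact: alpha_eq_upto. Qed.

Lemma mean_alpha_eq_upto k t y y' : (forall i, (i <= k)%N -> y i = y' i) ->
  mean (alpha k) t y = mean (alpha k) t y'.
Proof. by move=> yy'; apply: eq_mean => th; exact: alpha_eq_upto. Qed.

Lemma alphaS_eq k t th y : smooth_field 1 (alpha k) ->
  alpha k.+1 t th y =
    compsum k.+1 (alpha0 a Z t th) (y 0%N) (fun j => y j + prim (alpha j.-1) t th y)
    - transport alpha k t th y.
Proof.
move=> Cal; rewrite alpha_S -(transportE Cal (@alpha_depends_upto k)); congr (_ - _).
by apply: eq_compsum => j _; rewrite scale_osc.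
Qed.

(** At index [k + 1], [compsum] uses [k + 1] derivatives of [alpha0], available since
    [n + k + 1 <= m + 1], and [transport] one derivative of the previous primitive; each step of the
    recursion thus costs one order. *)
Lemma alpha_smooth k n : (n + k <= m.+1)%N -> smooth_field n (alpha k).
Proof.
elim/ltn_ind: k n => -[|k] IH n nk V pV t th y Ct Cth Cy.
  have C : Cn n (fun p : R * R * 'cV[R]_d => alpha0 a Z p.1.1 p.1.2 p.2).
    by apply: Cn_le A0C; rewrite addn0 in nk.
  exact: (Cn_comp (Cn_triple Ct Cth (Cy 0%N)) C).
have IH1 j : (j <= k)%N -> smooth_field n.+1 (alpha j).
  by move=> jk; apply: IH => //; rewrite addSn (leq_trans _ nk)// addnS ltnS leq_add2l.
have Ck1 : smooth_field 1 (alpha k).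
  by apply: IH => //; rewrite (leq_trans _ nk)// add1n leq_addl.
under eq_fun do rewrite (alphaS_eq _ _ _ Ck1).
apply: CnB.
  apply: (compsum_smooth (F := fun p : R * R * 'cV[R]_d => alpha0 a Z p.1.1 p.1.2 p.2)
    (u := fun p => (t p, th p))) => //.
  - exact: Cn_le A0C.
  - exact: (@Cn_pair _ _ _ R R).
  move=> j /andP[j0 jk]; apply: CnD; first exact: Cy.
  have jk1 : (j.-1 <= k)%N by rewrite -ltnS prednK.
  have Cp := smooth_field_le (depends_upto_prim (@alpha_depends_upto j.-1)) (leqnSn n)
    (smooth_prim (IH1 _ jk1)).
  exact: Cp.
apply: (transport_smooth (IH1 k (leqnn k))) => // j jk.
apply: (@smooth_field_le _ _ j n n.+1) => //; last exact: smooth_mean (IH1 j jk).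
by move=> t' th' z z'; exact: mean_alpha_eq_upto.
Qed.

Lemma alpha_smooth1 k : (k <= m)%N -> smooth_field 1 (alpha k).
Proof. by move=> km; apply: alpha_smooth; rewrite add1n ltnS. Qed.

Lemma alpha_periodic k : (k <= m)%N -> periodic_field (alpha k).
Proof.
elim/ltn_ind: k => -[|k] IH km t th y.
  by rewrite !alpha_0 (alpha0_periodic a_per Z_per).
have C1 := alpha_smooth1 (ltnW km).
rewrite (alphaS_eq t (th + 2 * pi) y C1) (alphaS_eq t th y C1).
rewrite (alpha0_periodic a_per Z_per t th).
have TP := transport_periodic C1 (IH k (ltnSn k) (ltnW km)).
rewrite (TP t th y).
congr (_ - _); apply: eq_compsum => j /andP[j0 jk].
have jk1 : (j.-1 <= k)%N by rewrite -ltnS prednK.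
have jm : (j.-1 <= m)%N by rewrite (leq_trans jk1)// ltnW.
have PP := prim_periodic (alpha_smooth1 jm) (IH j.-1 jk1 jm).
by rewrite (PP t th y).
Qed.

End alpha_fields.

(** * Uniform bounds for periodic fields *)

Section periodic_bounds.
Context {R : realType} {V W : normedModType R}.
Hypothesis pV : proper V.
Implicit Type F : R -> V -> W.

Lemma periodic_bounded F r : continuous (fun p : R * V => F p.1 p.2) ->
  (forall th y, F (th + 2 * pi) y = F th y) ->
  exists2 M : R, 0 <= M & forall th y, `|y| <= r -> `|F th y| <= M.
Proof.
move=> cF FP; have p0 : 0 <= 2 * pi :> R by rewrite mulr_ge0// pi_ge0.
have [M M0 H] := proper_bounded (proper_prod (@proper_real R) pV) (Num.max (2 * pi) r) cF.
exists M; first exact: M0.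
move=> th y yr; have [th0 /andP[th00 th01] ->] := periodic_reduce (fun th => FP th y) th.
by apply: (H (th0, y)); rewrite prod_norm_le !le_max ger0_norm// th01 yr orbT.
Qed.

Lemma periodic_lipschitz F r : Cn 1 (fun p : R * V => F p.1 p.2) ->
  (forall th y, F (th + 2 * pi) y = F th y) ->
  exists2 C : R, 0 <= C & forall th x y, `|x| <= r -> `|y| <= r ->
    `|F th y - F th x| <= C * `|y - x|.
Proof.
move=> cF FP; have p0 : 0 <= 2 * pi :> R by rewrite mulr_ge0// pi_ge0.
have [C C0 H] := C1_lipschitz (proper_prod (@proper_real R) pV) (Num.max (2 * pi) r) cF.
exists C; first exact: C0.
move=> th x y xr yr.
have gP t : F (t + 2 * pi) y - F (t + 2 * pi) x = F t y - F t x by rewrite !FP.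
have [th0 /andP[th00 th01] ->] := periodic_reduce gP th.
have B (z : V) : `|z| <= r -> `|(th0 : R, z)| <= Num.max (2 * pi) r.
  by move=> zr; rewrite prod_norm_le !le_max ger0_norm// th01 zr orbT.
apply: (le_trans (H (th0, x) (th0, y) (B x xr) (B y yr))); apply: ler_wpM2l => //.
have -> : (th0, y) - (th0, x) = (0, y - x) by congr pair; rewrite /= subrr.
by rewrite prod_norm_le normr0 normr_ge0 lexx.
Qed.

End periodic_bounds.

Lemma uniform_bound (R : realType) (I : finType) (P : I -> R -> Prop) :
  (forall i M N, M <= N -> P i M -> P i N) ->
  (forall i, exists2 M : R, 0 <= M & P i M) ->
  exists2 M : R, 0 <= M & forall i, P i M.
Proof.
move=> Pmono H.
have [M /all_and2[M0 PM]] : {M : I -> R & forall i, 0 <= M i /\ P i (M i)}.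
  apply: (@boolp.choice _ _ (fun i M => 0 <= M /\ P i M)) => i.
  by have [M M0 PM] := H i; exists M.
exists (\sum_i M i); first by rewrite sumr_ge0.
move=> i; apply: Pmono (PM i); rewrite (bigD1 i)//= lerDl.
exact: sumr_ge0.
Qed.

(** * Extension of functions from a compact interval *)

Section clamp.
Context {R : realType} (a b : R).
Hypothesis ab : a <= b.

(** Retraction onto [[a, b]]. The solutions are known only on the time interval; composing with
    [clamp] turns continuity within it into continuity on the line, to which the compactness lemmas
    and the calculus of [Cn 0] apply. *)
Definition clamp (t : R) : R := Num.max a (Num.min b t).

Lemma clamp_itv t : a <= clamp t <= b.
Proof. by rewrite /clamp le_max lexx ge_max ab ge_min lexx. Qed.

Lemma clamp_id t : a <= t <= b -> clamp t = t.
Proof. by move=> /andP[at' tb]; rewrite /clamp min_r// max_r. Qed.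

Lemma clamp_dist t u : `|clamp t - clamp u| <= `|t - u|.
Proof.
have ba : 0 <= b - a by rewrite subr_ge0.
rewrite /clamp; case: (leP b t) => H1; case: (leP b u) => H2; rewrite ?(max_r ab) ?subrr ?normr0//.
- by case: (leP a u) => H3; rewrite !ger0_norm; lra.
- by case: (leP a t) => H3; rewrite !ler0_norm; lra.
case: (leP a t) => H3; case: (leP a u) => H4 //.
- by rewrite !ger0_norm; lra.
- by rewrite !ler0_norm; lra.
- by rewrite subrr normr0.
Qed.

Lemma clamp_continuous : continuous clamp.
Proof.
apply/continuous_edP => t e e0; exists e; first exact: e0.
by move=> u ut; rewrite (le_trans (clamp_dist _ _))// ltW.
Qed.

Lemma within_clamp (V : normedModType R) (f : R -> V) :
  {within `[a, b], continuous f} -> continuous (fun t => f (clamp t)).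
Proof.
move=> /subspace_continuousP cf; apply/continuous_edP => t e e0.
have ct : (`[a, b]%classic : set R) (clamp t) by rewrite /= in_itv /= clamp_itv.
have /cvgrPdist_le/(_ _ e0) := cf _ ct.
rewrite near_withinE => /nbhs_ballP[k /= k0 Hk]; exists k; first exact: k0.
move=> u ut; rewrite distrC; apply: Hk; last by rewrite /= in_itv /= clamp_itv.
by rewrite /ball /= distrC (le_lt_trans (clamp_dist _ _)).
Qed.

Lemma continuous_within (V : normedModType R) (f g : R -> V) :
  (forall t, a <= t <= b -> f t = g t) -> continuous g -> {within `[a, b], continuous f}.
Proof.
move=> fg cg; apply: (@subspace_eq_continuous R `[a, b]%classic V g f); last exact: continuous_subspaceT.
by move=> t; rewrite inE /= in_itv /= => /fg.
Qed.

End clamp.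

Section field_bounds.
Context {R : realType} {d : nat}.
Implicit Types (f : vfield R d) (F : R -> R -> 'cV[R]_d -> 'cV[R]_d).

(** Brings the phase to the front, where the lemmas on periodic functions expect it. *)
Lemma Cn_swap n (V W : normedModType R) (F : R * R * V -> W) : Cn n F ->
  Cn n (fun p : R * (R * V) => F (p.2.1, p.1, p.2.2)).
Proof.
move=> CF; have C2 := Cn_snd n R (R * V)%type.
exact: (Cn_comp (Cn_triple (Cn_comp C2 (Cn_fst n R V)) (Cn_fst n R (R * V)%type)
  (Cn_comp C2 (Cn_snd n R V))) CF).
Qed.

Lemma field_bounded k n f r : depends_upto k f -> smooth_field n f -> periodic_field f ->
  exists2 M : R, 0 <= M & forall t th y, `|t| <= r -> (forall i, (i <= k)%N -> `|y i| <= r) ->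
    `|f t th y| <= M.
Proof.
move=> fk Cf fP.
have C : Cn n (fun p : R * (R * 'M[R]_(d, k.+1)) => unchart f (p.2.1, p.1, p.2.2)).
  exact: (Cn_swap (unchart_smooth k Cf)).
have P th (q : R * 'M[R]_(d, k.+1)) : unchart f (q.1, th + 2 * pi, q.2) = unchart f (q.1, th, q.2).
  by rewrite /unchart /= fP.
have [M M0 HM] := periodic_bounded (proper_prod (@proper_real R) (@proper_mx R d k.+1)) r
  (Cn_continuous C) P.
exists M; first exact: M0.
move=> t th y tr yr; have r0 : 0 <= r := le_trans (normr_ge0 _) tr.
have := HM th (t, \matrix_(i, j) y j i 0); rewrite -/(chart k t th y) (unchartK _ _ _ fk).
apply; rewrite prod_norm_le tr /=; apply/mx_norm_le => // i j.
by rewrite mxE (le_trans (mx_entry_le _ _ _))// yr// -ltnS.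
Qed.

Lemma state_lipschitz F r : Cn 1 (fun p : R * R * 'cV[R]_d => F p.1.1 p.1.2 p.2) ->
  (forall t th, F t (th + 2 * pi) = F t th) ->
  exists2 C : R, 0 <= C & forall t th x y, `|t| <= r -> `|x| <= r -> `|y| <= r ->
    `|F t th y - F t th x| <= C * `|y - x|.
Proof.
move=> CF FP; have P th (q : R * 'cV[R]_d) : F q.1 (th + 2 * pi) q.2 = F q.1 th q.2 by rewrite FP.
have [C C0 H] := periodic_lipschitz (proper_prod (@proper_real R) (@proper_mx R d 1)) r
  (F := fun th q => F q.1 th q.2) (Cn_swap CF) P.
exists C; first exact: C0.
move=> t th x y tr xr yr.
have := H th (t, x) (t, y); rewrite !prod_norm_le tr xr yr => /(_ isT isT) /= H1.
apply: (le_trans H1); apply: ler_wpM2l => //.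
have -> : ((t, y) - (t, x) : R * 'cV[R]_d) = (0, y - x) by congr pair; rewrite /= subrr.
by rewrite prod_norm_le normr0 normr_ge0 lexx.
Qed.

Lemma partials_bounded n F r : Cn n (fun p : R * R * 'cV[R]_d => F p.1.1 p.1.2 p.2) ->
  (forall t th, F t (th + 2 * pi) = F t th) ->
  exists2 M : R, 0 <= M & forall t th i l z, `|t| <= r -> (size l <= n)%N -> `|z| <= r ->
    `|partials l (fun y => F t th y i 0) z| <= M.
Proof.
move=> CF FP.
pose P (i : 'I_d) (k : 'I_n.+1) (l : k.-tuple 'I_d) M := forall t th z, `|t| <= r -> `|z| <= r ->
  `|partials l (fun y => F t th y i 0) z| <= M.
have Pi i k l : exists2 M, 0 <= M & @P i k l M.
  have C : Cn (n - k + size l) (fun p : R * R * 'cV[R]_d => F p.1.1 p.1.2 p.2 i 0).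
    by rewrite size_tuple subnK ?[(_ <= n)%N]ltn_ord//; [exact: Cn_entry | rewrite -ltnS].
  have Q th (q : R * 'cV[R]_d) :
      partials l (fun y => F q.1 (th + 2 * pi) y i 0) q.2 = partials l (fun y => F q.1 th y i 0) q.2.
    by rewrite FP.
  have [M M0 HM] := periodic_bounded (proper_prod (@proper_real R) (@proper_mx R d 1)) r
    (F := fun th q => partials l (fun y => F q.1 th y i 0) q.2)
    (Cn_continuous (Cn_swap (partials_smooth C))) Q.
  exists M; first exact: M0.
  by move=> t th z tr zr; apply: (HM th (t, z)); rewrite prod_norm_le tr.
have mono M N i k l : M <= N -> @P i k l M -> @P i k l N.
  by move=> MN H t th z tr zr; exact: le_trans (H t th z tr zr) MN.
have [M M0 H] : exists2 M, 0 <= M & forall i k l, @P i k l M.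
  apply: uniform_bound => [i M N MN H k l|i]; first exact: mono MN (H k l).
  apply: uniform_bound => [k M N MN H l|k]; first exact: mono MN (H l).
  by apply: uniform_bound => [l M N MN H|l]; [exact: mono MN H|exact: Pi].
exists M; first exact: M0.
by move=> t th i l z tr ln zr; exact: (H i (Ordinal (ln : (size l < n.+1)%N)) (in_tuple l) t th z tr zr).
Qed.

End field_bounds.

(** Chain rule along a solution of the averaged equations: time and slow variables give [transport],
    the phase gives [c] times the oscillating part of [al k]. With [c = eps^-1] the second term
    corrects the previous order. *)
Lemma prim_along {R : realType} {d : nat} (al : nat -> vfield R d) k (y : nat -> R -> 'cV[R]_d)
    (th : R -> R) t c : smooth_field 1 (al k) -> depends_upto k (al k) ->
  is_derive t (1 : R) th c ->
  (forall j, (j <= k)%N -> is_derive t (1 : R) (y j) (mean (al j) t (y^~ t))) ->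
  is_derive t (1 : R) (fun t => prim (al k) t (th t) (y^~ t))
    (transport al k t (th t) (y^~ t) + c *: (al k t (th t) (y^~ t) - mean (al k) t (y^~ t))).
Proof.
move=> Cal al_upto dth dy.
pose P := @unchart R d k (prim (al k)).
have PD u : differentiable P u := Cn_diff u (unchart_smooth k (smooth_prim Cal)).
pose N : 'M[R]_(d, k.+1) := \matrix_(r, j) mean (al j) t (y^~ t) r 0.
have dg : is_derive t (1 : R) (fun t => chart k t (th t) (y^~ t)) ((1, c, N) : R * R * 'M[R]_(d, k.+1)).
  apply: (@is_derive_pair _ (R * R)%type 'M[R]_(d, k.+1) (fun t => (t, th t))
    (fun t => \matrix_(r, j) y j t r 0)).
    exact: (@is_derive_pair _ R R id th).
  apply: is_derive_mx => i j; rewrite mxE.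
  under eq_fun do rewrite mxE.
  by apply: is_derive_entry; apply: dy; rewrite -ltnS.
have := is_derive_comp_diff (PD _) dg.
have -> : P \o (fun t => chart k t (th t) (y^~ t)) = fun t => prim (al k) t (th t) (y^~ t).
  by apply/funext => u /=; rewrite /P (unchartK _ _ _ (depends_upto_prim al_upto)).
set u0 := chart k t (th t) (y^~ t).
have -> : ((1, c, N) : R * R * 'M[R]_(d, k.+1)) =
    ((1, 0, N) : R * R * 'M[R]_(d, k.+1)) + c *: ((0, 1, 0) : R * R * 'M[R]_(d, k.+1)).
  by congr (_, _, _); rewrite /= ?scaler0 ?addr0 -?[_ *: 0]/(_ * 0) -?[_ *: 1]/(_ * 1) ?mulr0 ?mulr1 ?addr0 ?add0r.
rewrite linearD (linearZZ ('d P u0)).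
have H1 := diff_is_derive ((0, 1, 0) : R * R * 'M[R]_(d, k.+1)) (PD u0).
have H2 : is_derive (th t) (1 : R) (fun s => prim (al k) t s (y^~ t)) ('d P u0 (0, 1, 0)).
  have H3 := @is_derive_slice _ _ _ _ (fun q => P (q, \matrix_(r, j) y j t r 0)) t (th t) 1 _
    (@is_derive_slicel _ _ _ _ P _ _ _ _ H1).
  have <- : (fun s => P (t, s, \matrix_(r, j) y j t r 0)) = fun s => prim (al k) t s (y^~ t).
    apply/funext => s; exact: (unchartK t s (y^~ t) (depends_upto_prim al_upto)).
  exact: H3.
have [_ H4] := prim_derive t (th t) (y^~ t) Cal.
have [_ H5] := H2.
have -> : 'd P u0 (0, 1, 0) = al k t (th t) (y^~ t) - mean (al k) t (y^~ t).
  exact: etrans (esym H5) H4.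
exact.
Qed.

(* The oscillating parts produced by the correctors cancel order by order. *)
Lemma corrector_sum {R : realType} {V : lmodType R} (e : R) (N A T : nat -> V) n : e != 0 ->
  N 0%N + \sum_(i < n.+1)
     e ^+ i.+1 *: ((if (i < n)%N then N i.+1 else 0) + (T i + e^-1 *: (A i - N i))) =
  \sum_(i < n.+1) e ^+ i *: (if i == 0 :> nat then A 0%N else A i + T i.-1) + e ^+ n.+1 *: T n.
Proof.
move=> e0.
have step i : e ^+ i.+1 *: (e^-1 *: (A i - N i)) = e ^+ i *: (A i - N i).
  by rewrite scalerA exprSr mulfK.
have S k : (k <= n)%N -> N 0%N + \sum_(i < k)
     e ^+ i.+1 *: ((if (i < n)%N then N i.+1 else 0) + (T i + e^-1 *: (A i - N i))) =
  e ^+ k *: (N k - A k) + \sum_(i < k.+1) e ^+ i *: (if i == 0 :> nat then A 0%N else A i + T i.-1).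
  elim: k => [|k IH] kn.
    by rewrite big_ord0 big_ord_recl big_ord0 /= !scale1r !addr0 subrK.
  rewrite big_ord_recr /= addrA IH ?(ltnW kn)// [in RHS]big_ord_recr /= kn.
  rewrite (scalerDr _ (N k.+1)) (scalerDr _ (T k)) step; set U := \sum_(i < _) _; vring R V.
rewrite big_ord_recr /= addrA S// ltnn add0r (scalerDr _ (T n)) step.
set U := \sum_(i < _) _; vring R V.
Qed.

(** * The asymptotic expansion *)

(** Regularity is asked only of the terms that the field sees, whereas [smooth_field] asks it of all
    of them; beyond index [m] the functions [Y] are arbitrary. *)
Lemma smooth_field_comp {R : realType} {d k n : nat} (f : vfield R d) (V : normedModType R)
    (t th : V -> R) (y : nat -> V -> 'cV[R]_d) : depends_upto k f -> smooth_field n f ->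
  Cn n t -> Cn n th -> (forall i, (i <= k)%N -> Cn n (y i)) ->
  Cn n (fun p => f (t p) (th p) (fun i => y i p)).
Proof.
move=> fk Cf Ct Cth Cy.
have := Cn_comp (chart_smooth (k := k) Ct Cth Cy) (unchart_smooth k Cf).
by under eq_fun do rewrite (unchartK _ _ _ fk).
Qed.

Section expansion.
Context {R : realType} {d m : nat}.
Context (a : R -> R -> 'cV[R]_d -> 'cV[R]_d) (b : R -> 'cV[R]_d -> 'cV[R]_d).
Context (Z : R -> R -> 'cV[R]_d -> 'cV[R]_d).
Hypothesis a_Cb : forall i, Cb (axes_tx R d) m.+1
  (fun p : R * R * 'cV[R]_d => a p.1.1 p.1.2 p.2 i 0).
Hypothesis a_per : forall t x, periodic (fun th => a t th x) (2 * pi).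
Hypothesis b_Cb : forall i, Cb (axes_x R d) m.+2 (fun p : R * 'cV[R]_d => b p.1 p.2 i 0).
Hypothesis Z_ode : forall (t th : R) (z : 'cV[R]_d),
  is_derive th (1 : R) (fun th' => Z t th' z) (b t (Z t th z)).
Hypothesis Z_init : forall t z, Z t 0 z = z.
Hypothesis Z_per : forall t z, periodic (fun th => Z t th z) (2 * pi).
Context (x : 'cV[R]_d) (s T : R) (T_gt0 : 0 < T) (Y : nat -> R -> 'cV[R]_d).
Hypothesis Y_init : forall k, (k <= m)%N -> Y k s = if k == 0%N then x else 0.
Hypothesis Y_within : forall k, (k <= m)%N -> {within `[s, s + T], continuous (Y k)}.
Hypothesis Y_derive : forall k t, (k <= m)%N -> s < t < s + T ->
  is_derive t (1 : R) (Y k) (mean (alpha a Z k) t (Y^~ t)).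

Local Notation alpha := (alpha a Z).
Local Notation zetaC := (zeta_smooth b_Cb Z_ode Z_init).
Let alphaC k (km : (k <= m)%N) : smooth_field 1 (alpha k) :=
  alpha_smooth1 a_Cb b_Cb Z_ode Z_init km.
Let alphaP k (km : (k <= m)%N) : periodic_field (alpha k) :=
  alpha_periodic a_Cb a_per b_Cb Z_ode Z_init Z_per km.
Let alphaU k : depends_upto k (alpha k) := @alpha_depends_upto R d a Z k.
Let s_le : s <= s + T. Proof. by rewrite lerDl ltW. Qed.
Let tr : R := `|s| + T.

Let time_le t : s <= t <= s + T -> `|t| <= tr.
Proof.
move=> /andP[st tT]; rewrite /tr -(subrK s t) (le_trans (ler_normD _ _))//.
by rewrite addrC lerD2l ger0_norm ?subr_ge0// lerBlDl.
Qed.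

(* The [j]-th coefficient of the approximation of [Z t (- th) (X eps t)], at [th = (t - s) / eps]. *)
Definition coeff (t th : R) (j : nat) : 'cV[R]_d :=
  if j is i.+1 then (if (i < m)%N then Y j t else 0) + prim (alpha i) t th (Y^~ t) else Y 0%N t.

Definition approx (eps t : R) : 'cV[R]_d :=
  \sum_(j < m.+2) eps ^+ j *: coeff t ((t - s) / eps) j.

Lemma Y_bounded : exists2 r : R, 0 <= r & forall k t, (k <= m)%N -> s <= t <= s + T -> `|Y k t| <= r.
Proof.
have [r r0 H] : exists2 r : R, 0 <= r & forall (k : 'I_m.+1) t, s <= t <= s + T -> `|Y k t| <= r.
  apply: uniform_bound => [k M N MN H t st|k]; first exact: le_trans (H t st) MN.
  have km : (k <= m)%N by rewrite -ltnS.
  have [r r0 H] := proper_bounded (@proper_real R) tr (within_clamp s_le (Y_within km)).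
  exists r; first exact: r0.
  by move=> t st; have := H t (time_le st); rewrite clamp_id.
exists r; first exact: r0.
by move=> k t km st; exact: (H (Ordinal (km : (k < m.+1)%N)) t st).
Qed.

Lemma coeff_bounded : exists2 H : R, 0 <= H &
  forall t th j, s <= t <= s + T -> (j <= m.+1)%N -> `|coeff t th j| <= H.
Proof.
have [r r0 Yr] := Y_bounded.
have [M M0 HM] : exists2 M : R, 0 <= M & forall (k : 'I_m.+1) t th, s <= t <= s + T ->
    `|prim (alpha k) t th (Y^~ t)| <= M.
  apply: uniform_bound => [k M N MN H t th st|k]; first exact: le_trans (H t th st) MN.
  have km : (k <= m)%N by rewrite -ltnS.
  have [M M0 H] := field_bounded (tr + r) (depends_upto_prim (@alphaU k)) (smooth_prim (alphaC km))
    (prim_periodic (alphaC km) (alphaP km)).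
  exists M; first exact: M0.
  move=> t th st; apply: H => [|i ik]; first by rewrite (le_trans (time_le st))// lerDl.
  by rewrite (le_trans (Yr i t (leq_trans ik km) st))// lerDr addr_ge0// ltW.
exists (r + M); first exact: addr_ge0.
move=> t th [|i] st im /=; first by rewrite (le_trans (Yr 0%N t _ st))// lerDl.
rewrite (le_trans (ler_normD _ _))// lerD//; last exact: (HM (Ordinal (im : (i < m.+1)%N))).
by case: ifP => [im1|_]; [exact: Yr|rewrite normr0].
Qed.

Lemma coeff_continuous eps j : (j <= m.+1)%N ->
  continuous (fun t => coeff (clamp s (s + T) t) ((clamp s (s + T) t - s) / eps) j).
Proof.
move=> jm; set c := clamp s (s + T).
have cY k : (k <= m)%N -> Cn 0 (fun t => Y k (c t)) by move=> km; exact: (within_clamp s_le (Y_within km)).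
have cc : Cn 0 c := clamp_continuous s_le.
have cth : Cn 0 (fun t => (c t - s) / eps).
  by apply: (CnM (CnB cc (Cn_cst _ _ s)) (Cn_cst _ _ eps^-1)).
case: j jm => [_|i im]; first exact: cY.
apply: (@CnD _ 0); first by case: (ltnP i m) => im1; [exact: cY|exact: Cn_cst].
have pU := depends_upto_prim (@alphaU i).
have pC := smooth_field_le pU (leq0n 1) (smooth_prim (alphaC im)).
exact: (smooth_field_comp pU pC cc cth (fun j ji => cY j (leq_trans ji im))).
Qed.

Lemma approx_within eps : {within `[s, s + T], continuous (approx eps)}.
Proof.
apply: (@continuous_within _ _ _ _ _ (fun t => approx eps (clamp s (s + T) t))).
  by move=> t st; rewrite clamp_id.
apply: (@Cn_sum _ 0) => j _; apply: (@CnZ _ 0); first exact: Cn_cst.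
by apply: coeff_continuous; rewrite -ltnS.
Qed.

(** After [corrector_sum], the coefficient of [eps ^+ k] for [k > 0] is [alpha k] plus the transport
    term of index [k - 1], which by the recursion is the Taylor coefficient of [alpha0] at the
    approximation. Only the transport term of index [m] is left over. *)
Lemma approx_derive eps t : eps != 0 -> s < t < s + T ->
  is_derive t (1 : R) (approx eps)
   (\sum_(k < m.+1) eps ^+ k *:
     (if k == 0 :> nat then alpha0 a Z t ((t - s) / eps) (coeff t ((t - s) / eps) 0)
      else compsum k (alpha0 a Z t ((t - s) / eps)) (coeff t ((t - s) / eps) 0)
             (coeff t ((t - s) / eps)))
    + eps ^+ m.+1 *: transport alpha m t ((t - s) / eps) (Y^~ t)).
Proof.
move=> e0 st; set th := (t - s) / eps.
have dth : is_derive t (1 : R) (fun t => (t - s) / eps) eps^-1.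
  apply/is_derive_edP => e e1; exists 1 => // u _.
  rewrite -[u *: 1]/(u * 1) -[u *: _]/(u * _) (_ : _ - _ - _ = 0); last by ring.
  by rewrite normr0 mulr_ge0// ltW.
pose D i := transport alpha i t th (Y^~ t) + eps^-1 *: (alpha i t th (Y^~ t) - mean (alpha i) t (Y^~ t)).
have dp i : (i <= m)%N -> is_derive t (1 : R) (fun t => prim (alpha i) t ((t - s) / eps) (Y^~ t)) (D i).
  move=> im; apply: (prim_along (alphaC im) (@alphaU i) dth) => j ji.
  by apply: Y_derive => //; exact: leq_trans im.
pose dc j := if j is i.+1 then (if (i < m)%N then mean (alpha j) t (Y^~ t) else 0) + D i
             else mean (alpha 0) t (Y^~ t).
have dcoeff (j : 'I_m.+2) : is_derive t (1 : R) (fun t => coeff t ((t - s) / eps) j) (dc j).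
  case: j => -[|i] im /=; first exact: Y_derive.
  apply: is_deriveD; last exact: dp.
  by case: ltnP => im1; [exact: Y_derive|exact: is_derive_cst].
have -> : approx eps = \sum_(j < m.+2) (eps ^+ j \*: (fun t => coeff t ((t - s) / eps) j)).
  by apply/funext => u; rewrite /approx fct_sumE.
have H := is_derive_sum (fun j => is_deriveZ (eps ^+ j) (dcoeff j)).
have E := corrector_sum (fun i => mean (alpha i) t (Y^~ t)) (fun i => alpha i t th (Y^~ t))
  (fun i => transport alpha i t th (Y^~ t)) m e0.
suff <- : \sum_(j < m.+2) eps ^+ j *: dc j = \sum_(k < m.+1) eps ^+ k *:
     (if k == 0 :> nat then alpha0 a Z t th (coeff t th 0)
      else compsum k (alpha0 a Z t th) (coeff t th 0) (coeff t th))
    + eps ^+ m.+1 *: transport alpha m t th (Y^~ t) by exact: H.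
rewrite big_ord_recl /= scale1r; apply: (etrans E); congr (_ + _); apply: eq_bigr => -[[|k] km] _ //=.
congr (_ *: _); rewrite (alphaS_eq _ _ _ (alphaC (ltnW (km : (k < m)%N)))) subrK.
apply: eq_compsum => -[//|j] /andP[_ jk] /=.
by rewrite (leq_trans jk (km : (k < m)%N)).
Qed.

Let A0C : Cn m.+1 (fun p : R * R * 'cV[R]_d => alpha0 a Z p.1.1 p.1.2 p.2) :=
  alpha0_smooth a_Cb b_Cb Z_ode Z_init.
Let A0P t th : alpha0 a Z t (th + 2 * pi) = alpha0 a Z t th := alpha0_periodic a_per Z_per t th.

Let ZP t th : Z t (th + 2 * pi) = Z t th.
Proof. by apply/funext => z; exact: Z_per. Qed.

Let slice_smooth n (F : R -> R -> 'cV[R]_d -> 'cV[R]_d) t th :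
  Cn n (fun p : R * R * 'cV[R]_d => F p.1.1 p.1.2 p.2) -> Cn n (F t th).
Proof.
move=> CF.
exact: (Cn_comp (Cn_triple (Cn_cst n 'cV[R]_d t) (Cn_cst n 'cV[R]_d th) (Cn_id n 'cV[R]_d)) CF).
Qed.

(** Used twice: for [alpha0], to measure the defect of the approximation, and for [Z], to read off
    the profiles. *)
Let compsum_expansion F : Cn m.+1 (fun p : R * R * 'cV[R]_d => F p.1.1 p.1.2 p.2) ->
  (forall t th, F t (th + 2 * pi) = F t th) ->
  exists2 C : R, 0 <= C & forall eps t, 0 < eps <= 1 -> s <= t <= s + T ->
  `|F t ((t - s) / eps) (approx eps t) - \sum_(k < m.+1) eps ^+ k *:
     (if k == 0 :> nat then F t ((t - s) / eps) (coeff t ((t - s) / eps) 0)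
      else compsum k (F t ((t - s) / eps)) (coeff t ((t - s) / eps) 0)
             (coeff t ((t - s) / eps)))| <= C * eps ^+ m.+1.
Proof.
move=> CF FP; have [H H0 cH] := coeff_bounded.
have mH0 : 0 <= m.+2%:R * H by rewrite mulr_ge0.
have [M M0 HM] := partials_bounded (tr + m.+2%:R * H) CF FP.
have [C C0 HC] := @compsum_taylor R d m M H M0 H0; exists C; first exact: C0.
move=> eps t /andP[e0 e1] st; apply: HC.
- by rewrite (ltW e0) e1.
- exact: slice_smooth.
- by move=> j jm; exact: cH.
move=> i l z lm zH; apply: HM => //.
  by rewrite (le_trans (time_le st))// lerDl.
by rewrite (le_trans zH)// lerDr addr_ge0// ltW.
Qed.

Let approx_bounded : exists2 K : R, 0 <= K & forall eps t, 0 < eps <= 1 ->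
  s <= t <= s + T -> `|approx eps t| <= K.
Proof.
have [H H0 cH] := coeff_bounded; exists (m.+2%:R * H); first by rewrite mulr_ge0.
move=> eps t /andP[e0 e1] st; rewrite (le_trans (ler_norm_sum _ _ _))//.
have -> : m.+2%:R * H = \sum_(j < m.+2) H by rewrite sumr_const card_ord mulr_natl.
apply: ler_sum => j _; rewrite normrZ normrX (gtr0_norm e0) -[leRHS]mul1r.
by rewrite ler_pM ?exprn_ge0 ?(ltW e0)// ?exprn_ile1 ?(ltW e0)// cH// -ltnS.
Qed.

Context (X : R -> R -> 'cV[R]_d).
Hypothesis X_sol : forall eps, 0 < eps ->
  solves_on s T (fun t z => a t ((t - s) / eps) z + eps^-1 *: b t z) x (X eps).

Let back eps t := Z t (- ((t - s) / eps)) (X eps t).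

Let back_init eps : 0 < eps -> back eps s = x.
Proof.
by move=> /X_sol[Xs _ _]; rewrite /back subrr mul0r oppr0 Z_init.
Qed.

Lemma X_within eps : 0 < eps -> {within `[s, s + T], continuous (X eps)}.
Proof. by move=> /X_sol[]. Qed.

Let back_within eps : 0 < eps -> {within `[s, s + T], continuous (back eps)}.
Proof.
move=> e0; apply: (@continuous_within _ _ _ _ _ (fun t => back eps (clamp s (s + T) t))).
  by move=> t st; rewrite clamp_id.
have cc : Cn 0 (clamp s (s + T)) := clamp_continuous s_le.
have cX : Cn 0 (fun t => X eps (clamp s (s + T) t)) := within_clamp s_le (X_within e0).
have cth : Cn 0 (fun t => - ((clamp s (s + T) t - s) / eps)).
  by apply: CnN; apply: (CnM (CnB cc (Cn_cst _ _ s)) (Cn_cst _ _ eps^-1)).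
exact: (Cn_comp (Cn_triple cc cth cX) (Cn_le (leq0n _) zetaC)).
Qed.

Let back_derive eps t : 0 < eps -> s < t < s + T ->
  is_derive t (1 : R) (back eps) (alpha0 a Z t ((t - s) / eps) (back eps t)).
Proof.
move=> e0 st; have [_ _ dX] := X_sol e0.
apply: (backward_flow_ode b_Cb Z_ode Z_init); first by rewrite gt_eqF.
by apply: dX; rewrite in_itv /= st.
Qed.

(** The global bound on [alpha0] gives a bound for every [eps > 0], large values included. *)
Let back_bounded : exists2 K : R, 0 <= K & forall eps t, 0 < eps -> s <= t <= s + T ->
  `|back eps t| <= K.
Proof.
have [A A0 HA] := alpha0_bounded a_Cb b_Cb Z_ode Z_init Z_per.
exists (`|x| + A * T); first by rewrite addr_ge0// mulr_ge0// ltW.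
move=> eps t e0 st.
have := @gronwall _ _ (back eps) (fun t => alpha0 a Z t ((t - s) / eps) (back eps t))
  0 A s (s + T) (lexx _) A0 (back_within e0) (fun t => @back_derive eps t e0).
rewrite mul0r expR0 mulr1 (back_init e0) (addrC s) addrK => H.
by rewrite (addrC s) in st; apply: H st => u _; rewrite mul0r add0r.
Qed.

(** Gronwall's inequality with [L] a Lipschitz constant of [alpha0] on a ball containing both
    curves; the defect is [C * eps ^+ m.+1] from the Taylor expansion plus [M * eps ^+ m.+1] from
    the remaining transport term. *)
Lemma approx_error : exists2 C : R, 0 <= C & forall eps t, 0 < eps <= 1 -> s <= t <= s + T ->
  `|Z t (- ((t - s) / eps)) (X eps t) - approx eps t| <= C * eps ^+ m.+1.
Proof.
have [K K0 HK] := back_bounded; have [K' K'0 HK'] := approx_bounded.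
have [L L0 HL] := state_lipschitz (tr + (K + K')) (Cn_le (isT : (1 <= m.+1)%N) A0C) A0P.
have [C C0 HC] := compsum_expansion A0C A0P.
have [r r0 Yr] := Y_bounded.
have [M M0 HM] : exists2 M : R, 0 <= M & forall t th, s <= t <= s + T ->
    `|transport alpha m t th (Y^~ t)| <= M.
  have mU k : depends_upto k (fun t (_ : R) y => mean (alpha k) t y).
    by move=> t _ y y' yy'; exact: mean_alpha_eq_upto.
  have TC : smooth_field 0 (transport alpha m).
    apply: (transport_smooth (alphaC (leqnn m))) => k km.
    exact: (smooth_field_le (mU k) (leq0n 1) (smooth_mean (alphaC km))).
  have [M M0 H] := field_bounded (tr + r) (transport_depends_upto (fun k _ => mU k)) TC
    (transport_periodic (alphaC (leqnn m)) (alphaP (leqnn m))).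
  exists M; first exact: M0.
  move=> t th st; apply: H => [|i im]; first by rewrite (le_trans (time_le st))// lerDl.
  by rewrite (le_trans (Yr i t im st))// lerDr addr_ge0// ltW.
exists ((C + M) * T * expR (L * T)); first by rewrite !mulr_ge0// ?addr_ge0 ?expR_ge0// ltW.
move=> eps t e01 st; have /andP[e0 e1] := e01.
pose err t := back eps t - approx eps t.
have cerr : {within `[s, s + T], continuous err}.
  by move=> u; apply: cvgB; [exact: (back_within e0)|exact: approx_within].
have derr u (su : s < u < s + T) := is_deriveB (back_derive e0 su) (approx_derive (lt0r_neq0 e0) su).
(* At [t = s] the phase is 0, where all correctors vanish, so both curves start at [x]. *)
have err0 : err s = 0.
  rewrite /err (back_init e0) /approx big_ord_recl big1 => [|j _].
    by rewrite scale1r addr0 /= (Y_init (leq0n m)) subrr.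
  rewrite /= subrr mul0r prim0 addr0; case: ifP => [jm|_]; last by rewrite scaler0.
  by rewrite (Y_init jm) scaler0.
have := gronwall L0 (_ : 0 <= (C + M) * eps ^+ m.+1) cerr derr.
have -> : s + T - s = T by rewrite addrC addKr.
rewrite err0 normr0 add0r => H.
have -> : (C + M) * T * expR (L * T) * eps ^+ m.+1 = (C + M) * eps ^+ m.+1 * T * expR (L * T) by ring.
apply: H st; first by rewrite mulr_ge0 ?addr_ge0// exprn_ge0// ltW.
move=> u su.
have su' : s <= u <= s + T by case/andP: su => /ltW -> /ltW ->.
set th := (u - s) / eps; set S := \sum_(k < _) _.
set P := alpha0 a Z u th (back eps u); set Q := alpha0 a Z u th (approx eps u).
set W := transport _ _ _ _ _.
have -> : P - (S + eps ^+ m.+1 *: W) = (P - Q) + ((Q - S) - eps ^+ m.+1 *: W).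
  by vring R 'cV[R]_d.
rewrite (le_trans (ler_normD _ _))// lerD//.
  have kk v : `|v| <= K + K' -> `|v| <= tr + (K + K').
    by move=> vK; rewrite (le_trans vK)// lerDr addr_ge0// ltW.
  apply: HL.
  - by rewrite (le_trans (time_le su'))// lerDl addr_ge0.
  - by apply: kk; rewrite (le_trans (HK' eps u e01 su'))// lerDr.
  - by apply: kk; rewrite (le_trans (HK eps u e0 su'))// lerDl.
rewrite (le_trans (ler_normB _ _))// mulrDl lerD//; first exact: HC.
rewrite normrZ normrX (gtr0_norm e0) mulrC ler_wpM2r//; last exact: HM.
by rewrite exprn_ge0// ltW.
Qed.

(** The profile as a function of its coefficients: the vectors H^j are passed in place of [y j]. In
    this form it is a field, to which the uniform bounds apply. *)
Definition profile k : vfield R d := fun t th y =>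
  if k is 0 then Z t th (y 0%N) else compsum k (Z t th) (y 0%N) y.

Lemma profile_smooth k : (k <= m)%N -> smooth_field 0 (profile k).
Proof.
case: k => [|k] km V pV t th y Ct Cth Cy.
  exact: (Cn_comp (Cn_triple Ct Cth (Cy 0%N)) (Cn_le (leq0n _) zetaC)).
apply: (@compsum_smooth _ _ 0 k.+1 _ _ (zeta Z) (fun p => (t p, th p)) (y 0%N) y).
- by apply: Cn_le zetaC; rewrite add0n (leq_trans km)// -addn2 leq_addr.
- exact: (@Cn_pair _ _ _ R R).
- exact: Cy.
- by move=> j _; exact: Cy.
Qed.

Lemma profile_depends_upto k : depends_upto k (profile k).
Proof.
case: k => [|k] t th y y' yy' /=; rewrite (yy' 0%N)//.
by apply: eq_compsum => j /andP[_ jk]; exact: yy'.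
Qed.

Lemma profile_periodic k : periodic_field (profile k).
Proof. by move=> t th y; rewrite /profile ZP. Qed.

Lemma Xprofile_coeff k t th : (k <= m)%N ->
  Xprofile a Z Y k t th = profile k t th (coeff t th).
Proof.
case: k => [//|k] km; apply: eq_compsum => -[//|j] /andP[_ jk] /=.
by rewrite (leq_trans jk km) scale_osc.
Qed.

Lemma Xprofile_bounded : exists2 P : R, 0 <= P & forall k t th, (k <= m)%N -> s <= t <= s + T ->
  `|Xprofile a Z Y k t th| <= P.
Proof.
have [H H0 cH] := coeff_bounded.
have [P P0 HP] : exists2 P : R, 0 <= P & forall (k : 'I_m.+1) t th, s <= t <= s + T ->
    `|Xprofile a Z Y k t th| <= P.
  apply: uniform_bound => [k M N MN HM t th st|k]; first exact: le_trans (HM t th st) MN.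
  have km : (k <= m)%N by rewrite -ltnS.
  have [P P0 HP] := field_bounded (tr + H) (@profile_depends_upto k) (profile_smooth km)
    (@profile_periodic k).
  exists P; first exact: P0.
  move=> t th st; rewrite (Xprofile_coeff _ _ km); apply: HP => [|i ik].
    by rewrite (le_trans (time_le st))// lerDl.
  rewrite (le_trans (cH t th i st _)) ?(leq_trans ik (leqW km))//.
  by rewrite lerDr addr_ge0// ltW.
exists P; first exact: P0.
by move=> k t th km st; exact: (HP (Ordinal (km : (k < m.+1)%N))).
Qed.

Lemma Xprofile_within k eps : (k <= m)%N ->
  {within `[s, s + T], continuous (fun t => Xprofile a Z Y k t ((t - s) / eps))}.
Proof.
move=> km; set c := clamp s (s + T).
apply: (@continuous_within _ _ _ _ _
  (fun t => profile k (c t) ((c t - s) / eps) (coeff (c t) ((c t - s) / eps)))).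
  by move=> t st; rewrite (Xprofile_coeff _ _ km) /c clamp_id.
have cc : Cn 0 c := clamp_continuous s_le.
have cth : Cn 0 (fun t => (c t - s) / eps).
  by apply: (CnM (CnB cc (Cn_cst _ _ s)) (Cn_cst _ _ eps^-1)).
have H := (@smooth_field_comp R d k 0 (profile k) R c (fun t => (c t - s) / eps)
  (fun j t => coeff (c t) ((c t - s) / eps) j) (@profile_depends_upto k) (profile_smooth km) cc cth
  (fun j jk => @coeff_continuous eps j (leq_trans jk (leqW km)))).
exact H.
Qed.

(** [X] is recovered from the bounded curve [back] by [Z], which is [profile 0] and periodic in the
    phase. *)
Lemma X_bounded : exists2 K : R, 0 <= K & forall eps t, 0 < eps -> s <= t <= s + T ->
  `|X eps t| <= K.
Proof.
have [K K0 HK] := back_bounded.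
have [M M0 HM] := field_bounded (tr + K) (@profile_depends_upto 0) (profile_smooth (leq0n m))
  (@profile_periodic 0).
exists M; first exact: M0.
move=> eps t e0 st; rewrite -(ZVK b_Cb Z_ode Z_init t ((t - s) / eps) (X eps t)).
apply: (HM t _ (fun=> back eps t)) => [|i _]; first by rewrite (le_trans (time_le st))// lerDl.
by rewrite (le_trans (HK eps t e0 st))// lerDr addr_ge0// ltW.
Qed.

Lemma expansion_error : exists2 C : R, 0 <= C & forall eps t, 0 < eps <= 1 -> s <= t <= s + T ->
  `|X eps t - \sum_(i < m.+1) eps ^+ i *: Xprofile a Z Y i t ((t - s) / eps)| <= C * eps ^+ m.+1.
Proof.
have [K K0 HK] := back_bounded; have [K' K'0 HK'] := approx_bounded.
have [L L0 HL] := state_lipschitz (tr + (K + K')) (Cn_le (isT : (1 <= m.+2)%N) zetaC) ZP.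
have [C C0 HC] := compsum_expansion (Cn_le (leqnSn _) zetaC) ZP.
have [D D0 HD] := approx_error.
exists (L * D + C); first by rewrite addr_ge0// mulr_ge0.
move=> eps t e01 st; have /andP[e0 e1] := e01.
rewrite -{1}(ZVK b_Cb Z_ode Z_init t ((t - s) / eps) (X eps t)) -/(back eps t).
rewrite -(subrKA (Z t ((t - s) / eps) (approx eps t))) [leRHS]mulrDl (le_trans (ler_normD _ _))// lerD//.
  have kk v : `|v| <= K + K' -> `|v| <= tr + (K + K').
    by move=> vK; rewrite (le_trans vK)// lerDr addr_ge0// ltW.
  rewrite -mulrA (le_trans (HL t _ (approx eps t) (back eps t) _ _ _))//.
  - by rewrite (le_trans (time_le st))// lerDl addr_ge0.
  - by apply: kk; rewrite (le_trans (HK' eps t e01 st))// lerDr.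
  - by apply: kk; rewrite (le_trans (HK eps t e0 st))// lerDl.
  by rewrite ler_wpM2l// HD.
have := HC eps t e01 st; congr (`|_ - _| <= _); apply: eq_bigr => -[k km] _.
by rewrite (Xprofile_coeff _ _ (km : (k <= m)%N)); case: k km.
Qed.

(** The full expansion to order [m] is used for every [k]: after division by [eps ^+ k] its error is
    at most [C * eps], and the profiles of index between [k + 1] and [m], at most [m] of them,
    contribute at most [P * eps] each. *)
Lemma Xrem_error : exists2 C : R, 0 <= C & forall k eps t, (k <= m)%N -> 0 < eps <= 1 ->
  s <= t <= s + T ->
  `|Xrem a Z Y s X k eps t - Xprofile a Z Y k t ((t - s) / eps)| <= C * eps.
Proof.
have [C C0 HC] := expansion_error; have [P P0 HP] := Xprofile_bounded.
exists (C + P *+ m); first by rewrite addr_ge0// mulrn_wge0.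
move=> k eps t km e01 st; have /andP[e0 e1] := e01.
have ek0 : 0 < eps ^+ k by rewrite exprn_gt0.
set p := fun i : nat => Xprofile a Z Y i t ((t - s) / eps).
have E : Xrem a Z Y s X k eps t - p k = (eps ^+ k)^-1 *:
   ((X eps t - \sum_(i < m.+1) eps ^+ i *: p i) + \sum_(k.+1 <= i < m.+1) eps ^+ i *: p i).
  rewrite -(big_mkord xpredT (fun i => eps ^+ i *: p i)) (big_cat_nat (n := k.+1))//=.
  rewrite big_mkord big_ord_recr /= /Xrem -/p.
  rewrite -{1}[p k]scale1r -{1}(mulVf (lt0r_neq0 ek0)) -scalerA -scalerBr; congr (_ *: _).
  set A := \sum_(i < k) _; set B := \sum_(_ <= i < _) _; set Q := eps ^+ k *: p k.
  by vring R 'cV[R]_d.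
rewrite E normrZ gtr0_norm ?invr_gt0// mulrC ler_pdivrMr// -mulrA -exprS.
have pe i : (k < i)%N -> eps ^+ i <= eps ^+ k.+1 by move=> ki; rewrite ler_wiXn2l// ltW.
rewrite (le_trans (ler_normD _ _))// mulrDl lerD//.
  by rewrite (le_trans (HC eps t e01 st))// ler_wpM2l// pe.
rewrite big_nat (le_trans (ler_norm_sum _ _ _))//.
apply: (@le_trans _ _ (\sum_(k.+1 <= i < m.+1) P * eps ^+ k.+1)); last first.
  rewrite sumr_const_nat -mulrnAl ler_wpM2r ?exprn_ge0 ?(ltW e0)//.
  by rewrite ler_wpMn2l// subSS leq_subr.
rewrite [leRHS]big_nat; apply: ler_sum => i /andP[ki im].
rewrite normrZ mulrC ler_pM// ?HP//.
by rewrite normrX (gtr0_norm e0) pe.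
Qed.

(** For [eps <= 1] the profile and [Xrem_error] give the bound. For [eps > 1] the expansion says
    nothing, but division by [eps ^+ k] absorbs each factor [eps ^+ i] with [i < k], and [X] is
    bounded independently of [eps]. *)
Lemma Xrem_bounded : exists2 K : R, 0 <= K & forall k eps t, (k <= m)%N -> 0 < eps ->
  s <= t <= s + T -> `|Xrem a Z Y s X k eps t| <= K.
Proof.
have [C C0 HC] := Xrem_error; have [P P0 HP] := Xprofile_bounded; have [K K0 HK] := X_bounded.
exists (C + P + (K + P *+ m)); first by rewrite !addr_ge0// mulrn_wge0.
move=> k eps t km e0 st; have [e1|/ltW e1] := leP eps 1.
  rewrite -(subrK (Xprofile a Z Y k t ((t - s) / eps)) (Xrem _ _ _ _ _ _ _ _)).
  rewrite (le_trans (ler_normD _ _))// -[leLHS]addr0 lerD//; last by rewrite addr_ge0// mulrn_wge0.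
  rewrite lerD ?HP// (le_trans (HC k eps t km _ st)) ?e0//.
  by rewrite -[leRHS]mulr1 ler_wpM2l.
have ek0 : 0 < eps ^+ k by rewrite exprn_gt0.
rewrite /Xrem normrZ gtr0_norm ?invr_gt0// mulrC ler_pdivrMr//.
have ek1 : 1 <= eps ^+ k by rewrite exprn_ege1.
apply: (@le_trans _ _ ((K + P *+ m) * eps ^+ k)); last first.
  by rewrite ler_wpM2r ?(ltW ek0)// lerDr addr_ge0.
rewrite (le_trans (ler_normB _ _))// [leRHS]mulrDl lerD//.
  by rewrite (le_trans (HK eps t e0 st))// -[leLHS]mulr1 ler_wpM2l.
rewrite (le_trans (ler_norm_sum _ _ _))//.
apply: (@le_trans _ _ (\sum_(i < k) P * eps ^+ k)); last first.
  by rewrite sumr_const card_ord -mulrnAl ler_wpM2r ?(ltW ek0)// ler_wpMn2l.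
apply: ler_sum => i _; rewrite normrZ mulrC ler_pM// ?HP//.
  by rewrite (leq_trans (ltnW (ltn_ord i)) km).
by rewrite normrX (gtr0_norm e0) ler_weXn2l// ltnW.
Qed.

Lemma Xrem_within k eps : (k <= m)%N -> 0 < eps ->
  {within `[s, s + T], continuous (Xrem a Z Y s X k eps)}.
Proof.
move=> km e0; set c := clamp s (s + T).
apply: (@continuous_within _ _ _ _ _ (fun t => Xrem a Z Y s X k eps (c t))).
  by move=> t st; rewrite /c clamp_id.
apply: (@CnZ _ 0); first exact: Cn_cst.
apply: (@CnB _ 0); first exact: (within_clamp s_le (X_within e0)).
apply: (@Cn_sum _ 0) => i _; apply: (@CnZ _ 0); first exact: Cn_cst.
have im : (i <= m)%N := leq_trans (ltnW (ltn_ord i)) km.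
have H := @within_clamp _ _ _ s_le _ (fun t => Xprofile a Z Y i t ((t - s) / eps))
  (@Xprofile_within i eps im).
exact H.
Qed.

End expansion.

(** * Euclidean norm and essential supremum on the time interval *)

Section euclidean_norm.
Context {R : realType} {d : nat}.
Implicit Types v : 'cV[R]_d.

Lemma enorm_ge0 v : 0 <= enorm v.
Proof. exact: sqrtr_ge0. Qed.

Lemma enorm_le v : enorm v <= Num.sqrt d%:R * `|v|.
Proof.
rewrite -[leRHS]ger0_norm ?mulr_ge0 ?sqrtr_ge0// -sqrtr_sqr exprMn sqr_sqrtr// /enorm.
rewrite ler_wsqrtr//; have -> : d%:R * `|v| ^+ 2 = \sum_(i < d) `|v| ^+ 2.
  by rewrite sumr_const card_ord mulr_natl.
apply: ler_sum => i _; rewrite -[v i 0 ^+ 2]real_normK ?num_real//.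
by rewrite lerXn2r ?nnegrE// mx_entry_le.
Qed.

Lemma Lnorm_oo_le (u v M : R) (F : R -> 'cV[R]_d) : 0 <= M ->
  (forall t, u <= t <= v -> enorm (F t) <= M) ->
  (Lnorm (mrestr lebesgue_measure (measurable_itv `[u, v])) +oo
     (fun t => (enorm (F t))%:E) <= M%:E)%E.
Proof.
(* The second branch of [Lnorm] at [+oo] is the value 0; in the first one the complement of the
   interval is a null set of the restricted measure. *)
move=> M0 FM; rewrite unlock; case: ifP => [_|_]; last by rewrite lee_fin.
apply/ess_supP; exists (~` `[u, v]); split.
- by apply: measurableC; exact: measurable_itv.
- by rewrite /= /mrestr setICl measure0.
move=> t /= H; rewrite in_itv /= => uv; apply: H => /=.
by rewrite lee_fin ger0_norm ?enorm_ge0// FM.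
Qed.

End euclidean_norm.

Theorem theorem1p3 (R : realType) (d m : nat)
    (a : R -> R -> 'cV[R]_d -> 'cV[R]_d)
    (b : R -> 'cV[R]_d -> 'cV[R]_d)
    (Z : R -> R -> 'cV[R]_d -> 'cV[R]_d)
    (d_ge1 : (1 <= d)%N)
    (a_Cb : forall i, Cb (axes_tx R d) m.+1
              (fun p : R * R * 'cV[R]_d => a p.1.1 p.1.2 p.2 i 0))
    (a_per : forall t x, periodic (fun th => a t th x) (2 * pi))
    (b_Cb : forall i, Cb (axes_x R d) m.+2
              (fun p : R * 'cV[R]_d => b p.1 p.2 i 0))
    (Z_ode : forall (t th : R) (z : 'cV[R]_d),
       is_derive th (1 : R) (fun th' => Z t th' z) (b t (Z t th z)))
    (Z_init : forall t z, Z t 0 z = z)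
    (Z_per : forall t z, periodic (fun th => Z t th z) (2 * pi))
    (x : 'cV[R]_d) (s T : R) (T_gt0 : 0 < T)
    (X : R -> R -> 'cV[R]_d)
    (X_sol : forall eps, 0 < eps ->
       solves_on s T
         (fun t z => a t ((t - s) / eps) z + eps^-1 *: b t z) x (X eps))
    (Y : nat -> R -> 'cV[R]_d)
    (Y0_sol : solves_on s T
       (fun t z => abar a Z 0 t (upd (Y ^~ t) 0%N z)) x (Y 0%N))
    (Yk_sol : forall k, (1 <= k <= m)%N ->
       solves_on s T (fun t z => abar a Z k t (upd (Y ^~ t) k z)) 0 (Y k)) :
  forall k, (1 <= k <= m)%N ->
    bounded_in_Linfty s (s + T) (Xrem a Z Y s X k) /\
    (ereal_sup [set (enorm (Xrem a Z Y s X k eps t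
                            - Xprofile a Z Y k t ((t - s) / eps)))%:E
               | t in `[s, s + T]])
      @[eps --> 0^'+] --> 0%:E.
Proof.
move=> k /andP[_ km].
have Y_sol j : (j <= m)%N -> solves_on s T (fun t z => abar a Z j t (upd (Y ^~ t) j z))
    (if j == 0%N then x else 0) (Y j).
  by case: j => [|j] jm; [exact: Y0_sol|exact: Yk_sol].
have Y_init j : (j <= m)%N -> Y j s = if j == 0%N then x else 0 by move=> /Y_sol[].
have Y_within j : (j <= m)%N -> {within `[s, s + T], continuous (Y j)} by move=> /Y_sol[].
have Y_derive j t : (j <= m)%N -> s < t < s + T ->
    is_derive t (1 : R) (Y j) (mean (alpha a Z j) t (Y^~ t)).
  move=> /Y_sol[_ _ H] st; have := H t; rewrite in_itv /= st => /(_ isT).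
  have -> // : upd (Y^~ t) j (Y j t) = Y^~ t.
  by apply/funext => i; rewrite /upd; case: eqP => [->|].
have c0 : 0 <= Num.sqrt (d%:R : R) := sqrtr_ge0 _.
split.
  split=> [eps e0 i|].
    apply: subspace_continuous_measurable_fun; first exact: measurable_itv.
    have cX := Xrem_within a_Cb b_Cb Z_ode Z_init T_gt0 Y_within X_sol km e0.
    move=> t; apply: (continuous_comp (g := fun v : 'cV[R]_d => v i 0) (cX t)).
    exact: (Cn_continuous (Cn_entry i 0 (Cn_id 0 'cV[R]_d))).
  have [K K0 HK] := Xrem_bounded a_Cb a_per b_Cb Z_ode Z_init Z_per T_gt0 Y_init Y_within
    Y_derive X_sol.
  exists (Num.sqrt d%:R * K) => eps e0; apply: Lnorm_oo_le; first exact: mulr_ge0.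
  by move=> t st; rewrite (le_trans (enorm_le _))// ler_wpM2l// HK.
have [C C0 HC] := Xrem_error a_Cb a_per b_Cb Z_ode Z_init Z_per T_gt0 Y_init Y_within
  Y_derive X_sol.
apply: (@squeeze_cvge _ _ _ _ (fun=> 0%E) _ (fun eps => (Num.sqrt d%:R * (C * eps))%:E)); last 2 first.
- exact: cvg_cst.
- apply: cvg_EFin; first exact: nearW.
  apply: cvg_at_right_filter; rewrite -[X in _ --> X](mulr0 (Num.sqrt (d%:R : R))).
  by apply: cvgMr; rewrite -[X in _ --> X](mulr0 C); apply: cvgMr; exact: cvg_id.
near=> eps.
have e0 : 0 < eps by [].
have e1 : eps <= 1 by near: eps; exact: nbhs_right_le.
(* The supremum is nonnegative because the set contains the value at [t = s]; over an empty set it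
   would be [-oo]. *)
apply/andP; split.
  apply: ereal_sup_ge; eexists; first by exists s => //; rewrite /= in_itv /= lexx lerDl ltW.
  by rewrite lee_fin enorm_ge0.
apply: ub_ereal_sup => _ [t st <-]; rewrite lee_fin (le_trans (enorm_le _))//.
by rewrite ler_wpM2l// HC ?e0//.
Unshelve. all: by end_near. Qed.
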